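(* Let $U\subset\mathbb{R}^2$ be a domain with Poisson bivector field $\alpha^{ij}=\epsilon^{ij}\phi$, $\phi\in C^\infty(U)$, and assume that all the symplectic leaves of $(U,\alpha)$ are simply connected. Then the phase spaces $\tilde{\mathcal{G}}$ and $\tilde{\tilde{\mathcal{G}}}$ are diffeomorphic to $\mathcal{G}$, where these spaces are defined in the context.
   Context: Here $\epsilon^{12}=-\epsilon^{21}=1$, $\epsilon^{11}=\epsilon^{22}=0$; $I=[0,1]$; $C^1_0(I,\mathbb{R}^2)$ is the space of $C^1$ maps vanishing at $0$ and $1$; primes denote $u$-derivatives; $\phi$ also denotes $\phi\circ X$, $\phi_0=\phi(X(0))$, $\partial_i\phi=\partial\phi/\partial x^i$. $\tilde{\mathcal{G}}$: the quotient of the set of $(X,\eta)\in C^1(I,U)\times C^0(I,\mathbb{R}^2)$ satisfying $$(X^1)'+\phi(X)\eta_2=0,\qquad (X^2)'-\phi(X)\eta_1=0$$ by the infinitesimal symmetries $$\delta X^1=-\phi\beta_2,\quad \delta X^2=\phi\beta_1,\quad \delta\eta_i=\beta_i'+\partial_i\phi\,(\eta_1\beta_2-\eta_2\beta_1)\ (i=1,2),\qquad \beta\in C^1_0(I,\mathbb{R}^2).$$ $\tilde{\tilde{\mathcal{G}}}$: the quotient of the set of $(X,E)\in C^1(I,U)\times C^0(I,\mathbb{R}^2)$ satisfying $$(X^1)'+\phi_0E_2=0,\quad (X^2)'-\phi_0E_1=0,\qquad H(u):=1+\int_0^u(\partial_2\phi\,E_1-\partial_1\phi\,E_2)(v)\,dv>0\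 \ \forall u\in I,$$ by the infinitesimal symmetries $\delta X^1=-\phi_0e_2$, $\delta X^2=\phi_0e_1$, $\delta E_i=e_i'$, $e\in C^1_0(I,\mathbb{R}^2)$. In both cases two solutions are identified iff they are joined by a path of solutions whose velocity is at each time an infinitesimal symmetry. The quotient is regarded as a smooth manifold if it has a smooth structure for which the projection from the Banach manifold of solutions is a smooth submersion; ''diffeomorphic'' refers to this structure. $\mathcal{G}$: define $x_f:U\times\mathbb{R}^2\to\mathbb{R}^2$ by $x_f^i(x,\pi)=x^i-\phi(x)\epsilon^{ij}\pi_j$, $V=\{p\in U\times\mathbb{R}^2: x_f(p)\in U\}$, and $h:V\to\mathbb{R}$ by $$h(x,\pi)=\begin{cases}\phi(x_f)/\phi(x)&\text{if }\phi(x)\ne0,\\ 1-\pi_2\,\partial_1\phi(x)+\pi_1\,\partial_2\phi(x)&\text{if }\phi(x)=0.\end{cases}$$ $\mathcal{G}$ is the connected component of $\{p\in V: h(p)>0\}$ containing $U\times\{(0,0)\}$; it is an open subset of $\mathbb{R}^4$. *)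

(* Defs.v *)
From HB Require Import structures.
From mathcomp Require Import all_boot all_order all_algebra.
From mathcomp Require Import all_classical all_reals all_analysis.
From Stdlib Require Import Relations.Relation_Operators.
Set Implicit Arguments.
Unset Strict Implicit.
Unset Printing Implicit Defensive.
Import Order.TTheory GRing.Theory Num.Theory numFieldNormedType.Exports.
Local Open Scope classical_set_scope.
Local Open Scope ring_scope.

Notation I01 := (`[0, 1]%classic).

Section C0.
Variables (R : realType) (V : normedModType R).

(* A function on [0,1] is represented by its extension by 0 to R, so that
   equality in the type is equality of functions on [0,1]. *)
Definition C0_pred : {pred R -> V} := fun f =>
  `[< {within I01, continuous f} /\ forall u, ~ I01 u -> f u = 0 >].

Record C0 := MkC0 { C0_fun :> R -> V; _ : C0_fun \in C0_pred }.

HB.instance Definition _ := [isSub for C0_fun].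
HB.instance Definition _ := [Choice of C0 by <:].

Lemma C0_submod_closed : GRing.submod_closed C0_pred.
Proof.
split=> [|a f g].
  by apply/asboolP; split=> // x; exact: cvg_cst.
move=> /asboolP[cf f0] /asboolP[cg g0]; apply/asboolP; split=> [x|u Iu].
  by apply: cvgD; [apply: cvgZr; exact: cf|exact: cg].
by rewrite !fctE f0// g0// scaler0 addr0.
Qed.
HB.instance Definition _ :=
  GRing.isSubmodClosed.Build R (R -> V) C0_pred C0_submod_closed.
HB.instance Definition _ := [SubChoice_isSubLmodule of C0 by <:].

Lemma C0_continuous (f : C0) : {within I01, continuous f}.
Proof. by case: f => f /= /asboolP[]. Qed.

Lemma C0_out (f : C0) u : ~ I01 u -> f u = 0.
Proof. by case: f => f /= /asboolP[_ f0] /f0. Qed.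

Definition C0_norm (f : C0) : R := sup [set `|f u| | u in I01].

Lemma C0_has_sup (f : C0) : has_sup [set `|f u| | u in I01].
Proof.
split; first by exists `|f 0|, 0 => //=; rewrite in_itv/= lexx ler01.
have cf : {within I01, continuous (fun u => `|f u|)}.
  by move=> u; apply: cvg_norm; exact: C0_continuous.
have [c _ cP] := EVT_max ler01 cf.
by exists `|f c| => _ [u /= Iu <-]; exact: cP.
Qed.

Lemma le_C0_norm (f : C0) u : `|f u| <= C0_norm f.
Proof.
have ub v : I01 v -> `|f v| <= C0_norm f.
  by move=> Iv; apply: (sup_upper_bound (C0_has_sup f)); exists v.
have [/ub//|Iu] := pselect (I01 u).
rewrite C0_out// normr0 (le_trans (normr_ge0 (f 0)))// ub//=.
by rewrite in_itv/= lexx ler01.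
Qed.

Lemma C0_norm_le (f : C0) (M : R) :
  (forall u, I01 u -> `|f u| <= M) -> C0_norm f <= M.
Proof.
move=> fM; apply: ge_sup; first by case: (C0_has_sup f).
by move=> _ [u Iu <-]; exact: fM.
Qed.

Lemma C0_ler_normD (f g : C0) : C0_norm (f + g) <= C0_norm f + C0_norm g.
Proof.
by apply: C0_norm_le => u _; rewrite (le_trans (ler_normD _ _))// lerD// le_C0_norm.
Qed.

Lemma C0_normrZ (l : R) (f : C0) : C0_norm (l *: f) = `|l| * C0_norm f.
Proof.
have le (k : R) (g : C0) : C0_norm (k *: g) <= `|k| * C0_norm g.
  by apply: C0_norm_le => u _; rewrite normrZ ler_wpM2l// le_C0_norm.
apply/eqP; rewrite eq_le le/=.
have [->|l0] := eqVneq l 0.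
  by rewrite normr0 mul0r (le_trans (normr_ge0 _) (le_C0_norm _ 0)).
rewrite -ler_pdivlMl ?normr_gt0// -normfV.
by rewrite -[X in C0_norm X <= _](scalerK l0) le.
Qed.

Lemma C0_normr0_eq0 (f : C0) : C0_norm f = 0 -> f = 0.
Proof.
move=> f0; apply/val_inj/funext => u /=.
by apply/eqP; rewrite -normr_le0 -f0 le_C0_norm.
Qed.

HB.instance Definition _ :=
  Lmodule_isNormed.Build R C0 C0_ler_normD C0_normrZ C0_normr0_eq0.

End C0.

Section C1.
Variables (R : realType) (V : normedModType R).

(* C^1([0,1], V) is the graph of d/du in C^0 x C^0: an element is a pair (X, X')
   with X' the derivative of X on ]0,1[; both are continuous on [0,1], so X' is
   determined by X, and is its one-sided derivative at 0 and 1. The norm of the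
   product is max(|X|, |X'|), the usual C^1 norm. *)
Definition C1_pred : {pred C0 V * C0 V} := fun p =>
  `[< forall u : R, `]0, 1[%classic u -> is_derive u 1 (p.1 : R -> V) (p.2 u) >].

Record C1 := MkC1 { C1_pair : C0 V * C0 V; _ : C1_pair \in C1_pred }.

HB.instance Definition _ := [isSub for C1_pair].
HB.instance Definition _ := [Choice of C1 by <:].

Lemma C1_submod_closed : GRing.submod_closed C1_pred.
Proof.
split=> [|a f g].
  by apply/asboolP => u _; exact: (is_derive_cst (0 : V)).
move=> /asboolP df /asboolP dg; apply/asboolP => u u01.
by apply: is_deriveD; [apply: is_deriveZ; exact: df|exact: dg].
Qed.
HB.instance Definition _ :=
  GRing.isSubmodClosed.Build R (C0 V * C0 V)%type C1_pred C1_submod_closed.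
HB.instance Definition _ := [SubChoice_isSubLmodule of C1 by <:].

Definition C1_norm (X : C1) : R := `|C1_pair X|.

Lemma C1_ler_normD (X Y : C1) : C1_norm (X + Y) <= C1_norm X + C1_norm Y.
Proof. exact: ler_normD. Qed.

Lemma C1_normrZ (l : R) (X : C1) : C1_norm (l *: X) = `|l| * C1_norm X.
Proof. exact: normrZ. Qed.

Lemma C1_normr0_eq0 (X : C1) : C1_norm X = 0 -> X = 0.
Proof. by move=> /normr0_eq0 X0; exact: val_inj. Qed.

HB.instance Definition _ :=
  Lmodule_isNormed.Build R C1 C1_ler_normD C1_normrZ C1_normr0_eq0.

Definition C1_fun (X : C1) : R -> V := (C1_pair X).1.
Definition C1_deriv (X : C1) : C0 V := (C1_pair X).2.

End C1.
Coercion C1_fun : C1 >-> Funclass.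

(* [f] is C^{k+1} on the open set [A] iff it is Frechet differentiable at the
   points of [A] and its tangent map (x, v) |-> df_x(v) is C^k on [A] x E. In
   finite dimension this is C^k for every k; between arbitrary normed spaces
   requiring it for all k gives exactly the Frechet-smooth maps. *)
Fixpoint Ck (R : realType) (k : nat) (E F : normedModType R) (A : set E)
    (f : E -> F) : Prop :=
  match k with
  | 0 => forall x, A x -> {for x, continuous f}
  | k'.+1 => (forall x, A x -> differentiable f x) /\
      @Ck R k' (E * E)%type F (A `*` setT) (fun p => 'd f (p.1) p.2)
  end.

Definition smooth_on (R : realType) (E F : normedModType R) (A : set E)
    (f : E -> F) : Prop := forall k, Ck k A f.

Record chart (R : realType) (M : Type) (E : normedModType R) :=
  Chart { dom : set M; coord : M -> E }.

Section Manifolds.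
Variable R : realType.

(* [g] is the expression of [f] in the charts [c], [c'], on the whole open set
   where it is defined. *)
Definition local_expr (M N : Type) (E F : normedModType R)
    (c : chart M E) (c' : chart N F) (f : M -> N) (g : E -> F) : Prop :=
  let D := dom c `&` f @^-1` dom c' in
  [/\ open (coord c @` D), smooth_on (coord c @` D) g
    & forall x, D x -> coord c' (f x) = g (coord c x)].

Definition chart_open (M : Type) (E : normedModType R) (X : set M)
    (A : set (chart M E)) (O : set M) : Prop :=
  O `<=` X /\ forall c, A c -> open (coord c @` (O `&` dom c)).

(* [A] is a Hausdorff smooth atlas on the subset [X] of the type [M]; the
   topology of the manifold is the one given by the charts. *)
Definition smooth_atlas (M : Type) (E : normedModType R) (X : set M)
    (A : set (chart M E)) : Prop :=
  [/\ forall c, A c -> dom c `<=` X /\ {in dom c &, injective (coord c)},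
      X `<=` \bigcup_(c in A) dom c,
      forall c c', A c -> A c' -> exists g, local_expr c c' id g
    & forall x y, X x -> X y -> x <> y -> exists O O',
        [/\ chart_open X A O, chart_open X A O', O x, O' y & O `&` O' = set0]].

Definition open_subset_atlas (E : normedModType R) (G : set E) : set (chart E E) :=
  [set Chart G id].

Definition smooth_map (M N : Type) (E F : normedModType R)
    (X : set M) (A : set (chart M E)) (Y : set N) (A' : set (chart N F))
    (f : M -> N) : Prop :=
  (forall x, X x -> Y (f x)) /\
  forall c c', A c -> A' c' -> exists g, local_expr c c' f g.

Definition split_surjection (E F : normedModType R) (l : E -> F) : Prop :=
  (forall y, exists x, l x = y) /\
  exists p : {linear E -> E},
    [/\ continuous p, forall x, l (p x) = 0 & forall x, l x = 0 -> p x = x].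

Definition smooth_submersion (M N : Type) (E F : normedModType R)
    (X : set M) (A : set (chart M E)) (Y : set N) (A' : set (chart N F))
    (f : M -> N) : Prop :=
  smooth_map X A Y A' f /\
  forall c c' g, A c -> A' c' -> local_expr c c' f g ->
    forall x, dom c x -> dom c' (f x) -> split_surjection ('d g (coord c x)).

Definition diffeomorphic (M N : Type) (E F : normedModType R)
    (X : set M) (A : set (chart M E)) (Y : set N) (A' : set (chart N F)) : Prop :=
  exists (f : M -> N) (g : N -> M),
    [/\ smooth_map X A Y A' f, smooth_map Y A' X A g,
        forall x, X x -> g (f x) = x & forall y, Y y -> f (g y) = y].

(* [psi] is a diffeomorphism of the open set [O] onto an open subset of K x L
   that straightens [S] to K x 0. *)
Definition slice_chart (B K L : normedModType R) (S O : set B)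
    (psi : B -> K * L) : Prop :=
  [/\ open O, open (psi @` O), smooth_on O psi,
      exists2 psi', smooth_on (psi @` O) psi' & forall b, O b -> psi' (psi b) = b
    & forall b, O b -> (S b <-> (psi b).2 = 0)].

Definition submanifold (B K L : normedModType R) (S : set B) : Prop :=
  forall s, S s -> exists O (psi : B -> K * L), slice_chart S O psi /\ O s.

Definition submanifold_atlas (B K L : normedModType R) (S : set B) :
    set (chart B K) :=
  [set c | exists O (psi : B -> K * L),
     slice_chart S O psi /\ c = Chart (O `&` S) (fun b => (psi b).1)].

Section Quotient.
Variables (B : normedModType R) (S : set B) (sym : B -> B -> Prop).

(* [sym s v] means that the tangent vector [v] at the solution [s] is an
   infinitesimal symmetry. Differentiability in [t] is for the norm of [B], and at
   t = 0, 1 it is two-sided; this is no restriction, as a C^1 path on [0,1] extends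
   to R as a C^1 path in [B] (only [c t] for t in [0,1] has to lie in [S]). *)
Definition joined (s s' : B) : Prop :=
  exists c : R -> B,
    [/\ c 0 = s, c 1 = s',
        forall t, I01 t -> [/\ S (c t), derivable c t 1 & sym (c t) ('D_1 c t)]
      & {within I01, continuous (fun t => 'D_1 c t)}].

Definition class_of (s : B) : set B := [set s' | S s' /\ joined s s'].

Definition quotient : set (set B) := [set class_of s | s in S].

(* [S] is a submanifold of [B] modelled on a Banach space, its quotient has a
   smooth structure for which the projection is a smooth submersion, and with that
   structure it is diffeomorphic to the open subset [G] of [E]. *)
Definition quotient_diffeomorphic_to (E : normedModType R) (G : set E) : Prop :=
  exists K L : completeNormedModType R,
    @submanifold B K L S /\
    exists A : set (chart (set B) E),
      [/\ smooth_atlas quotient A,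
          smooth_submersion S (@submanifold_atlas B K L S) quotient A class_of,
          smooth_atlas G (open_subset_atlas G)
        & diffeomorphic quotient A G (open_subset_atlas G)].

End Quotient.
End Manifolds.

Section PlanePoisson.
Variable R : realType.
Local Notation R2 := 'rV[R]_2.

Definition comp1 (v : R2) : R := v 0 0.
Definition comp2 (v : R2) : R := v 0 1.

Definition partial (i : 'I_2) (f : R2 -> R) (x : R2) : R :=
  'D_(delta_mx 0 i) f x.

Definition eps (i j : 'I_2) : R := (i < j)%N%:R - (j < i)%N%:R.

Variables (U : set R2) (phi : R2 -> R).

Definition bivector (i j : 'I_2) (x : R2) : R := eps i j * phi x.

Definition ham_field (f : R2 -> R) (x : R2) : R2 :=
  \row_i \sum_j bivector i j x * partial j f x.

Definition ham_step (x y : R2) : Prop :=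
  exists (f : R2 -> R) (c : R -> R2),
    [/\ smooth_on U f, c 0 = x, c 1 = y
      & forall t, I01 t -> U (c t) /\ is_derive t 1 c (ham_field f (c t))].

(* Points that can be joined to [x] by finitely many arcs of Hamiltonian
   trajectories. Here a leaf is a point or an open set, so its intrinsic topology
   is the subspace topology. *)
Definition leaf (x : R2) : set R2 := [set y | clos_refl_trans R2 ham_step x y].

Definition path_connected (A : set R2) : Prop :=
  forall x y, A x -> A y -> exists c : R -> R2,
    [/\ {within I01, continuous c}, forall t, I01 t -> A (c t), c 0 = x & c 1 = y].

Definition simply_connected (A : set R2) : Prop :=
  path_connected A /\
  forall c : R -> R2, {within I01, continuous c} ->
    (forall t, I01 t -> A (c t)) -> c 0 = c 1 ->
    exists H : R * R -> R2,
      [/\ {within I01 `*` I01, continuous H},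
          forall s t, I01 s -> I01 t -> A (H (s, t)),
          forall t, I01 t -> H (0, t) = c t /\ H (1, t) = c 0
        & forall s, I01 s -> H (s, 0) = c 0 /\ H (s, 1) = c 0].

Local Notation d1 := (partial 0 phi).
Local Notation d2 := (partial 1 phi).
Local Notation C1p := (C1 R2).
Local Notation C0p := (C0 R2).

Definition solutions (s : C1p * C0p) : Prop :=
  let: (X, eta) := s in
  forall u, I01 u ->
    [/\ U (X u),
        comp1 (C1_deriv X u) + phi (X u) * comp2 (eta u) = 0
      & comp2 (C1_deriv X u) - phi (X u) * comp1 (eta u) = 0].

Definition C10 (b : C1p) : Prop := b 0 = 0 /\ b 1 = 0.

Definition symmetry (s v : C1p * C0p) : Prop :=
  let: (X, eta) := s in let: (dX, deta) := v in
  exists2 beta : C1p, C10 beta & forall u, I01 u ->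
    [/\ comp1 (dX u) = - (phi (X u) * comp2 (beta u)),
        comp2 (dX u) = phi (X u) * comp1 (beta u)
      & forall i : 'I_2, deta u 0 i = C1_deriv beta u 0 i
          + partial i phi (X u)
            * (comp1 (eta u) * comp2 (beta u) - comp2 (eta u) * comp1 (beta u))].

Definition hol (X : C1p) (E : C0p) (u : R) : R :=
  1 + \int[lebesgue_measure]_(v in `[0, u]%classic)
        (d2 (X v) * comp1 (E v) - d1 (X v) * comp2 (E v)).

Definition lin_solutions (s : C1p * C0p) : Prop :=
  let: (X, E) := s in
  forall u, I01 u ->
    [/\ U (X u),
        comp1 (C1_deriv X u) + phi (X 0) * comp2 (E u) = 0,
        comp2 (C1_deriv X u) - phi (X 0) * comp1 (E u) = 0
      & 0 < hol X E u].

Definition lin_symmetry (s v : C1p * C0p) : Prop :=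
  let: (X, E) := s in let: (dX, dE) := v in
  exists2 e : C1p, C10 e & forall u, I01 u ->
    [/\ comp1 (dX u) = - (phi (X 0) * comp2 (e u)),
        comp2 (dX u) = phi (X 0) * comp1 (e u)
      & dE u = C1_deriv e u].

Definition x_f (p : R2 * R2) : R2 :=
  \row_i (p.1 0 i - phi p.1 * \sum_j eps i j * p.2 0 j).

Definition h (p : R2 * R2) : R :=
  if phi p.1 == 0 then 1 - comp2 p.2 * d1 p.1 + comp1 p.2 * d2 p.1
  else phi (x_f p) / phi p.1.

Definition h_pos : set (R2 * R2) :=
  [set p | [/\ U p.1, U (x_f p) & 0 < h p]].

(* For connected [U] all the components below coincide. *)
Definition groupoid : set (R2 * R2) :=
  \bigcup_(x in U) connected_component h_pos (x, 0).

End PlanePoisson.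

(* Main.v *)
(* The map (X, E) |-> (X(0), int_0^1 E) descends to the quotient of the linearized solutions.
   With P = int E and x = X(0), a linearized solution is X = x + phi(x) J P, where J is the
   rotation with matrix -epsilon, and its holonomy is H(u) = h(x, P(u)). So linearized solutions
   over x are exactly the C^1 curves P from 0 in the fibre {w | (x, w) in h_pos}, and a path of
   symmetries is a homotopy of such curves with fixed end points. If phi(x) = 0 that fibre is a
   half plane; otherwise w |-> x_f(x, w) identifies its component of 0 with the leaf of x, which
   is simply connected. Hence the end point P(1) classifies the linearized solutions, and the
   points (x, P(1)) fill up the groupoid. A homotopy is only continuous; it is replaced by a
   finite chain of straight segments between C^1 curves.
   The substitution E = exp(int dphi(J eta)) eta, with inverse eta = E / H, is a diffeomorphism
   of open subsets of the Banach space that carries the solutions of the original problem to the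
   linearized ones, and it matches the equivalence relations. *)
From HB Require Import structures.
Require Import Defs.
From mathcomp Require Import all_boot all_order all_algebra.
From mathcomp Require Import all_classical all_reals all_analysis.
From mathcomp Require Import ring lra.
From Stdlib Require Import Relations.Relation_Operators.
Import Order.TTheory GRing.Theory Num.Theory numFieldNormedType.Exports.
Set Implicit Arguments.
Unset Strict Implicit.
Unset Printing Implicit Defensive.
Local Open Scope classical_set_scope.
Local Open Scope ring_scope.

(** * Smooth maps between normed spaces *)

(** The substitution is not shown to carry symmetries to symmetries along arbitrary paths; two
    weaker facts suffice. A path of symmetries preserves (X(0), int E): off the zeros of phi this
    pair is a function of X(0) and X(1), which symmetries fix, and at a zero X is constant and the
    derivative can be computed. Conversely, only straight segments are pulled back, with beta = e /
    H. The groupoid is a component in the total space, where the base point moves, whereas a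
    solution is a curve in one fibre. The bridge is that x and x_f lie in one leaf: counted as true
    at the zeros of phi, this is locally constant on [h_pos], and path connectedness of the leaf
    then supplies a curve in the fibre. As (X(0), int E) is a global coordinate whose level sets are
    the classes, one chart covers the quotient. The analytic cost is smoothness of substitution,
    holonomy and equation on spaces of curves. It reduces to superposition operators: their tangent
    maps are again superposition operators, and Taylor's formula is uniform along a compact
    curve. *)

Section Calculus.
Variable R : realType.
Implicit Types E F G : normedModType R.

(** An explicit bound in place of the little-o: differentials are guessed pointwise and verified by
    estimates. *)
Lemma diff_of_bound E F (f : E -> F) (l : {linear E -> F}) (x : E) :
  continuous l ->
  (forall e : R, 0 < e -> \forall y \near (0 : E),
      `|f (y + x) - f x - l y| <= e * `|y|) ->
  differentiable f x /\ 'd f x = l :> (E -> F).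
Proof.
move=> cl H.
have fE : f \o shift x = cst (f x) + l +o_ (0 : E) id.
  apply/eqaddoP => e e0; near=> y => /=.
  have : `|f (y + x) - f x - l y| <= e * `|y| by near: y; exact: H.
  by rewrite !fctE opprD addrA.
have dE := diff_unique cl fE.
by split=> //; apply/diff_locallyP; rewrite dE; split.
Unshelve. all: by end_near. Qed.

Lemma diff_bound E F (f : E -> F) (x : E) : differentiable f x ->
  forall e : R, 0 < e -> \forall y \near (0 : E),
      `|f (y + x) - f x - 'd f x y| <= e * `|y|.
Proof.
move=> /diff_locallyP[_ /eqaddoP H] e e0; near=> y.
have : `|(f \o shift x - (cst (f x) + 'd f x)) y| <= e * `|id y|.
  by near: y; exact: H.
by rewrite !fctE opprD addrA.
Unshelve. all: by end_near. Qed.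

Lemma diff_congr E F (f g : E -> F) (x : E) : (\near x, f x = g x) ->
  differentiable f x -> differentiable g x /\ 'd g x = 'd f x :> (E -> F).
Proof.
move=> fg df; apply: diff_of_bound; first exact: diff_continuous.
move=> e e0; have gx := nbhs_singleton fg; near=> y.
rewrite -gx; suff -> : g (y + x) = f (y + x) by near: y; exact: diff_bound.
apply/esym; near: y.
have sx : (fun y => y + x) @ 0 --> x.
  by rewrite -[X in _ --> X]add0r; apply: cvgD; [exact: cvg_id|exact: cvg_cst].
exact: (sx _ fg).
Unshelve. all: by end_near. Qed.

Lemma Ck_sub k E F (A B : set E) (f : E -> F) :
  B `<=` A -> Ck k A f -> Ck k B f.
Proof.
elim: k E A B f => [|k IH] E A B f BA /=; first by move=> H x /BA /H.
move=> [df Tf]; split; first by move=> x /BA /df.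
by apply: IH Tf => -[x v] [/= /BA].
Qed.

(** [Ck k.+1] asks for [Ck k] of the tangent map only, so passing to [Ck k] of [f] itself takes an
    induction. *)
Lemma Ck_pred k E F (A : set E) (f : E -> F) : Ck k.+1 A f -> Ck k A f.
Proof.
elim: k E A f => [|k IH] E A f.
  by move=> [df _] x Ax; exact/differentiable_continuous/df.
by move=> [df Tf]; split => //; exact: IH.
Qed.

Lemma openXT E F (A : set E) : open A -> open (A `*` @setT F).
Proof.
move=> oA; rewrite (_ : _ `*` _ = fst @^-1` A); last first.
  by apply/seteqP; split=> [p []//|p ?]; split.
by apply: open_comp => // p _; exact: cvg_fst.
Qed.

Lemma Ck_congr k E F (A : set E) (f g : E -> F) : open A ->
  (forall x, A x -> f x = g x) -> Ck k A f -> Ck k A g.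
Proof.
elim: k E A f g => [|k IH] E A f g oA fg /=.
  move=> cf x Ax; suff : g @ x --> g x by [].
  rewrite -(fg x Ax).
  apply: cvg_trans (cf x Ax); apply: near_eq_cvg.
  by near do rewrite fg//; exact: open_nbhs_nbhs.
have nearfg x : A x -> \near x, f x = g x.
  by move=> Ax; near do rewrite fg//; exact: open_nbhs_nbhs.
move=> [df Tf]; split=> [x Ax|].
  by have [] := diff_congr (nearfg x Ax) (df x Ax).
apply: IH Tf; first exact: openXT.
move=> [x v] [/= Ax _].
have [_ dE] := diff_congr (nearfg x Ax) (df x Ax).
exact: (esym (congr1 (fun h : E -> F => h v) dE)).
Unshelve. all: by end_near. Qed.

(** A predicate on bare functions, so that maps given by formulas compose without packing a linear
    structure each time. *)
Definition clinear E F (l : E -> F) := linear l /\ continuous l.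

Lemma clinear_diff E F (l : E -> F) x : clinear l ->
  differentiable l x /\ 'd l x = l :> (E -> F).
Proof.
move=> [ll cl].
pose L : {linear E -> F} := HB.pack l (GRing.isLinear.Build _ _ _ _ _ ll).
split; first exact: (linear_differentiable (f := L)).
exact: (diff_lin (f := L)).
Qed.

Lemma clinear_comp E F G (l : E -> F) (m : F -> G) :
  clinear l -> clinear m -> clinear (m \o l).
Proof.
move=> [ll cl] [lm cm]; split; first by move=> a u v /=; rewrite ll lm.
by move=> x; apply: continuous_comp; [exact: cl|exact: cm].
Qed.

Lemma clinear_pair E F G (l : E -> F) (m : E -> G) :
  clinear l -> clinear m -> clinear (fun x => (l x, m x)).
Proof.
move=> [ll cl] [lm cm]; split; first by move=> a u v /=; rewrite ll lm.
by move=> x; apply: cvg_pair; [exact: cl|exact: cm].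
Qed.

Lemma clinear_fst E F : clinear (@fst E F).
Proof. by split=> // x; exact: cvg_fst. Qed.

Lemma clinear_snd E F : clinear (@snd E F).
Proof. by split=> // x; exact: cvg_snd. Qed.

Lemma clinear_id E : clinear (@id E).
Proof. by split=> // x; exact: cvg_id. Qed.

Lemma clinear_add E F (l m : E -> F) :
  clinear l -> clinear m -> clinear (fun x => l x + m x).
Proof.
move=> [ll cl] [lm cm]; split.
  by move=> a u v /=; rewrite ll lm scalerDr addrACA.
by move=> x; apply: cvgD; [exact: cl|exact: cm].
Qed.

Lemma clinear_scale E F (a : R) (l : E -> F) :
  clinear l -> clinear (fun x => a *: l x).
Proof.
move=> [ll cl]; split.
  by move=> b u v /=; rewrite ll scalerDr !scalerA mulrC.
by move=> x; apply: cvgZr; exact: cl.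
Qed.

Lemma clinear_bound E F (l : E -> F) (C : R) :
  linear l -> (forall x, `|l x| <= C * `|x|) -> clinear l.
Proof.
move=> ll lC; split=> // x.
pose L : {linear E -> F} := HB.pack l (GRing.isLinear.Build _ _ _ _ _ ll).
apply: (bounded_linear_continuous (f := L)).
apply/linear_boundedP; near=> r => y /=; apply: le_trans (lC y) _.
by rewrite ler_wpM2r//; near: r; exact: nbhs_pinfty_ge.
Unshelve. all: by end_near. Qed.

Lemma Ck_lin k E F (A : set E) (l : E -> F) : clinear l -> Ck k A l.
Proof.
elim: k E A l => [|k IH] E A l cl /=; first by move=> x _; exact: cl.2.
split; first by move=> x _; exact: (clinear_diff x cl).1.
rewrite (_ : (fun p => _) = (l \o snd)); last first.
  by apply/funext => p /=; rewrite (clinear_diff p.1 cl).2.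
exact/IH/(clinear_comp (clinear_snd E E) cl).
Qed.

Lemma Ck_cst k E F (A : set E) (c : F) : Ck k A (fun=> c).
Proof.
elim: k E A c => [|k IH] E A c /=; first by move=> x _; exact: cvg_cst.
split; first by move=> x _; exact: differentiable_cst.
rewrite (_ : (fun p => _) = (fun=> 0)); first exact: IH.
by apply/funext => p /=; rewrite diff_cst.
Qed.

Lemma Ck_pair k E F G (A : set E) (f : E -> F) (g : E -> G) : open A ->
  Ck k A f -> Ck k A g -> Ck k A (fun x => (f x, g x)).
Proof.
elim: k E A f g => [|k IH] E A f g oA /=.
  by move=> cf cg x Ax; apply: cvg_pair; [exact: cf|exact: cg].
move=> [df Tf] [dg Tg]; split=> [x Ax|].
  by apply: differentiable_pair; [exact: df|exact: dg].
apply: Ck_congr (IH _ _ _ _ _ Tf Tg); [exact: openXT| |exact: openXT].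
by move=> [x v] [/= Ax _]; rewrite diff_pair//; [exact: df|exact: dg].
Qed.

(** The tangent map is a functor, T(g f) = Tg Tf, so the induction needs no formula for higher
    derivatives. The first component [f \o fst] of Tf is C^k by [Ck_pred]. *)
Lemma Ck_comp k E F G (A : set E) (B : set F) (f : E -> F) (g : F -> G) :
  open A -> (forall x, A x -> B (f x)) ->
  Ck k A f -> Ck k B g -> Ck k A (g \o f).
Proof.
elim: k E F G A B f g => [|k IH] E F G A B f g oA AB.
  move=> cf cg x Ax; apply: continuous_comp; first exact: cf.
  exact/cg/AB.
move=> Cf Cg; have [df Tf] := Cf; have [dg Tg] := Cg; split=> [x Ax|].
  by apply: differentiable_comp; [exact: df|exact/dg/AB].
have oAT := openXT (F := E) oA.
have Ckf1 : Ck k (A `*` @setT E) (f \o fst).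
  apply: (IH _ _ _ _ A) => //; first by move=> ? [].
    exact/Ck_lin/clinear_fst.
  exact: Ck_pred.
have := IH _ _ _ _ (B `*` setT) _ _ oAT _ (Ck_pair oAT Ckf1 Tf) Tg.
move=> /(_ _)/Ck_congr; apply=> //.
  move=> [x v] [/= Ax _].
  have dE := diff_comp (df x Ax) (dg _ (AB x Ax)).
  exact: (esym (congr1 (fun h : E -> G => h v) dE)).
by move=> [x v] [/= Ax _]; split=> //; exact: AB.
Qed.

Lemma Ck_add k E F (A : set E) (f g : E -> F) : open A ->
  Ck k A f -> Ck k A g -> Ck k A (fun x => f x + g x).
Proof.
move=> oA Cf Cg.
apply: (Ck_comp (g := fun p : F * F => p.1 + p.2) (B := setT) _ _ (Ck_pair oA Cf Cg)) => //.
exact/Ck_lin/clinear_add/clinear_snd/clinear_fst.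
Qed.

(** The tangent map is a sum of copies of [b] precomposed with linear maps, so the induction closes
    on [b] itself. The same pattern gives the exponential and the inverse. *)
Lemma Ck_bilin k E1 E2 F (b : {bilinear E1 -> E2 -> F}) :
  continuous (fun p : E1 * E2 => b p.1 p.2) -> Ck k setT (fun p : E1 * E2 => b p.1 p.2).
Proof.
move=> cb; elim: k => [|k IH] /=; first by move=> x _; exact: cb.
split; first by move=> x _; exact: differentiable_bilin.
rewrite setXTT.
rewrite (_ : (fun p => _) =
  fun p : (E1 * E2) * (E1 * E2) => b p.1.1 p.2.2 + b p.2.1 p.1.2); last first.
  by apply/funext => p /=; rewrite diff_bilin.
have fstE := clinear_fst; have sndE := clinear_snd.
apply: Ck_add; first exact: openT.
  apply: (Ck_comp (B := setT) (f := fun p : (E1 * E2) * (E1 * E2) => (p.1.1, p.2.2)) _ _ _ IH) => //.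
    exact: openT.
  apply/Ck_lin/clinear_pair.
    exact: (clinear_comp (fstE _ _) (fstE _ _)).
  exact: (clinear_comp (sndE _ _) (sndE _ _)).
apply: (Ck_comp (B := setT) (f := fun p : (E1 * E2) * (E1 * E2) => (p.2.1, p.1.2)) _ _ _ IH) => //.
  exact: openT.
apply/Ck_lin/clinear_pair.
  exact: (clinear_comp (sndE _ _) (fstE _ _)).
exact: (clinear_comp (fstE _ _) (sndE _ _)).
Qed.

Lemma scale_bilinear F : bilinear_for
    (GRing.Scale.Law.clone _ _ *:%R _) (GRing.Scale.Law.clone _ _ *:%R _)
    (@GRing.scale R F).
Proof.
split=> [u'|u] a x y /=; first by rewrite scalerDl scalerA.
by rewrite scalerDr !scalerA mulrC.
Qed.

Lemma Ck_scale k E F (A : set E) (f : E -> R) (g : E -> F) : open A ->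
  Ck k A f -> Ck k A g -> Ck k A (fun x => f x *: g x).
Proof.
move=> oA Cf Cg.
pose b : {bilinear R -> F -> F} := HB.pack (@GRing.scale R F)
  (bilinear_isBilinear.Build R R F F _ _ _ (@scale_bilinear F)).
apply: (Ck_comp (g := fun p : R * F => b p.1 p.2) (B := setT) _ _ (Ck_pair oA Cf Cg)) => //.
apply: Ck_bilin => p; exact: scale_continuous.
Qed.

Lemma diff_real F (f : R -> F) x v : differentiable f x ->
  'd f x v = v *: 'D_1 f x.
Proof.
by move=> df; rewrite deriveE// -linearZ -[in LHS](mulr1 v).
Qed.

Lemma Ck_expR k (A : set R) : Ck k A expR.
Proof.
apply: (@Ck_sub k _ _ setT) => //.
elim: k => [|k IH] /=; first by move=> x _; exact: continuous_expR.
have dexp x : differentiable (expR : R -> R) x.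
  by apply/derivable1_diffP; exact: derivable_expR.
split; first by [].
rewrite setXTT (_ : (fun p => _) = fun p : R * R => expR p.1 *: p.2); last first.
  apply/funext => -[x v] /=.
  have dE : 'D_1 (@expR R) x = expR x by exact: (congr1 (@^~ x) (@derive_expR R)).
  by rewrite diff_real// dE; exact: mulrC.
apply: Ck_scale; [exact: openT| |exact/Ck_lin/clinear_snd].
apply: Ck_comp IH => //; first exact: openT.
exact/Ck_lin/clinear_fst.
Qed.

Lemma Ck_inv k (A : set R) : open A -> (forall x, A x -> x != 0) ->
  Ck k A (fun x => x^-1).
Proof.
move=> oA A0; elim: k => [|k IH].
  by move=> x /A0 x0; exact: inv_continuous.
have oAT := openXT (F := R) oA.
have Cinv : Ck k (A `*` @setT R) (fun p => p.1^-1).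
  apply: (Ck_comp _ _ _ IH (f := fst)) => //; first by move=> ? [].
  exact/Ck_lin/clinear_fst.
split; first by move=> x /A0 x0; exact: differentiable_Rinv.
apply: (@Ck_congr _ _ _ _ (fun p : R * R => p.1^-1 *: (p.1^-1 *: - p.2))) => //.
  move=> [x v] [/= /A0 x0 _]; rewrite diff_Rinv//=.
  by rewrite scalerA scalerN scaleNr -expr2 exprVn.
apply: Ck_scale => //; apply: Ck_scale => //.
apply/Ck_lin; rewrite (_ : (fun _ => _) = fun p : R * R => -1 *: p.2).
  exact/clinear_scale/clinear_snd.
by apply/funext => p; rewrite scaleN1r.
Qed.

End Calculus.

(** * Spaces of curves and superposition operators *)

Section ContinuousOnUnit.
Variable R : realType.
Implicit Types V W : normedModType R.

Lemma I01P (u : R) : I01 u <-> 0 <= u <= 1.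
Proof. by rewrite /= in_itv. Qed.

Lemma I01_0 : I01 (0 : R).
Proof. by apply/I01P; rewrite lexx ler01. Qed.

Lemma I01_1 : I01 (1 : R).
Proof. by apply/I01P; rewrite lexx ler01. Qed.

Lemma cont01P V (f : R -> V) : {within I01, continuous f} <->
  forall u : R, I01 u -> forall e : R, 0 < e ->
    \forall v \near u, I01 v -> `|f u - f v| <= e.
Proof.
rewrite subspace_continuousP; split.
  by move=> cf u Iu e e0; have /cvgrPdist_le/(_ _ e0) := cf u Iu.
by move=> cf u Iu; apply/cvgrPdist_le => e e0; exact: cf.
Qed.

Lemma cont01_eq V (f g : R -> V) : (forall u : R, I01 u -> f u = g u) ->
  {within I01, continuous f} -> {within I01, continuous g}.
Proof. by move=> fg; apply: subspace_eq_continuous => u; rewrite inE => /fg. Qed.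

Lemma C0_ext V (f g : C0 V) : (forall u : R, I01 u -> f u = g u) -> f = g.
Proof.
move=> fg; apply/val_inj/funext => u /=.
by have [/fg//|Iu] := pselect (I01 u); rewrite !C0_out.
Qed.

Definition restrict01 V (f : R -> V) (u : R) : V := if u \in I01 then f u else 0.

Lemma restrict01E V (f : R -> V) (u : R) : I01 u -> restrict01 f u = f u.
Proof. by move=> /mem_set; rewrite /restrict01 => ->. Qed.

(** Total by convention: a function that is not continuous on [0, 1] is sent to 0, so every value
    lemma asks for continuity. *)
Definition C0of V (f : R -> V) : C0 V := insubd 0 (restrict01 f).

Lemma C0ofE V (f : R -> V) (u : R) : {within I01, continuous f} -> I01 u -> C0of f u = f u.
Proof.
move=> cf Iu; rewrite /C0of -(restrict01E f Iu); congr (_ u).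
apply: (@insubdK _ _ (C0 V)); apply/asboolP; split.
  by apply: cont01_eq cf => v Iv; rewrite restrict01E.
by move=> v Iv; rewrite /restrict01 memNset.
Qed.

Lemma C0_normE V (f : C0 V) : `|f| = C0_norm f.
Proof. by []. Qed.

Lemma C0_eval V (f : C0 V) u : `|f u| <= `|f|.
Proof. exact: le_C0_norm. Qed.

Lemma C0D V (f g : C0 V) u : (f + g) u = f u + g u. Proof. by []. Qed.
Lemma C0B V (f g : C0 V) u : (f - g) u = f u - g u. Proof. by []. Qed.
Lemma C0Z V a (f : C0 V) u : (a *: f) u = a *: f u. Proof. by []. Qed.

Lemma C0_evalB V (f g : C0 V) u : `|f u - g u| <= `|f - g|.
Proof. exact: (C0_eval (f - g) u). Qed.

(** The model spaces of the solution manifold have to be complete. The limit is taken pointwise and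
    shown to be uniform. *)
Lemma C0_complete (V : completeNormedModType R) (F : set_system (C0 V)) :
  ProperFilter F -> cauchy F -> cvg F.
Proof.
move=> PF cF; have /cauchyP cFex := cF.
have cvu u : cvg ((fun f : C0 V => f u) @ F).
  apply: cauchy_cvg; apply: cauchy_exP => e e0.
  have [f Ff] := cFex e e0; exists (f u).
  suff : F (fun g : C0 V => ball (f u) e (g u)) by [].
  apply: filterS Ff => g; rewrite -!ball_normE/= => fg.
  exact: le_lt_trans (C0_evalB f g u) fg.
pose l u := lim ((fun f : C0 V => f u) @ F).
(* Uniformity: the Cauchy ball around [f] is chosen before [u], and the weak inequality passes to
   the limit. *)
have lP e : 0 < e -> exists2 f : C0 V, F (ball f e) & forall u, `|f u - l u| <= e.
  move=> e0; have [f Ff] := cFex e e0; exists f => // u.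
  apply/ler_addgt0Pr => d d0.
  have [g [fg gl]] : exists g : C0 V, ball f e g /\ `|l u - g u| <= d.
    apply: (@filter_ex _ F _ (fun g => ball f e g /\ `|l u - g u| <= d)).
    by apply: filterI => //; have /cvgrPdist_le/(_ _ d0) := cvu u.
  rewrite -(subrK (g u) (f u)) -addrA (le_trans (ler_normD _ _))// lerD//.
    move: fg; rewrite -ball_normE/= => /ltW; apply: le_trans.
    exact: C0_evalB.
  by rewrite distrC.
have lC0 : l \in @C0_pred R V.
  apply/asboolP; split.
    apply/cont01P => u Iu e e0; have e3 : 0 < e / 3 by rewrite divr_gt0.
    have [f _ fl] := lP _ e3.
    have := (cont01P f).1 (@C0_continuous _ _ f) u Iu _ e3.
    apply: filterS => v fuv Iv.
    have -> : e = e / 3 + (e / 3 + e / 3) by lra.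
    rewrite (le_trans (ler_distD (f u) _ _))// lerD//; first by rewrite distrC.
    by rewrite (le_trans (ler_distD (f v) _ _))// lerD//; exact: fuv.
  move=> u Iu; apply/eqP; rewrite -normr_le0.
  apply/ler_addgt0Pr => e e0; have [f _ fl] := lP _ e0.
  by have := fl u; rewrite C0_out// sub0r normrN add0r.
apply/cvg_ex; exists (MkC0 lC0).
suff : id @ F --> MkC0 lC0 by [].
apply/cvgrPdist_le => e e0; have [|f Ff fl] := lP (e / 2); first by rewrite divr_gt0.
apply: filterS Ff => g; rewrite -ball_normE/= => /ltW fg.
rewrite C0_normE; apply: C0_norm_le => u _; rewrite C0B /=.
rewrite -(subrK (f u) (l u)) -addrA [e]splitr.
rewrite (le_trans (ler_normD _ _))// lerD//; first by rewrite distrC.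
exact: le_trans (C0_evalB f g u) fg.
Qed.

HB.instance Definition _ (V : completeNormedModType R) :=
  Uniform_isComplete.Build (C0 V) (@C0_complete V).

HB.instance Definition _ (A B : puniformType) := Pointed.on (A * B)%type.

Lemma prod_complete (T U : completeNormedModType R) (F : set_system (T * U)) :
  ProperFilter F -> cauchy F -> cvg F.
Proof.
move=> PF /cauchyP cF.
have c1 : cvg (fst @ F).
  apply: cauchy_cvg; apply: cauchy_exP => e e0.
  have [p Fp] := cF e e0; exists p.1.
  suff : F (fun q : T * U => ball p.1 e q.1) by [].
  by apply: filterS Fp => q [].
have c2 : cvg (snd @ F).
  apply: cauchy_cvg; apply: cauchy_exP => e e0.
  have [p Fp] := cF e e0; exists p.2.
  suff : F (fun q : T * U => ball p.2 e q.2) by [].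
  by apply: filterS Fp => q [].
apply/cvg_ex; exists (lim (fst @ F), lim (snd @ F)).
suff : id @ F --> (lim (fst @ F), lim (snd @ F)) by [].
rewrite (_ : id = fun p : T * U => (p.1, p.2)); last by apply/funext => -[].
exact: cvg_pair c1 c2.
Qed.

HB.instance Definition _ (T U : completeNormedModType R) :=
  Uniform_isComplete.Build (T * U)%type (@prod_complete T U).

HB.instance Definition _ n :=
  Uniform_isComplete.Build 'rV[R]_n.+1 (@mx_complete R 1 n.+1).

End ContinuousOnUnit.

Section Superposition.
Variable R : realType.
Implicit Types E F V W : normedModType R.

Lemma is_derive_comp_diff E F (c : R -> E) (c' : E) (f : E -> F) (t : R) :
  is_derive t 1 c c' -> differentiable f (c t) ->
  is_derive t 1 (f \o c) ('d f (c t) c').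
Proof.
move=> [dc dcE] df; have dc1 : differentiable c t by exact/derivable1_diffP.
have dfc : differentiable (f \o c) t by exact: differentiable_comp.
apply: DeriveDef; first exact/derivable1_diffP.
by rewrite deriveE// diff_comp//= -dcE deriveE.
Qed.

Lemma is_derive_clinear E F (c : R -> E) (c' : E) (l : E -> F) (t : R) :
  clinear l -> is_derive t 1 c c' -> is_derive t 1 (l \o c) (l c').
Proof.
move=> cl dc; have [dl dlE] := clinear_diff (c t) cl.
by have := is_derive_comp_diff dc dl; rewrite dlE.
Qed.

Lemma clinear_scalel E (y : E) : clinear (fun s : R => s *: y).
Proof.
split; first by move=> a u v; rewrite scalerDl -scalerA.
by move=> x; apply: cvgZl; exact: cvg_id.
Qed.

Lemma is_derive_affine E (x y : E) (t : R) :
  is_derive t 1 (fun s : R => x + s *: y) y.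
Proof.
have -> : (fun s : R => x + s *: y) = cst x + (fun s => s *: y) by [].
rewrite -[y in is_derive _ _ _ y]add0r; apply: is_deriveD.
rewrite -[y in is_derive _ _ _ y]scale1r.
exact: (is_derive_clinear (c := id) (clinear_scalel y)).
Qed.

Lemma continuous_line E (x y : E) : continuous (fun t : R => x + t *: y).
Proof.
move=> t; have [dt _] := is_derive_affine x y t.
exact/differentiable_continuous/derivable1_diffP.
Qed.

(** Compactness of [0, 1]: local bounds give one global bound. Monotonicity in the integer replaces
    the maximum over a finite cover. *)
Lemma near_I01 (P : nat -> R -> Prop) :
  (forall n m u, (n <= m)%N -> P n u -> P m u) ->
  (forall u : R, I01 u -> exists n, \forall v \near u, P n v) ->
  exists n, forall u : R, I01 u -> P n u.
Proof.
move=> Pmono Pnear.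
have /compact_near_coveringP cI := @segment_compact R 0 1.
have := cI nat \oo P _; case.
  move=> u /Pnear[n Pn]; exists ([set v | P n v], [set m | (n <= m)%N]) => /=.
    by split => //; exists n.
  by move=> [v m] /= [Pv nm]; exact: Pmono Pv.
by move=> n _ /(_ n)/= Pn; exists n => u Iu; apply: Pn => /=.
Qed.

Lemma ball_natP E (A : set E) (x : E) : nbhs x A ->
  exists n : nat, ball x n.+1%:R^-1 `<=` A.
Proof.
move=> /nbhs_ballP[e /= e0 eA].
have [n _ /(_ n (leqnn _)) ne] := near_infty_natSinv_lt (PosNum e0).
by exists n => y yb; apply/eA/(le_ball _ yb)/ltW.
Qed.

(** Two steps of length 1/(2n+3) stay within 1/(n+1): one to move the centre along the curve, one
    for the perturbation. *)
Lemma invn_double (n : nat) :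
  (n.+1 + n.+1).+1%:R^-1 + (n.+1 + n.+1).+1%:R^-1 <= n.+1%:R^-1 :> R.
Proof.
set d := _.+1%:R^-1; have -> : d + d = 2 * d by lra.
rewrite /d ler_pdivrMr// mulrC ler_pdivlMr//.
by rewrite -natrM ler_nat mul2n -addnn leqnSn.
Qed.

Lemma C0_within_open E (A : set E) (X : C0 E) : open A ->
  (forall u : R, I01 u -> A (X u)) ->
  exists n : nat, forall u : R, I01 u -> ball (X u) n.+1%:R^-1 `<=` A.
Proof.
move=> oA XA.
(* The premise [I01 u] is repeated inside the property because neighbours of an end point leave
   [0, 1], where [X] is extended by 0. *)
have : exists n, forall u : R, I01 u -> I01 u -> ball (X u) n.+1%:R^-1 `<=` A.
  apply: (@near_I01 (fun n u => I01 u -> ball (X u) n.+1%:R^-1 `<=` A)).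
    move=> n m u nm Pn Iu y Xy; apply: Pn => //; apply: le_ball Xy.
    by rewrite lef_pV2 ?posrE// ler_nat ltnS.
  move=> u Iu; have [n nA] := ball_natP (open_nbhs_nbhs (conj oA (XA u Iu))).
  exists (n.+1 + n.+1)%N; set e : R := _.+1%:R^-1.
  have e0 : 0 < e by rewrite invr_gt0.
  have e2 : e + e <= n.+1%:R^-1 by exact: invn_double.
  have := (cont01P X).1 (@C0_continuous _ _ X) u Iu _ e0.
  apply: filterS => v Xuv Iv y Xvy; apply: nA.
  have := Xuv Iv; move: Xvy; rewrite -!ball_normE/= => vy uv.
  rewrite (le_lt_trans (ler_distD (X v) _ _))// (lt_le_trans _ e2)//.
  exact: ler_ltD.
by case=> n nP; exists n => u Iu; exact: nP.
Qed.

Lemma open_C0 E (A : set E) : open A ->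
  open [set X : C0 E | forall u : R, I01 u -> A (X u)].
Proof.
move=> oA; rewrite openE => X /= /(C0_within_open oA)[n nP].
apply/nbhs_ballP; exists n.+1%:R^-1 => //=.
move=> Y; rewrite -ball_normE/= => XY u Iu; apply: (nP u Iu).
by rewrite -ball_normE/=; exact: le_lt_trans (C0_evalB X Y u) XY.
Qed.

Lemma clinear_C0_eval E (u : R) : clinear (fun X : C0 E => X u).
Proof. by apply: (@clinear_bound _ _ _ _ 1) => // X; rewrite mul1r C0_eval. Qed.

Definition C0pair E F (p : C0 E * C0 F) : C0 (E * F)%type :=
  C0of (fun u => (p.1 u, p.2 u)).

Lemma C0pairE E F (p : C0 E * C0 F) (u : R) :
  I01 u -> C0pair p u = (p.1 u, p.2 u).
Proof.
move=> Iu; rewrite /C0pair C0ofE// => v.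
by apply: cvg_pair; exact: C0_continuous.
Qed.

Lemma clinear_C0pair E F : clinear (@C0pair E F).
Proof.
apply: (@clinear_bound _ _ _ _ 1).
  move=> a p q; apply: C0_ext => u Iu.
  by rewrite C0D C0Z !C0pairE.
move=> p; rewrite mul1r [leLHS]C0_normE; apply: C0_norm_le => u Iu.
rewrite C0pairE// !prod_normE/= ge_max !le_max.
by apply/andP; split; apply/orP; [left|right]; exact: C0_eval.
Qed.

(** The superposition, or Nemytskii, operator of [f]. *)
Definition C0map E F (f : E -> F) (X : C0 E) : C0 F := C0of (f \o X).

Lemma C0mapE E F (A : set E) (f : E -> F) (X : C0 E) (u : R) :
  (forall x, A x -> {for x, continuous f}) ->
  (forall v : R, I01 v -> A (X v)) -> I01 u -> C0map f X u = f (X u).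
Proof.
move=> cf XA Iu; rewrite /C0map C0ofE//.
apply/subspace_continuousP => v Iv.
have /subspace_continuousP/(_ v Iv) cX := @C0_continuous _ _ X.
apply: cvg_comp; [exact: cX|exact/cf/XA].
Qed.

Lemma C0map_clinE E F (l : E -> F) (X : C0 E) (u : R) :
  clinear l -> I01 u -> C0map l X u = l (X u).
Proof. by move=> [_ cl] Iu; apply: (@C0mapE _ _ setT) => // x _; exact: cl. Qed.

Lemma clinear_C0map E F (l : E -> F) : clinear l -> clinear (C0map l).
Proof.
move=> cl; have [ll lc] := cl.
pose L : {linear E -> F} := HB.pack l (GRing.isLinear.Build _ _ _ _ _ ll).
have [k k0 kP] := linear_lipschitz (lc : continuous L).
apply: (@clinear_bound _ _ _ _ k).
  by move=> a X Y; apply: C0_ext => u Iu; rewrite C0D C0Z !C0map_clinE// ll.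
move=> X; rewrite [leLHS]C0_normE; apply: C0_norm_le => u Iu.
rewrite C0map_clinE// (le_trans (kP _))// ler_wpM2l ?(ltW k0)//.
exact: C0_eval.
Qed.

End Superposition.

(** * Smoothness of superposition operators *)

Section Nemytskii.
Variable R : realType.
Implicit Types E F : normedModType R.

(** The mean value theorem as an equality needs real values; this is why superposition operators are
    differentiated for scalar [f], and vector-valued ones are assembled from coordinates. *)
Lemma mvt_line E (f : E -> R) (x y : E) :
  (forall t : R, 0 <= t <= 1 -> differentiable f (x + t *: y)) ->
  exists2 t : R, 0 <= t <= 1 & f (x + y) - f x = 'd f (x + t *: y) y.
Proof.
move=> df.
have dg (t : R) : 0 <= t <= 1 ->
    is_derive t 1 (f \o (fun s => x + s *: y)) ('d f (x + t *: y) y).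
  by move=> /df dft; apply: is_derive_comp_diff => //; exact: is_derive_affine.
have [||t t01] := @MVT R (f \o (fun s => x + s *: y))
  (fun t => 'd f (x + t *: y) y) 0 1 ltr01.
- by move=> t; rewrite in_itv/= => /andP[/ltW t0 /ltW t1]; apply: dg; rewrite t0.
- apply: derivable_within_continuous => t; rewrite in_itv/= => /dg[]//.
rewrite /= scale1r scale0r addr0 subr0 mulr1 => ->; exists t => //.
by move: t01; rewrite in_itv/= => /andP[/ltW-> /ltW->].
Qed.

(* Continuity of the second tangent map at ((x0, 0), (0, 0)) bounds the second derivative on
   vectors of a fixed small norm [a]; the mean value theorem, used twice, is applied to [y]
   rescaled to that norm. *)
Lemma taylor2_near E (A : set E) (f : E -> R) (x0 : E) :
  open A -> Ck 2 A f -> A x0 ->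
  exists n : nat, forall x y, ball x0 n.+1%:R^-1 x -> `|y| < n.+1%:R^-1 ->
    `|f (x + y) - f x - 'd f x y| <= n.+1%:R * `|y| ^+ 2.
Proof.
move=> oA [df [dTf]] /= cQ Ax0.
set Tf := fun p : E * E => 'd f (p.1) p.2 in dTf cQ.
have := cQ ((x0, 0), (0, 0)) (conj (conj Ax0 I) I).
move=> /cvgrPdist_lt/(_ 1 ltr01)/=; rewrite !linear0.
move=> /nbhs_ballP[d /= d0 dQ].
have [r /= r0 rA] := (nbhs_ballP _ _).1 (open_nbhs_nbhs (conj oA Ax0)).
have {dQ}dQ x v w : `|x - x0| < d -> `|v| < d -> `|w| < d ->
    `|'d Tf (x, v) (w, 0)| < 1.
  move=> xd vd wd; have := dQ ((x, v), (w, 0)); rewrite sub0r normrN; apply.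
  split; split; rewrite -ball_normE/=.
  - by rewrite distrC.
  - by rewrite sub0r normrN.
  - by rewrite sub0r normrN.
  - by rewrite subrr normr0.
pose m := Num.min d r; have m0 : 0 < m by rewrite lt_min d0.
have mA x : `|x - x0| < m -> A x.
  move=> xm; apply: rA; rewrite -ball_normE/= distrC (lt_le_trans xm)//.
  by rewrite ge_min lexx orbT.
have md : m <= d by rewrite ge_min lexx.
pose a := m / 2; have a0 : 0 < a by rewrite divr_gt0.
have am : a + a = m by rewrite -splitr.
(* One integer serves both as radius, 1/(n+1) <= a, and as constant of the remainder, a^-2 <=
   n+1. *)
have [n _ nP] : exists2 n : nat, True & 1 / a <= n.+1%:R /\ (1 / a) ^+ 2 <= n.+1%:R.
  exists (Num.Def.trunc (1 / a) + Num.Def.trunc ((1 / a) ^+ 2)).+1%N => //.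
  have k1 : 0 <= 1 / a by rewrite divr_ge0// ltW.
  have k2 : 0 <= (1 / a) ^+ 2 by rewrite exprn_ge0.
  have := truncnS_gt (1 / a); have := truncnS_gt ((1 / a) ^+ 2).
  move=> /ltW/le_trans h2 /ltW/le_trans h1.
  by split; [apply: h1|apply: h2]; rewrite ler_nat ltnS leqW ?leq_addr ?leq_addl.
have na : n.+1%:R^-1 <= a.
  by rewrite invf_ple ?posrE//; case: nP; rewrite div1r.
exists n => x y xb yb.
have {xb}xa : `|x - x0| < a.
  by move: xb; rewrite -ball_normE/= distrC => /lt_le_trans; apply.
have {yb}ya : `|y| < a by exact: lt_le_trans na.
have near_x0 (t : R) : 0 <= t <= 1 -> `|(x + t *: y) - x0| < m.
  move=> /andP[t0 t1]; rewrite addrAC (le_lt_trans (ler_normD _ _))// -am ltrD//.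
  rewrite normrZ ger0_norm// (le_lt_trans _ ya)//.
  by rewrite -[leRHS]mul1r ler_wpM2r.
have [->|y0] := eqVneq y 0.
  by rewrite addr0 subrr linear0 subrr normr0 mulr_ge0// exprn_ge0.
have yn0 : 0 < `|y| by rewrite normr_gt0.
have [t t01 ->] : exists2 t : R, 0 <= t <= 1 & f (x + y) - f x = 'd f (x + t *: y) y.
  by apply: mvt_line => t /near_x0/mA/df.
pose c := a / `|y|; have c0 : 0 < c by rewrite divr_gt0.
pose v := c *: y; have va : `|v| = a.
  by rewrite /v normrZ gtr0_norm// /c divfK// gt_eqF.
have [s s01 sE] : exists2 s : R, 0 <= s <= 1 &
    Tf ((x, v) + (t *: y, 0)) - Tf (x, v) = 'd Tf ((x, v) + s *: (t *: y, 0)) (t *: y, 0).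
  apply: mvt_line => s /andP[s0 s1]; apply: dTf; split => //=; apply: mA.
  rewrite scalerA near_x0//; case/andP: t01 => t0 t1.
  by rewrite mulr_ge0//= mulr_ile1.
have Tfy z : 'd f z y = c^-1 * Tf (z, v).
  by rewrite /Tf/= /v linearZ/= mulKf// gt_eqF.
rewrite !Tfy -mulrBr normrM.
have -> : Tf (x + t *: y, v) = Tf ((x, v) + (t *: y, 0)).
  by congr Tf; congr pair; rewrite /= addr0.
rewrite sE.
have -> : (t *: y, 0 : E) = c^-1 *: (t *: v, 0).
  have -> : t *: y = c^-1 *: (t *: v).
    by rewrite /v !scalerA mulrAC mulVf ?mul1r// gt_eqF.
  by congr pair; rewrite /= scaler0.
have ci : `|c^-1| = c^-1 by rewrite gtr0_norm// invr_gt0.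
rewrite linearZ/= normrM !ci mulrA -expr2.
apply: (@le_trans _ _ (c^-1 ^+ 2 * 1)).
  rewrite ler_wpM2l ?exprn_ge0 ?invr_ge0 ?(ltW c0)// ltW//.
  have -> : (x, v) + s *: (c^-1 *: (t *: v, 0)) = (x + (s * t) *: y, v).
    have -> : (s * t) *: y = s *: (c^-1 *: (t *: v)).
      by rewrite /v !scalerA -!mulrA; congr (_ * _ *: _); rewrite mulrCA mulVf ?mulr1// gt_eqF.
    by congr pair; rewrite /= !scaler0 addr0.
  case/andP: t01 => t0 t1; case/andP: s01 => s0 s1.
  apply: dQ.
  - by rewrite (lt_le_trans _ md)// near_x0// mulr_ge0//= mulr_ile1.
  - by rewrite va (lt_le_trans _ md)// -am ltrDl.
  - rewrite normrZ va ger0_norm// (@le_lt_trans _ _ a)//.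
      by rewrite -[leRHS]mul1r ler_wpM2r// ltW.
    by rewrite (lt_le_trans _ md)// -am ltrDl.
rewrite mulr1 /c invf_div expr_div_n mulrC ler_wpM2r ?exprn_ge0//.
by case: nP => _; rewrite div1r exprVn.
Qed.

(** The constant is uniform in [u] by compactness, which turns a pointwise second order remainder
    into one for the sup norm. *)
Lemma taylor2_C0 E (A : set E) (f : E -> R) (X : C0 E) :
  open A -> Ck 2 A f -> (forall u : R, I01 u -> A (X u)) ->
  exists n : nat, forall (u : R) y, I01 u -> `|y| < n.+1%:R^-1 ->
    `|f (X u + y) - f (X u) - 'd f (X u) y| <= n.+1%:R * `|y| ^+ 2.
Proof.
move=> oA C2f XA.
pose P n (u : R) := I01 u -> forall y, `|y| < n.+1%:R^-1 ->
    `|f (X u + y) - f (X u) - 'd f (X u) y| <= n.+1%:R * `|y| ^+ 2.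
have [||n nP] := @near_I01 R P; last by exists n => u y Iu; exact: nP.
- move=> n m u nm Pn Iu y ym; apply: (@le_trans _ _ (n.+1%:R * `|y| ^+ 2)).
    apply: Pn => //; apply: lt_le_trans ym _.
    by rewrite lef_pV2 ?posrE// ler_nat ltnS.
  by rewrite ler_wpM2r ?exprn_ge0// ler_nat ltnS.
- move=> u Iu; have [n nP] := taylor2_near oA C2f (XA u Iu); exists n.
  have e0 : 0 < n.+2%:R^-1 :> R by rewrite invr_gt0.
  have := (cont01P X).1 (@C0_continuous _ _ X) u Iu _ e0.
  apply: filterS => v Xuv Iv y yn; apply: nP => //.
  rewrite -ball_normE/= (le_lt_trans (Xuv Iv))//.
  by rewrite ltf_pV2 ?posrE// ltr_nat.
Qed.

Lemma near_dist E (x : E) (e : R) : 0 < e -> \forall y \near x, `|x - y| < e.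
Proof.
by move=> e0; apply/nbhs_ballP; exists e => // y; rewrite -ball_normE.
Qed.

Lemma near0_norm E (e : R) : 0 < e -> \forall y \near (0 : E), `|y| < e.
Proof.
move=> e0; apply/nbhs_ballP; exists e => // y.
by rewrite -ball_normE/= sub0r normrN.
Qed.

Lemma near_addl E (x : E) (A : set E) : nbhs x A -> \forall y \near (0 : E), A (y + x).
Proof.
move=> /nbhs_ballP[e e0 eA]; apply/nbhs_ballP; exists e => // y.
rewrite -ball_normE/= sub0r normrN => ye; apply: eA.
by rewrite -ball_normE/= opprD addrCA subrr addr0 normrN.
Qed.

Lemma continuous_pairl E F (x : E) : continuous (fun y : F => (x, y)).
Proof.
move=> y A [[P Q] /= [nx ny] PQA]; apply: filterS ny => z Qz.
by apply: PQA; split => //=; exact: nbhs_singleton nx.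
Qed.

Lemma smooth_continuous E F (A : set E) (f : E -> F) : smooth_on A f ->
  forall x, A x -> {for x, continuous f}.
Proof. by move=> sf; exact: (sf 0). Qed.

Lemma smooth_differentiable E F (A : set E) (f : E -> F) : smooth_on A f ->
  forall x, A x -> differentiable f x.
Proof. by move=> sf; case: (sf 1). Qed.

Lemma smooth_tangent E F (A : set E) (f : E -> F) : smooth_on A f ->
  smooth_on (A `*` setT) (fun p : E * E => 'd f (p.1) p.2).
Proof. by move=> sf k; case: (sf k.+1). Qed.

(** Uniform continuity along the compact curve, comparing with all nearby points [y] of [E] and not
    only with points of the curve. *)
Lemma continuous_C0map E (A : set E) (f : E -> R) (X : C0 E) :
  open A -> (forall x, A x -> {for x, continuous f}) ->
  (forall u : R, I01 u -> A (X u)) -> {for X, continuous (C0map f)}.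
Proof.
move=> oA cf XA; suff : C0map f @ X --> C0map f X by [].
apply/(@cvgrPdist_le _ _ _ _ (nbhs_filter X)) => e e0.
pose P n (u : R) := I01 u -> forall y, `|y - X u| < n.+1%:R^-1 ->
  `|f (X u) - f y| <= e.
have [||n nP] := @near_I01 R P.
- by move=> n m u nm Pn Iu y /lt_le_trans ym; apply: Pn => //; apply: ym;
    rewrite lef_pV2 ?posrE// ler_nat ltnS.
- move=> u Iu; have e2 : 0 < e / 2 by rewrite divr_gt0.
  have /cvgrPdist_le/(_ _ e2)/ball_natP[n nP] := cf _ (XA u Iu).
  exists (n.+1 + n.+1)%N; pose d : R := (n.+1 + n.+1).+1%:R^-1.
  have d0 : 0 < d by rewrite invr_gt0.
  have d2 : d + d <= n.+1%:R^-1 by exact: invn_double.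
  have := (cont01P X).1 (@C0_continuous _ _ X) u Iu _ d0.
  apply: filterS => v Xuv Iv y ym.
  have h1 : `|f (X u) - f (X v)| <= e / 2.
    apply: nP; rewrite -ball_normE/= (le_lt_trans (Xuv Iv))//.
    by rewrite (lt_le_trans _ d2)// ltrDl.
  have h2 : `|f (X u) - f y| <= e / 2.
    apply: nP; rewrite -ball_normE/= (le_lt_trans (ler_distD (X v) _ _))//.
    by rewrite (lt_le_trans _ d2)// ler_ltD//; [exact: Xuv|rewrite distrC].
  by rewrite [e]splitr (le_trans (ler_distD (f (X u)) _ _))// lerD// distrC.
have oO := open_C0 (E := E) oA.
have n0 : 0 < n.+1%:R^-1 :> R by rewrite invr_gt0.
apply: filterS2 (open_nbhs_nbhs (conj oO XA)) (near_dist X n0) => Y YA XY.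
rewrite C0_normE; apply: C0_norm_le => u Iu; rewrite C0B.
rewrite !(C0mapE cf)//; apply: nP => //.
by rewrite -C0B (le_lt_trans (C0_eval _ _))// distrC.
Qed.

(** The differential acts pointwise, by df at X(u) applied to Y(u). It is stated through [C0pair] so
    as to be a superposition operator again. *)
Lemma C0map_diff E (A : set E) (f : E -> R) (X : C0 E) : open A ->
  smooth_on A f -> (forall u : R, I01 u -> A (X u)) ->
  differentiable (C0map f) X /\
  forall Y, 'd (C0map f) X Y = C0map (fun p : E * E => 'd f (p.1) p.2) (C0pair (X, Y)).
Proof.
move=> oA sf XA; have sTf := smooth_tangent sf.
have oAT := openXT (F := E) oA.
have cf := smooth_continuous sf; have cTf := smooth_continuous sTf.
have XYA Y (u : R) : I01 u -> (A `*` setT) (C0pair (X, Y) u).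
  by move=> Iu; rewrite C0pairE//; split=> //=; exact: XA.
pose D Y := C0map (fun p : E * E => 'd f (p.1) p.2) (C0pair (X, Y)).
have DE Y (u : R) : I01 u -> D Y u = 'd f (X u) (Y u).
  by move=> Iu; rewrite /D (C0mapE cTf)//; [rewrite C0pairE|exact: XYA].
have lD : linear D.
  by move=> a Y Z; apply: C0_ext => u Iu; rewrite C0D C0Z !DE// linearP.
have cD : continuous D.
  move=> Y; apply: (@continuous_comp _ _ _ (fun Y => C0pair (X, Y))
    (C0map (fun p : E * E => 'd f (p.1) p.2))).
    apply: (@continuous_comp _ _ _ (fun Y => (X, Y)) (@C0pair _ E E)).
      exact: continuous_pairl.
    exact: (clinear_C0pair E E).2.
  by apply: (continuous_C0map oAT cTf) => u Iu; exact: XYA.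
pose L : {linear C0 E -> C0 R} := HB.pack D (GRing.isLinear.Build _ _ _ _ _ lD).
suff [dX dE] : differentiable (C0map f) X /\ 'd (C0map f) X = L :> (_ -> _).
  by split=> // Y; rewrite dE.
apply: diff_of_bound; first exact: cD.
move=> e e0; have [n nP] := taylor2_C0 oA (sf 2) XA.
have oO := open_C0 (E := E) oA.
have n0 : 0 < n.+1%:R :> R by [].
have N1 := near_addl (open_nbhs_nbhs (conj oO XA)).
have N2 : \forall Y \near (0 : C0 E), `|Y| < n.+1%:R^-1.
  by apply: near0_norm; rewrite invr_gt0.
(* This threshold turns the remainder (n+1) |Y|^2 into at most e |Y|. *)
have N3 : \forall Y \near (0 : C0 E), `|Y| < n.+1%:R^-1 * e.
  by apply: near0_norm; rewrite mulr_gt0// invr_gt0.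
apply: filterS3 N1 N2 N3 => Y YXA Yn Ye.
rewrite C0_normE; apply: C0_norm_le => u Iu; rewrite !C0B -[L Y]/(D Y) DE//.
rewrite (C0mapE cf YXA)// (C0mapE cf XA)// C0D.
rewrite [Y u + X u]addrC (le_trans (nP _ _ Iu _))//.
  by rewrite (le_lt_trans (C0_eval _ _)).
apply: (@le_trans _ _ (n.+1%:R * `|Y| ^+ 2)).
  by rewrite ler_wpM2l// ler_pXn2r ?nnegrE// C0_eval.
by rewrite expr2 mulrA ler_wpM2r// -ler_pdivlMl// ltW.
Qed.

(* The tangent map of [C0map f] is [C0map] of the tangent map of [f], hence the induction on [k]. *)
Lemma smooth_C0map E (A : set E) (f : E -> R) : open A -> smooth_on A f ->
  smooth_on [set X : C0 E | forall u : R, I01 u -> A (X u)] (C0map f).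
Proof.
move=> oA sf k; elim: k E A f oA sf => [|k IH] E A f oA sf.
  by move=> X XA; exact: (continuous_C0map oA (smooth_continuous sf)).
split; first by move=> X XA; have [] := C0map_diff oA sf XA.
have oAT := openXT (F := E) oA; have sTf := smooth_tangent sf.
have oO := openXT (F := C0 E) (open_C0 oA).
have := Ck_comp oO _ (Ck_lin _ _ (clinear_C0pair E E)) (IH _ _ _ oAT sTf).
move=> /(_ _)/Ck_congr; apply => //.
  by move=> [X Y] [/= XA _]; have [_ ->] := C0map_diff oA sf XA.
by move=> [X Y] [/= XA _] u Iu; rewrite C0pairE//; split=> //=; exact: XA.
Qed.

End Nemytskii.

(** * Curves of class C^1 and primitives *)

Section C1Toolkit.
Variable R : realType.
Implicit Types E F V W : normedModType R.

Lemma is_derive_pair E F (f : R -> E) (g : R -> F) (df : E) (dg : F) (t : R) :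
  is_derive t 1 f df -> is_derive t 1 g dg ->
  is_derive t 1 (fun s => (f s, g s)) (df, dg).
Proof.
move=> [Df <-] [Dg <-].
have d1 : differentiable f t by exact/derivable1_diffP.
have d2 : differentiable g t by exact/derivable1_diffP.
have dfg := differentiable_pair d1 d2.
by apply: DeriveDef; [exact/derivable1_diffP|rewrite !deriveE// diff_pair].
Qed.

Lemma is_derive_scale E (k : R -> R) (f : R -> E) (dk : R) (df : E) (t : R) :
  is_derive t 1 k dk -> is_derive t 1 f df ->
  is_derive t 1 (fun s => k s *: f s) (dk *: f t + k t *: df).
Proof.
move=> Dk Df.
pose b : {bilinear R -> E -> E} := HB.pack (@GRing.scale R E)
  (bilinear_isBilinear.Build R R E E _ _ _ (@scale_bilinear R E)).
have cb : continuous (fun p : R * E => b p.1 p.2).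
  by move=> p; exact: scale_continuous.
have db := differentiable_bilin (k t, f t) cb.
have := is_derive_comp_diff (is_derive_pair Dk Df) db.
by rewrite diff_bilin//= addrC.
Qed.

Lemma is_derive_expR_comp (c : R -> R) (c' t : R) : is_derive t 1 c c' ->
  is_derive t 1 (fun s => expR (c s)) (expR (c t) * c').
Proof.
move=> dc; have de : differentiable (@expR R) (c t).
  by apply/derivable1_diffP; exact: derivable_expR.
have := is_derive_comp_diff dc de; rewrite diff_real//.
have [_ ->] := @is_derive_expR R (c t); move/is_derive_eq; apply.
by rewrite /GRing.scale/= mulrC.
Qed.

Lemma I01_oo (u : R) : `]0, 1[%classic u -> I01 u.
Proof. by rewrite /= !in_itv/= => /andP[/ltW -> /ltW ->]. Qed.

Lemma near_oo (u : R) : `]0, 1[%classic u -> \forall v \near u, `]0, 1[%classic v.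
Proof. by move=> u01; apply: open_nbhs_nbhs; split=> //; exact: itv_open. Qed.

Lemma cont01_oo V (f : R -> V) (u : R) : {within I01, continuous f} ->
  `]0, 1[%classic u -> {for u, continuous f}.
Proof.
move=> /cont01P cf u01; suff : f @ u --> f u by [].
apply/cvgrPdist_le => e e0.
apply: filterS2 (near_oo u01) (cf u (I01_oo u01) e e0) => v v01; apply.
exact: I01_oo.
Qed.

(** The uniqueness argument behind the identities between phi, holonomy and exponential: a suitable
    combination has derivative 0, so no uniqueness theorem for differential equations is called
    upon. *)
Lemma cst01 (f : R -> R) : {within I01, continuous f} ->
  (forall u : R, `]0, 1[%classic u -> is_derive u 1 f 0) ->
  forall u : R, I01 u -> f u = f 0.
Proof.
move=> cf df u; rewrite /= in_itv/= => /andP[]; rewrite le_eqVlt => /orP[/eqP<-//|u0 u1].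
have [||v _] := @MVT R f (fun=> 0) 0 u u0.
- move=> v; rewrite in_itv/= => /andP[v0 vu]; apply: df.
  by rewrite /= in_itv/= v0 (lt_le_trans vu).
- apply: continuous_subspaceW cf => v /=; rewrite !in_itv/= => /andP[-> vu].
  exact: le_trans u1.
by rewrite mul0r => /subr0_eq.
Qed.

(** The derivative is part of the data; an incompatible pair gives 0 by default. *)
Definition C1of V (f : R -> V) (g : C0 V) : C1 V := insubd 0 (C0of f, g).

Lemma C1ofP V (f : R -> V) (g : C0 V) : {within I01, continuous f} ->
  (forall u : R, `]0, 1[%classic u -> is_derive u 1 f (g u)) ->
  C1_pair (C1of f g) = (C0of f, g).
Proof.
move=> cf df; apply: (@insubdK _ _ (C1 V)); apply/asboolP => u u01 /=.
apply: near_eq_is_derive (df u u01).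
by apply: filterS (near_oo u01) => v /I01_oo Iv; rewrite C0ofE.
Qed.

Lemma C1ofE V (f : R -> V) (g : C0 V) (u : R) : {within I01, continuous f} ->
  (forall u : R, `]0, 1[%classic u -> is_derive u 1 f (g u)) ->
  I01 u -> C1of f g u = f u.
Proof.
by move=> cf df Iu; rewrite /C1_fun C1ofP//= C0ofE.
Qed.

Lemma C1of_deriv V (f : R -> V) (g : C0 V) : {within I01, continuous f} ->
  (forall u : R, `]0, 1[%classic u -> is_derive u 1 f (g u)) ->
  C1_deriv (C1of f g) = g.
Proof. by move=> cf df; rewrite /C1_deriv C1ofP. Qed.

Definition C1val V (X : C1 V) : C0 V := (C1_pair X).1.

Lemma C1valE V (X : C1 V) (u : R) : C1val X u = X u. Proof. by []. Qed.

Lemma C1_continuous V (X : C1 V) : {within I01, continuous X}.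
Proof. exact: (@C0_continuous _ _ (C1val X)). Qed.

Lemma C1_is_derive V (X : C1 V) (u : R) : `]0, 1[%classic u ->
  is_derive u 1 (X : R -> V) (C1_deriv X u).
Proof.
move: u; case: X => p /= pP u u01.
by move/asboolP : (pP) => /(_ u u01).
Qed.

Lemma C1D V (X Y : C1 V) u : (X + Y) u = X u + Y u. Proof. by []. Qed.
Lemma C1B V (X Y : C1 V) u : (X - Y) u = X u - Y u. Proof. by []. Qed.
Lemma C1Z V a (X : C1 V) u : (a *: X) u = a *: X u. Proof. by []. Qed.

Lemma C1_normE V (X : C1 V) : `|X| = Num.max `|C1val X| `|C1_deriv X|.
Proof. by []. Qed.

Lemma clinear_C1val V : clinear (@C1val V).
Proof.
by apply: (@clinear_bound _ _ _ _ 1) => // X; rewrite mul1r C1_normE le_max lexx.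
Qed.

Lemma clinear_C1_deriv V : clinear (@C1_deriv R V).
Proof.
by apply: (@clinear_bound _ _ _ _ 1) => // X; rewrite mul1r C1_normE le_max lexx orbT.
Qed.

Lemma clinear_C1_eval V (u : R) : clinear (fun X : C1 V => X u).
Proof. exact: clinear_comp (clinear_C1val V) (clinear_C0_eval V u). Qed.

Lemma C1_ext V (X Y : C1 V) : (forall u : R, I01 u -> X u = Y u) ->
  C1_deriv X = C1_deriv Y -> X = Y.
Proof.
move=> XY dXY; apply: val_inj => /=.
rewrite [LHS]surjective_pairing [RHS]surjective_pairing; congr pair => //.
exact: C0_ext.
Qed.

Lemma C1_inj0 (X Y : C1 R) : C1_deriv X = C1_deriv Y -> X 0 = Y 0 -> X = Y.
Proof.
move=> dXY XY0; apply: C1_ext => // u Iu; apply/subr0_eq; rewrite -C1B.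
have d0 (v : R) : `]0, 1[%classic v -> is_derive v 1 ((X - Y : C1 R) : R -> R) 0.
  move=> v01; have := C1_is_derive (X - Y) v01.
  rewrite (_ : C1_deriv (X - Y) = C1_deriv X - C1_deriv Y)// dXY.
  by rewrite C0B subrr.
by rewrite (cst01 (@C1_continuous _ (X - Y)) d0 Iu) C1B XY0 subrr.
Qed.

Let leb := @lebesgue_measure R.

Lemma C0_integrable (f : C0 R) : leb.-integrable `[0, 1] (EFin \o f).
Proof.
apply: continuous_compact_integrable; first exact: segment_compact.
exact: C0_continuous.
Qed.

Lemma prim_continuous (f : C0 R) :
  {within I01, continuous (fun u : R => \int[leb]_(v in `[0, u]) f v)}.
Proof. exact: (parameterized_integral_continuous ler01 (C0_integrable f)). Qed.

Lemma prim_is_derive (f : C0 R) (u : R) : `]0, 1[%classic u ->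
  is_derive u 1 (fun u : R => \int[leb]_(v in `[0, u]) f v) (f u).
Proof.
move=> u01; have cf : {for u, continuous f}.
  by apply: cont01_oo u01; exact: C0_continuous.
move: u01; rewrite /= in_itv/= => /andP[u0 u1].
have [df dE] := continuous_FTC1_closed u1 (C0_integrable f) u0 cf.
rewrite derive1E in dE; exact: (DeriveDef df dE).
Qed.

Definition prim (f : C0 R) : C1 R :=
  C1of (fun u : R => \int[leb]_(v in `[0, u]) f v) f.

Lemma primE (f : C0 R) (u : R) : I01 u -> prim f u = \int[leb]_(v in `[0, u]) f v.
Proof. by move=> Iu; rewrite /prim (C1ofE (@prim_continuous f) (@prim_is_derive f) Iu). Qed.

Lemma prim_deriv (f : C0 R) : C1_deriv (prim f) = f.
Proof. exact: (C1of_deriv (@prim_continuous f) (@prim_is_derive f)). Qed.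

Lemma prim0 (f : C0 R) : prim f 0 = 0.
Proof.
by rewrite primE ?set_itv1 ?Rintegral_set1//; exact: I01_0.
Qed.

Lemma C1_mvt (X : C1 R) (u : R) : I01 u -> `|X u - X 0| <= `|C1_deriv X|.
Proof.
rewrite /= in_itv/= => /andP[]; rewrite le_eqVlt => /orP[/eqP<-|u0 u1].
  by rewrite subrr normr0.
have [||v _ ->] := @MVT R X (C1_deriv X) 0 u u0.
- move=> v; rewrite in_itv/= => /andP[v0 vu]; apply: C1_is_derive.
  by rewrite /= in_itv/= v0 (lt_le_trans vu).
- apply: continuous_subspaceW (@C1_continuous _ X) => v /=; rewrite !in_itv/= => /andP[-> vu].
  exact: le_trans u1.
rewrite subr0 normrM -[leRHS]mulr1 ler_pM// ?C0_eval//.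
by rewrite gtr0_norm.
Qed.

Lemma clinear_prim : clinear prim.
Proof.
apply: (@clinear_bound _ _ _ _ 1).
  move=> a f g; apply: C1_inj0; last by rewrite C1D C1Z !prim0 scaler0 addr0.
  by rewrite (clinear_C1_deriv R).1 !prim_deriv.
move=> f; rewrite mul1r C1_normE prim_deriv ge_max lexx andbT C0_normE.
apply: C0_norm_le => u Iu; rewrite C1valE -[prim f u]subr0 -(prim0 f).
by rewrite (le_trans (C1_mvt _ Iu))// prim_deriv.
Qed.

Definition C1map E F (l : E -> F) (X : C1 E) : C1 F :=
  C1of (l \o X) (C0map l (C1_deriv X)).

Lemma C1map_subproof E F (l : E -> F) (X : C1 E) : clinear l ->
  {within I01, continuous (l \o X)} /\
  (forall u : R, `]0, 1[%classic u -> is_derive u 1 (l \o X) (C0map l (C1_deriv X) u)).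
Proof.
move=> cl; split.
  apply/subspace_continuousP => v Iv.
  have /subspace_continuousP/(_ v Iv) cX := @C1_continuous _ X.
  by apply: cvg_comp; [exact: cX|exact: cl.2].
move=> u u01; rewrite C0map_clinE//; last exact: I01_oo.
exact: is_derive_clinear (C1_is_derive X u01).
Qed.

Lemma C1mapE E F (l : E -> F) (X : C1 E) (u : R) : clinear l -> I01 u ->
  C1map l X u = l (X u).
Proof. by move=> /(C1map_subproof X)[cX dX]; exact: (C1ofE cX dX). Qed.

Lemma C1map_deriv E F (l : E -> F) (X : C1 E) : clinear l ->
  C1_deriv (C1map l X) = C0map l (C1_deriv X).
Proof. by move=> /(C1map_subproof X)[cX dX]; exact: (C1of_deriv cX dX). Qed.

Lemma C0map_bound E F (l : E -> F) (k : R) (f : C0 E) : clinear l -> 0 <= k ->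
  (forall x, `|l x| <= k * `|x|) -> `|C0map l f| <= k * `|f|.
Proof.
move=> cl k0 kP.
rewrite [leLHS]C0_normE; apply: C0_norm_le => u Iu; rewrite C0map_clinE//.
by rewrite (le_trans (kP _))// ler_wpM2l// C0_eval.
Qed.

Lemma C1val_C1map E F (l : E -> F) (X : C1 E) : clinear l ->
  C1val (C1map l X) = C0map l (C1val X).
Proof.
move=> cl; apply: C0_ext => u Iu.
by rewrite C0map_clinE// C1valE C1mapE.
Qed.

Lemma linear_C1map E F (l : E -> F) : clinear l -> linear (C1map l).
Proof.
move=> cl a X Y; apply: C1_ext.
  by move=> u Iu; rewrite C1D C1Z !C1mapE// C1D C1Z cl.1.
rewrite C1map_deriv//.
have -> : C1_deriv (a *: X + Y) = a *: C1_deriv X + C1_deriv Y by [].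
have -> : C1_deriv (a *: C1map l X + C1map l Y) =
  a *: C1_deriv (C1map l X) + C1_deriv (C1map l Y) by [].
by rewrite !C1map_deriv// (clinear_C0map cl).1.
Qed.

Lemma clinear_C1map E F (l : E -> F) : clinear l -> clinear (C1map l).
Proof.
move=> cl; have [ll lc] := cl.
pose L : {linear E -> F} := HB.pack l (GRing.isLinear.Build _ _ _ _ _ ll).
have [k k0 kP] := linear_lipschitz (lc : continuous L).
apply: (@clinear_bound _ _ _ _ k); first exact: linear_C1map.
move=> X; rewrite !C1_normE C1map_deriv// C1val_C1map//.
rewrite maxr_pMr ?(ltW k0)// ge_max !le_max.
by rewrite !(C0map_bound _ cl (ltW k0) kP) orbT.
Qed.

Lemma clinear_coord n (i : 'I_n.+1) : clinear (fun v : 'rV[R]_n.+1 => v 0 i).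
Proof.
split; first by move=> a u v; rewrite !mxE.
by move=> v; exact: coord_continuous.
Qed.

End C1Toolkit.

(** * Concatenation of paths *)

Section Joined.
Variable R : realType.
Implicit Types E F V W : normedModType R.

Lemma is_derive_of_bound E (f : R -> E) (d : E) (x : R) :
  (forall e : R, 0 < e -> \forall h \near (0 : R),
     `|f (h + x) - f x - h *: d| <= e * `|h|) -> is_derive x 1 f d.
Proof.
move=> H; have [ll cl] := clinear_scalel d.
pose L : {linear R -> E} := HB.pack (fun s : R => s *: d) (GRing.isLinear.Build _ _ _ _ _ ll).
have [df dE] := @diff_of_bound R R E f L x cl H.
apply: DeriveDef; first exact/derivable1_diffP.
by rewrite deriveE// dE /= scale1r.
Qed.

(** The truncated power of quadratic splines: unlike max(0, x) it is of class C^1, with derivative 2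
    max(0, x). *)
Definition pos2 (x : R) : R := (Num.max 0 x) ^+ 2.

Lemma is_derive_pos2 (x : R) : is_derive x 1 pos2 (2 * Num.max 0 x).
Proof.
have [x0|x0|<-] := ltgtP 0 x.
- apply: (@near_eq_is_derive R R R (fun x : R => x * x)).
    near=> y; rewrite /pos2 max_r// ltW//; near: y.
    exact: lt_nbhsr.
  have := is_derive_scale (is_derive_id x 1) (is_derive_id x 1).
  by move/is_derive_eq; apply; rewrite -[1 *: x]/(1 * x) -[x *: 1]/(x * 1); ring.
- apply: (@near_eq_is_derive R R R (cst 0)).
    near=> y; rewrite /pos2 max_l ?expr0n// ltW//; near: y.
    exact: lt_nbhsl.
  by rewrite mulr0; exact: is_derive_cst.
- apply: is_derive_of_bound => e e0.
  apply: filterS (@near0_norm R R e e0) => h he.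
  rewrite /pos2 addr0 maxxx mulr0 scaler0 expr0n/= !subr0 normrX expr2.
  have hm : `|Num.max 0 h| <= `|h|.
    by have [h0|h0] := leP 0 h; [exact: lexx|rewrite normr0].
  by rewrite ler_pM// (le_trans hm) ?ltW.
Unshelve. all: by end_near. Qed.

(* [step01] goes from 0 to 1 on [0, 1] and is constant outside, so that paths reparametrized by
   it can be concatenated without losing a continuous velocity. *)
Definition step01 (x : R) : R := 2 * pos2 x - 4 * pos2 (x - 2^-1) + 2 * pos2 (x - 1).
Definition step01' (x : R) : R :=
  4 * Num.max 0 x - 8 * Num.max 0 (x - 2^-1) + 4 * Num.max 0 (x - 1).

Lemma is_derive_pos2_affine (a b x : R) :
  is_derive x 1 (fun t => pos2 (a + t * b)) (b * (2 * Num.max 0 (a + x * b))).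
Proof.
have h1 := is_derive_affine a b x.
have h2 : differentiable pos2 (a + x * b) by apply/derivable1_diffP; have [] := is_derive_pos2 (a + x * b).
have := is_derive_comp_diff h1 h2; rewrite diff_real//.
by have [_ ->] := is_derive_pos2 (a + x * b).
Qed.

Lemma is_derive_step01 (a b x : R) :
  is_derive x 1 (fun t => step01 (a + t * b)) (b * step01' (a + x * b)).
Proof.
have h1 := is_derive_pos2_affine a b x.
have h2 := is_derive_pos2_affine (a - 2^-1) b x.
have h3 := is_derive_pos2_affine (a - 1) b x.
have := is_deriveD (is_deriveB (is_deriveZ 2 h1) (is_deriveZ 4 h2)) (is_deriveZ 2 h3).
set f := (f in is_derive _ _ f _) => H.
have fE : f = (fun t => step01 (a + t * b)).
  apply/funext => t; rewrite /f /step01 -[a + t * b - 2^-1]addrAC -[a + t * b - 1]addrAC.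
  by [].
rewrite fE in H; move/is_derive_eq: H; apply.
by rewrite /step01' [a - 2^-1 + _]addrAC [a - 1 + _]addrAC /GRing.scale/=; field.
Qed.

Lemma step01_le0 x : x <= 0 -> step01 x = 0 /\ step01' x = 0.
Proof.
move=> x0; rewrite /step01 /step01' /pos2 !max_l ?expr0n/=; [|lra..].
by split; ring.
Qed.

Lemma step01_ge1 x : 1 <= x -> step01 x = 1 /\ step01' x = 0.
Proof.
move=> x0; rewrite /step01 /step01' /pos2 !max_r; [|lra..].
by split; field.
Qed.

Lemma step01_I x : I01 (step01 x).
Proof.
apply/I01P; have [x0|x0] := leP x 0.
  by rewrite (step01_le0 x0).1 lexx ler01.
have [x1|x1] := leP 1 x; first by rewrite (step01_ge1 x1).1 lexx ler01.
rewrite /step01 /pos2 (max_r (ltW x0)) (@max_l _ _ 0 (x - 1)); last lra.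
have [h|h] := leP (x - 2^-1) 0; rewrite expr0n/=; nra.
Qed.

Lemma step01'_continuous : continuous step01'.
Proof.
have cm (a : R) : continuous (fun x : R => Num.max 0 (x - a)).
  move=> x; apply: (@continuous_max _ _ (cst 0) (fun x : R => x - a)); first exact: cvg_cst.
  by apply: cvgB; [exact: cvg_id|exact: cvg_cst].
have c0 : continuous (fun x : R => Num.max 0 x).
  move=> x; apply: (@continuous_max _ _ (cst 0) id); first exact: cvg_cst.
  exact: cvg_id.
move=> x; apply: cvgD; last by apply: cvgMr; exact: cm.
by apply: cvgB; [apply: cvgMr; exact: c0|apply: cvgMr; exact: cm].
Qed.

Lemma cont01_comp V (f : R -> V) (k : R -> R) : {within I01, continuous f} ->
  continuous k -> (forall t : R, I01 t -> I01 (k t)) ->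
  {within I01, continuous (f \o k)}.
Proof.
move=> /cont01P cf ck kI; apply/cont01P => u Iu e e0.
have fk := cf _ (kI u Iu) e e0.
have H : \forall v \near u, I01 (k v) -> `|f (k u) - f (k v)| <= e := ck u _ fk.
by apply: filterS H => v + Iv; apply; exact: kI.
Qed.

Section Trans.
Variables (B : normedModType R) (S : set B) (sym : B -> B -> Prop).
Hypothesis symZ : forall s v a, S s -> sym s v -> sym s (a *: v).

Lemma joined_refl s : S s -> sym s 0 -> joined S sym s s.
Proof.
move=> Ss s0; exists (cst s); split=> //.
  by move=> t It; split=> //; rewrite derive_cst.
have -> : (fun t : R => 'D_1 (cst s : R -> B) t) = cst (0 : B).
  by apply/funext => t; rewrite derive_cst.
by move=> t; exact: cvg_cst.
Qed.

(** The two paths may meet with different velocities, so each is slowed down to rest at the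
    junction. Reparametrization multiplies velocities by scalars, whence [symZ]. *)
Lemma joined_trans s1 s2 s3 : joined S sym s1 s2 -> joined S sym s2 s3 ->
  joined S sym s1 s3.
Proof.
move=> [c1 [c10 c11 c1P cc1]] [c2 [c20 c21 c2P cc2]].
pose k1 (t : R) := step01 (0 + t * 2); pose k2 (t : R) := step01 (-1 + t * 2).
pose k1' (t : R) := 2 * step01' (0 + t * 2); pose k2' (t : R) := 2 * step01' (-1 + t * 2).
(* [k1] moves only for t in [0, 1/2] and [k2] only in [1/2, 1], so one summand is always at rest. A
   sum, unlike a case distinction at 1/2, is differentiated by the usual rules. *)
pose c t := c1 (k1 t) + (c2 (k2 t) - s2).
have dk1 (t : R) : is_derive t 1 k1 (k1' t) by exact: is_derive_step01.
have dk2 (t : R) : is_derive t 1 k2 (k2' t) by exact: is_derive_step01.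
have dc (t : R) : is_derive t 1 c (k1' t *: 'D_1 c1 (k1 t) + k2' t *: 'D_1 c2 (k2 t)).
  have dd (k k' : R -> R) (b : R -> B) : is_derive t 1 k (k' t) -> derivable b (k t) 1 ->
      is_derive t 1 (b \o k) (k' t *: 'D_1 b (k t)).
    move=> dk /derivable1_diffP db.
    by have := is_derive_comp_diff dk db; rewrite diff_real.
  have [_ d1 _] := c1P _ (step01_I (0 + t * 2)).
  have [_ d2 _] := c2P _ (step01_I (-1 + t * 2)).
  have := is_deriveD (dd _ _ _ (dk1 t) d1) (is_deriveB (dd _ _ _ (dk2 t) d2) (is_derive_cst s2 t 1)).
  by rewrite subr0.
have cE (t : R) : 'D_1 c t = k1' t *: 'D_1 c1 (k1 t) + k2' t *: 'D_1 c2 (k2 t).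
  by have [_ ->] := dc t.
exists c; split.
- rewrite /c /k1 /k2 !mul0r !addr0 (step01_le0 (lexx 0)).1 (step01_le0 (lerN10 R)).1.
  by rewrite c10 c20 subrr addr0.
- have [h1 h2] : (1 <= 0 + 1 * 2 :> R) /\ (1 <= -1 + 1 * 2 :> R) by split; lra.
  rewrite /c /k1 /k2 (step01_ge1 h1).1 (step01_ge1 h2).1 c11 c21.
  by rewrite addrC subrK.
- move=> t It; rewrite cE; have [th|th] := leP t 2^-1.
    have k2t : k2 t = 0 /\ k2' t = 0.
      by rewrite /k2 /k2'; have [-> ->] := @step01_le0 (-1 + t * 2) ltac:(lra); rewrite mulr0.
    rewrite /c k2t.1 k2t.2 c20 subrr addr0 scale0r addr0.
    have [S1 _ s1P] := c1P _ (step01_I (0 + t * 2)).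
    by split; [|have [] := dc t|exact: symZ].
  have k1t : k1 t = 1 /\ k1' t = 0.
    by rewrite /k1 /k1'; have [-> ->] := @step01_ge1 (0 + t * 2) ltac:(lra); rewrite mulr0.
  rewrite /c k1t.1 k1t.2 c11 addrC subrK scale0r add0r.
  have [S1 _ s1P] := c2P _ (step01_I (-1 + t * 2)).
  by split; [|have [] := dc t|exact: symZ].
have -> : (fun t : R => 'D_1 c t) = fun t => k1' t *: 'D_1 c1 (k1 t) + k2' t *: 'D_1 c2 (k2 t).
  by apply/funext => t; exact: cE.
have ck (k k' : R -> R) : (forall t : R, is_derive t 1 k (k' t)) -> continuous k.
  by move=> dk t; apply/differentiable_continuous/derivable1_diffP; have [] := dk t.
have ca (a : R) : continuous (fun t : R => 2 * step01' (a + t * 2)).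
  move=> t; apply: cvgMr; apply: (@continuous_comp _ _ _ (fun t : R => a + t * 2) step01').
    by apply: cvgD; [exact: cvg_cst|apply: cvgMl; exact: cvg_id].
  exact: step01'_continuous.
have cs (k k' : R -> R) (b : R -> B) : continuous k' ->
    {within I01, continuous (b \o k)} -> {within I01, continuous (fun t => k' t *: b (k t))}.
  move=> ck' cb t; apply: cvgZ; last exact: cb.
  exact: (continuous_subspaceT ck').
have h1 : {within I01, continuous (fun t : R => k1' t *: 'D_1 c1 (k1 t))}.
  apply: (cs k1 k1' ('D_1 c1)); first exact: ca.
  apply: (cont01_comp cc1); [exact: ck dk1|by move=> *; exact: step01_I].
have h2 : {within I01, continuous (fun t : R => k2' t *: 'D_1 c2 (k2 t))}.
  apply: (cs k2 k2' ('D_1 c2)); first exact: ca.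
  apply: (cont01_comp cc2); [exact: ck dk2|by move=> *; exact: step01_I].
by move=> t; apply: cvgD; [exact: h1|exact: h2].
Qed.

End Trans.

End Joined.

Section SmoothOn.
Variable R : realType.
Implicit Types E F G : normedModType R.

Lemma smooth_comp E F G (A : set E) (B : set F) (f : E -> F) (g : F -> G) :
  open A -> (forall x, A x -> B (f x)) ->
  smooth_on A f -> smooth_on B g -> smooth_on A (g \o f).
Proof. by move=> oA AB sf sg k; exact: Ck_comp oA AB (sf k) (sg k). Qed.

Lemma smooth_sub E F (A B : set E) (f : E -> F) :
  B `<=` A -> smooth_on A f -> smooth_on B f.
Proof. by move=> BA sf k; exact: Ck_sub BA (sf k). Qed.

Lemma smooth_lin E F (A : set E) (l : E -> F) : clinear l -> smooth_on A l.
Proof. by move=> cl k; exact: Ck_lin. Qed.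

Lemma smooth_pair E F G (A : set E) (f : E -> F) (g : E -> G) : open A ->
  smooth_on A f -> smooth_on A g -> smooth_on A (fun x => (f x, g x)).
Proof. by move=> oA sf sg k; exact: Ck_pair. Qed.

Lemma open_smooth_preimage E F (A : set E) (B : set F) (f : E -> F) :
  open A -> smooth_on A f -> open B -> open (A `&` f @^-1` B).
Proof.
move=> oA sf oB; rewrite openE => x [Ax Bx]; rewrite /interior.
apply: filterI; first exact: open_nbhs_nbhs.
exact: (smooth_continuous sf Ax (open_nbhs_nbhs (conj oB Bx))).
Qed.

End SmoothOn.

(** * Quotients with a global coordinate *)

Section AbstractQuotient.
Variables (R : realType) (B E : normedModType R).

Lemma open_Hausdorff_atlas (G : set E) : open G -> smooth_atlas G (open_subset_atlas G).
Proof.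
move=> oG; split.
- by move=> _ ->; split=> //= x y _ _.
- by move=> x Gx; exists (Chart G id).
- move=> _ _ -> ->; exists id; split => //=.
    by rewrite image_id setIid.
  exact/smooth_lin/clinear_id.
- move=> x y Gx Gy /eqP xy.
  pose e := `|x - y| / 2.
  have e0 : 0 < e by rewrite divr_gt0// normr_gt0 subr_eq0.
  exists (G `&` ball x e), (G `&` ball y e); split.
  + split; first exact: subIsetl.
    move=> _ ->; rewrite image_id /= setIAC setIid; apply: openI => //; exact: ball_open.
  + split; first exact: subIsetl.
    move=> _ ->; rewrite image_id /= setIAC setIid; apply: openI => //; exact: ball_open.
  + by split=> //; exact: ballxx.
  + by split=> //; exact: ballxx.
  + apply/seteqP; split=> // z [[_ xz] [_ yz]].
    move: xz yz; rewrite -!ball_normE/= => xz yz.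
    have := ler_distD z x y; rewrite leNgt => /negP; apply.
    by rewrite [ltRHS]splitr ltrD// distrC.
Qed.

(** Setting: the classes are the level sets of one map [pi] onto [G], which becomes the only chart
    of the quotient. [E_split], a property of finite dimensional [E], provides the complement of the
    kernel that a submersion requires. *)
Variables (S : set B) (sym : B -> B -> Prop) (G : set E) (pi : B -> E).
Hypothesis E_split : forall (K : normedModType R) (l : {linear K -> E}),
  continuous l -> (forall y, exists x, l x = y) -> split_surjection l.
Hypothesis openG : open G.
Hypothesis piG : forall s, S s -> G (pi s).
Hypothesis pi_surj : forall y, G y -> exists2 s, S s & pi s = y.
Hypothesis joinedP : forall s s', S s -> S s' -> joined S sym s s' <-> pi s = pi s'.

(** The choice made by [get] is harmless on a class, where [pi] is constant. *)
Definition qcoord (C : set B) : E := pi (get C).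

Lemma class_ofE s : S s -> class_of S sym s = [set s' | S s' /\ pi s' = pi s].
Proof.
move=> Ss; apply/seteqP; split=> s' [Ss'].
  by move=> /(joinedP Ss Ss') ->.
by move=> e; split=> //; exact/(joinedP Ss Ss')/esym.
Qed.

Lemma qcoord_class s : S s -> qcoord (class_of S sym s) = pi s.
Proof.
move=> Ss; rewrite /qcoord class_ofE//.
by have [] := @getI _ [set s' | S s' /\ pi s' = pi s] s (conj Ss erefl).
Qed.

Lemma quotient_class s : S s -> quotient S sym (class_of S sym s).
Proof. by move=> Ss; exists s; rewrite ?inE. Qed.

Lemma qcoord_inj C C' : quotient S sym C -> quotient S sym C' ->
  qcoord C = qcoord C' -> C = C'.
Proof.
move=> [s Ss <-] [s' Ss' <-].
by rewrite !qcoord_class// !class_ofE// => ->.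
Qed.

Lemma qcoord_in C : quotient S sym C -> G (qcoord C).
Proof. by move=> [s Ss <-]; rewrite qcoord_class//; exact: piG. Qed.

Lemma qcoord_image (O : set E) : qcoord @` (quotient S sym `&` qcoord @^-1` O) = G `&` O.
Proof.
apply/seteqP; split=> [_ [C [qC OC] <-]|y [Gy Oy]].
  by split=> //; exact: qcoord_in.
have [s Ss sy] := pi_surj Gy.
exists (class_of S sym s); rewrite /= ?qcoord_class//.
by split; [exact: quotient_class|rewrite sy].
Qed.

Let atlas : set (chart (set B) E) := [set Chart (quotient S sym) qcoord].

Lemma qcoord_image_quotient : qcoord @` quotient S sym = G.
Proof. by rewrite -[RHS]setIT -qcoord_image preimage_setT setIT. Qed.

Lemma quotient_atlas : smooth_atlas (quotient S sym) atlas.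
Proof.
split.
- move=> _ ->; split=> //= C C'; rewrite !inE; exact: qcoord_inj.
- by move=> C qC; exists (Chart (quotient S sym) qcoord).
- move=> _ _ -> ->; exists id; split => //=.
    by rewrite setIid qcoord_image_quotient.
  exact/smooth_lin/clinear_id.
- move=> C C' qC qC' CC'.
  have [_ _ _ H] := open_Hausdorff_atlas openG.
  have [|Q1 [Q2 [[QG oQ] [QG' oQ'] QC QC' QQ']]] := H _ _ (qcoord_in qC) (qcoord_in qC').
    by move=> /(qcoord_inj qC qC').
  have {}oQ : open Q1 by have := oQ _ erefl; rewrite image_id /= (setIidl QG).
  have {}oQ' : open Q2 by have := oQ' _ erefl; rewrite image_id /= (setIidl QG').
  exists (quotient S sym `&` qcoord @^-1` Q1), (quotient S sym `&` qcoord @^-1` Q2); split.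
  + split; first exact: subIsetl.
    move=> _ -> /=; rewrite setIAC setIid qcoord_image; exact: openI.
  + split; first exact: subIsetl.
    move=> _ -> /=; rewrite setIAC setIid qcoord_image; exact: openI.
  + by split.
  + by split.
  + apply/seteqP; split=> // D [[_ QD] [_ QD']].
    have : (Q1 `&` Q2) (qcoord D) by [].
    by rewrite QQ'.
Qed.

Lemma quotient_diffeo : diffeomorphic (quotient S sym) atlas G (open_subset_atlas G).
Proof.
exists qcoord, (fun y => [set s | S s /\ pi s = y]); split.
- split; first exact: qcoord_in.
  move=> _ _ -> ->; exists id; split=> //=.
    by rewrite qcoord_image setIid.
  exact/smooth_lin/clinear_id.
- split.
    move=> y /pi_surj[s Ss sy]; exists s; rewrite ?inE//.
    by rewrite class_ofE// sy.
  move=> _ _ -> ->; exists id; split.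
  + rewrite image_id /= (_ : _ `&` _ = G)//; apply/seteqP; split; first exact: subIsetl.
    move=> y Gy; split=> //=; have [s Ss sy] := pi_surj Gy.
    by exists s; rewrite ?inE// class_ofE// sy.
  + exact/smooth_lin/clinear_id.
  + move=> y [/= Gy _]; have [s Ss sy] := pi_surj Gy.
    by have := qcoord_class Ss; rewrite class_ofE// sy.
- move=> _ [s Ss <-].
  by rewrite qcoord_class// class_ofE.
- move=> y Gy; have [s Ss sy] := pi_surj Gy.
  by have := qcoord_class Ss; rewrite class_ofE// sy.
Qed.

Variables (K L : completeNormedModType R) (O : set B).
Hypothesis submS : @submanifold R B K L S.
Hypothesis SO : S `<=` O.
Hypothesis smooth_pi : smooth_on O pi.
(* Curves in [S] that lift lines make the differential of [pi] onto on tangent spaces of [S]. *)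
Hypothesis pi_section : forall s v, S s -> exists g : R -> B,
  [/\ g 0 = s, derivable g 0 1 & \forall t \near (0 : R), S (g t) /\ pi (g t) = pi s + t *: v].

(** This exhibits the coordinate image of the solution set as the preimage of an open set under a
    continuous map, hence as open in the model space. *)
Lemma slice_preimage (O' : set B) (psi : B -> K * L) : slice_chart S O' psi ->
  (fun b => (psi b).1) @` (O' `&` S) = (fun k => (k, 0)) @^-1` (psi @` O').
Proof.
move=> [_ _ _ _ Spsi]; apply/seteqP; split=> [_ [b [Ob Sb] <-]|k [b Ob bk]].
  by exists b => //=; rewrite [LHS]surjective_pairing ((Spsi b Ob).1 Sb).
by exists b; rewrite /= ?bk//; split=> //; apply/(Spsi b Ob); rewrite bk.
Qed.

Lemma clinear_pair0 (F H : normedModType R) : clinear (fun k : F => (k, 0 : H)).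
Proof.
apply: (@clinear_bound _ _ _ _ 1).
  by move=> a u v; congr pair; rewrite /= scaler0 addr0.
by move=> x; rewrite mul1r prod_normE/= normr0 ge_max lexx normr_ge0.
Qed.

(** In a slice chart the projection reads [pi \o psi'] on vectors (k, 0). Its differential is onto
    because a curve in [S] above the line pi(s) + t v becomes, in the chart, a curve along which the
    local expression has velocity v. *)
Lemma quotient_submersion :
  smooth_submersion S (@submanifold_atlas R B K L S) (quotient S sym) atlas (class_of S sym).
Proof.
split.
  split; first exact: quotient_class.
  move=> _ _ [P [psi [sl ->]]] ->.
  have [oP opP spsi [psi' spsi' psiK] Spsi] := sl.
  have DE : P `&` S `&` class_of S sym @^-1` quotient S sym = P `&` S.
    apply/seteqP; split; first exact: subIsetl.
    by move=> b [Ob Sb]; split=> //; exact: quotient_class.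
  have oD : open ((fun b => (psi b).1) @` (P `&` S)).
    rewrite (slice_preimage sl); apply: open_comp => // k _.
    exact: (clinear_pair0 K L).2.
  have sinv : smooth_on ((fun b => (psi b).1) @` (P `&` S)) (psi' \o (fun k => (k, 0))).
    apply: smooth_comp spsi' => //; last exact/smooth_lin/clinear_pair0.
    by rewrite (slice_preimage sl).
  exists (pi \o (psi' \o (fun k => (k, 0)))); rewrite /local_expr /= DE; split=> //.
    apply: smooth_comp sinv smooth_pi => //.
    move=> _ [b [Ob Sb] <-]; apply: SO => /=.
    by rewrite -(((Spsi b Ob).1 Sb)) -surjective_pairing psiK.
  move=> b [[Ob Sb] _]; rewrite qcoord_class//=; congr pi.
  by rewrite -(((Spsi b Ob).1 Sb)) -surjective_pairing psiK.
(* Here [g] is any local expression, so only its values at coordinates of solutions are available;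
   the curve stays among them. *)
move=> _ _ g [P [psi [sl ->]]] -> [] /=.
have [oP opP spsi _ Spsi] := sl.
move=> oD sg gE s [Os Ss] qs.
have dg : differentiable g (psi s).1.
  by apply: (smooth_differentiable sg); exists s.
apply: E_split; first exact: diff_continuous.
move=> v; have [gam [gam0 dgam Sgam]] := pi_section v Ss.
have dpsi : differentiable psi (gam 0) by rewrite gam0; exact: (smooth_differentiable spsi).
have D1 := is_derive_comp_diff (derivableP dgam) dpsi.
have D2 := is_derive_clinear (clinear_fst K L) D1.
have dg' : differentiable g ((fst \o (psi \o gam)) 0) by rewrite /= gam0.
have D3 := is_derive_comp_diff D2 dg'.
have D4 : is_derive (0 : R) 1 (g \o (fst \o (psi \o gam))) v.
  apply: (@near_eq_is_derive R R E (fun t : R => pi s + t *: v)); last exact: is_derive_affine.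
  have gO : \forall t \near (0 : R), P (gam t).
    have := differentiable_continuous ((derivable1_diffP _ _).1 dgam).
    by apply; rewrite gam0; exact: open_nbhs_nbhs.
  apply: filterS2 Sgam gO => t [St <-] Ot /=.
  by rewrite -gE ?qcoord_class//; split=> //; exact: quotient_class.
exists (('d psi (gam 0) ('D_1 gam 0)).1).
have [_ <-] := D4; have [_ ->] := D3.
by rewrite /= gam0.
Qed.

Lemma quotient_diffeomorphic : quotient_diffeomorphic_to S sym G.
Proof.
exists K, L; split=> //; exists atlas; split.
- exact: quotient_atlas.
- exact: quotient_submersion.
- exact: open_Hausdorff_atlas.
- exact: quotient_diffeo.
Qed.

End AbstractQuotient.

(** * Leaves and the groupoid *)

(** Both [P] and its negation are open relative to [A], so [A] cannot be divided between them. *)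
Lemma connected_locally_const (T : topologicalType) (A P : set T) (x : T) :
  connected A -> A x -> P x ->
  (forall y, A y -> \forall z \near y, A z -> (P z <-> P y)) -> A `<=` P.
Proof.
move=> cA Ax Px loc.
suff <- : A `&` P = A by exact: subIsetr.
apply: cA; first by exists x.
  exists (interior [set z | A z -> P z]); first exact: open_interior.
  apply/seteqP; split=> y [Ay Py]; split=> //.
    by apply: filterS (loc y Ay) => z zy Az; apply/zy.
  exact: (interior_subset Py).
exists (~` interior [set z | A z -> ~ P z]).
  by apply: open_closedC; exact: open_interior.
apply/seteqP; split=> y [Ay Py]; split=> //.
  by move=> /interior_subset/(_ Ay).
apply: contrapT => nPy; apply: Py.
by apply: filterS (loc y Ay) => z zy Az Pz; apply: nPy; exact/(zy Az).
Qed.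

(** * Linear and separable scalar equations *)

Section Scalar.
Variable R : realType.

(* Gronwall: with [M] a bound of [a], the function [g^2 exp(2 M s)] is nondecreasing. *)
Lemma linear_ode_neq0 (g a : R -> R) :
  (forall t : R, I01 t -> is_derive t 1 g (a t * g t)) ->
  {within I01, continuous a} -> g 0 != 0 -> forall t : R, I01 t -> g t != 0.
Proof.
move=> dg ca g0 t It; apply/negP => /eqP gt0.
have ca' : {within I01, continuous (fun t => `|a t|)}.
  by move=> u; apply: cvg_norm; exact: ca.
have [m _ mP] := EVT_max ler01 ca'; set M := `|a m| in mP.
pose G (s : R) := (g s) ^+ 2 * expR (2 * M * s).
have dG (s : R) : I01 s -> is_derive s 1 G
    (2 * (a s + M) * (g s) ^+ 2 * expR (2 * M * s)).
  move=> Is; have h1 := dg s Is.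
  have h2 := is_derive_scale h1 h1.
  have h3 : is_derive s 1 (fun s : R => 0 + s *: (2 * M)) (2 * M) by exact: is_derive_affine.
  have := is_derive_scale h2 (is_derive_expR_comp h3).
  have -> : (fun s => (g s *: g s) *: expR (0 + s *: (2 * M))) = G.
    by apply/funext => v; rewrite /G /= expr2 add0r [2 * M * v]mulrC.
  move/is_derive_eq; apply.
  by rewrite /= add0r [2 * M * s]mulrC /GRing.scale/=; ring.
have [s s0t sE] : exists2 s : R, 0 <= s <= t & G t - G 0 =
    2 * (a s + M) * (g s) ^+ 2 * expR (2 * M * s) * (t - 0).
  move: It; rewrite /= in_itv/= => /andP[t0 t1].
  have sub (s : R) : 0 <= s <= t -> I01 s.
    by move=> /andP[s0 st]; apply/I01P; rewrite s0 (le_trans st).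
  pose G' (s : R) := 2 * (a s + M) * (g s) ^+ 2 * expR (2 * M * s).
  have H1 (s : R) : s \in `]0, t[%R -> is_derive s 1 G (G' s).
    by rewrite in_itv/= => /andP[/ltW s0 /ltW st]; apply: dG; apply: sub; rewrite s0.
  have H2 : {within `[0, t], continuous G}.
    apply: derivable_within_continuous => s; rewrite in_itv/= => st.
    by have [] := dG s (sub s st).
  have [s st sE] := MVT_segment t0 H1 H2.
  by exists s => //; move: st; rewrite in_itv.
have : 0 <= G t - G 0.
  rewrite sE; case/andP: s0t => s0 st.
  have Is : I01 s.
    by apply/I01P; rewrite s0/= (le_trans st)//; move: It; rewrite /= in_itv/= => /andP[].
  apply: mulr_ge0; last by rewrite subr0 (le_trans s0).
  apply: mulr_ge0; last exact: expR_ge0.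
  apply: mulr_ge0; last exact: sqr_ge0.
  apply: mulr_ge0 => //; rewrite -lerBlDr sub0r lerNl (le_trans (ler_norm _))// normrN.
  by apply: mP; rewrite in_itv/=; move: Is; rewrite /= in_itv/=.
rewrite /G gt0 expr0n/= mul0r mulr0 expR0 mulr1 sub0r oppr_ge0.
by rewrite leNgt exprn_even_gt0//= g0.
Qed.

Lemma cont01_sign (g : R -> R) : {within I01, continuous g} ->
  (forall t : R, I01 t -> g t != 0) -> forall t : R, I01 t -> 0 < g 0 * g t.
Proof.
move=> cg g0 t It; have g00 := g0 0 (I01_0 R); have gt0 := g0 t It.
rewrite lt_neqAle eq_sym mulf_neq0//= leNgt; apply/negP => gneg.
have t01 : 0 <= t <= 1 by move: It; rewrite /= in_itv.
case/andP: (t01) => t0 t1.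
have [||s] := @IVT R g 0 t 0 t0.
- apply: continuous_subspaceW cg => s /=; rewrite !in_itv/= => /andP[-> st].
  exact: le_trans t1.
- rewrite ge_min le_max.
  have [h|h] := ltP 0 (g 0).
    by rewrite (ltW h)/= andbT; move: gneg; rewrite pmulr_rlt0// => /ltW ->; rewrite ?orbT.
  have h' : g 0 < 0 by rewrite lt_neqAle g00.
  by rewrite ?h /=; move: gneg; rewrite nmulr_rlt0// => /ltW ->; rewrite ?orbT.
- rewrite in_itv/= => /andP[s0 st] gs.
  have Is : I01 s by apply/I01P; rewrite s0 (le_trans st).
  by have := g0 s Is; rewrite gs eqxx.
Qed.

(* The flow of [s' = a / psi s] is the inverse of an antiderivative of [psi / a]; working
   on [1/3, 2/3] leaves room for two-sided derivatives at the end points. *)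
Lemma separable_ode (psi : C0 R) : (forall u : R, I01 u -> psi u != 0) ->
  exists (a : R) (s : R -> R), [/\ s 0 = 1/3, s 1 = 2/3
    & forall t : R, I01 t -> 1/3 <= s t <= 2/3 /\ is_derive t 1 s (a / psi (s t))].
Proof.
move=> psi0; pose T := prim psi.
have dT (u : R) : `]0, 1[%classic u -> is_derive u 1 (T : R -> R) (psi u).
  by move=> u01; have := C1_is_derive T u01; rewrite prim_deriv.
have cT : {within I01, continuous T} by exact: (@C1_continuous _ _ T).
have Tlt (u v : R) : I01 u -> I01 v -> u < v -> T u != T v.
  rewrite /= !in_itv/= => /andP[u0 u1] /andP[v0 v1] uv; apply/negP => /eqP Tuv.
  have H1 (w : R) : w \in `]u, v[%R -> is_derive w 1 (T : R -> R) (psi w).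
    rewrite in_itv/= => /andP[uw wv]; apply: dT.
    by rewrite /= in_itv/= (le_lt_trans u0)//= (lt_le_trans wv).
  have H2 : {within `[u, v], continuous (T : R -> R)}.
    apply: continuous_subspaceW cT => w /=; rewrite !in_itv/= => /andP[uw wv].
    by rewrite (le_trans u0)//= (le_trans wv).
  have [w wuv] := MVT uv H1 H2.
  move: wuv; rewrite in_itv/= => /andP[uw wv].
  rewrite Tuv subrr => /esym/eqP; rewrite mulf_eq0 subr_eq0 (gt_eqF uv) orbF.
  apply/negP/psi0/I01P.
  by rewrite (le_trans u0 (ltW uw))//= (le_trans (ltW wv)).
have Tinj (u v : R) : I01 u -> I01 v -> T u = T v -> u = v.
  move=> Iu Iv /eqP Tuv; apply/eqP; move: Tuv; apply: contraTT.
  rewrite neq_lt => /orP[|]; first exact: Tlt.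
  by move=> /(Tlt _ _ Iv Iu); rewrite eq_sym.
have I13 : I01 (1/3 : R) by apply/I01P; lra.
have I23 : I01 (2/3 : R) by apply/I01P; lra.
(* Total travel time: dividing by it makes the motion from 1/3 to 2/3 last exactly from t = 0 to t =
   1. *)
pose a := T (2/3) - T (1/3).
have a0 : a != 0 by rewrite subr_eq0 eq_sym Tlt//; lra.
pose N (u : R) := (T u - T (1/3)) / a.
have dN (u : R) : `]0, 1[%classic u -> is_derive u 1 N (psi u / a).
  move=> u01; have := is_deriveZ a^-1 (is_deriveB (dT u u01) (is_derive_cst (T (1/3)) u 1)).
  rewrite subr0 (_ : a^-1 *: psi u = psi u / a); last by rewrite mulrC.
  rewrite (_ : (_ \*: _) = N)//.
  by apply/funext => v; rewrite /N [RHS]mulrC.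
have cN (u : R) : `]0, 1[%classic u -> {for u, continuous N}.
  by move=> /dN[dNu _]; exact/differentiable_continuous/derivable1_diffP.
have Ninj (u v : R) : I01 u -> I01 v -> N u = N v -> u = v.
  move=> Iu Iv; rewrite /N => /(mulIf _) h; apply: Tinj => //.
  by have /subIr : T u - T (1/3) = T v - T (1/3) by apply: h; rewrite invr_eq0.
pose s (t : R) : R := get [set u : R | I01 u /\ N u = t].
have sN (u : R) : I01 u -> s (N u) = u.
  move=> Iu; have [Is Ns] := @getI _ [set v : R | I01 v /\ N v = N u] u (conj Iu erefl).
  exact: Ninj.
have N0 : N (1/3) = 0 by rewrite /N subrr mul0r.
have N1 : N (2/3) = 1 by rewrite /N mulfV.
exists a, s; split.
- by have := sN _ I13; rewrite N0.
- by have := sN _ I23; rewrite N1.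
- move=> t; rewrite /= in_itv/= => /andP[t0 t1].
  have [u] : exists2 u : R, u \in `[1/3, 2/3] & N u = t.
    apply: IVT; first lra.
      apply: continuous_in_subspaceT => v; rewrite inE/= in_itv/= => /andP[v0 v1].
      by apply: cN; rewrite /= in_itv/=; lra.
    by rewrite N0 N1 min_l// max_r// t0.
  rewrite in_itv/= => u13 Nu.
  have u01 : `]0, 1[%classic u by rewrite /= in_itv/=; lra.
  have Iu := I01_oo u01.
  rewrite -Nu sN//; split=> //.
  have := @is_derive_inverse R N s (psi u / a) u.
  rewrite invf_div; apply.
  + by apply: filterS (near_oo u01) => v /I01_oo; exact: sN.
  + by apply: filterS (near_oo u01) => v; exact: cN.
  + exact: dN.
  + by rewrite mulf_neq0// ?invr_eq0// psi0.
Qed.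

End Scalar.

(** * The plane and its Hamiltonian trajectories *)

Section Plane.
Variable R : realType.
Local Notation R2 := 'rV[R]_2.

Lemma ord2P (i : 'I_2) : i = 0 \/ i = 1.
Proof. by case: i => -[|[|//]] p; [left|right]; exact: val_inj. Qed.

Lemma R2_ext (v w : R2) : v 0 0 = w 0 0 -> v 0 1 = w 0 1 -> v = w.
Proof. by move=> e0 e1; apply/rowP => i; have [->|->] := ord2P i. Qed.

Lemma R2_basis (v : R2) : v = v 0 0 *: delta_mx 0 0 + v 0 1 *: delta_mx 0 1.
Proof.
by apply: R2_ext; rewrite !mxE/= ?mulr1 ?mulr0 ?addr0 ?add0r.
Qed.

Lemma sum_ord2 (V : zmodType) (F : 'I_2 -> V) : \sum_i F i = F 0 + F 1.
Proof.
by rewrite big_ord_recl big_ord1; congr (_ + F _); exact: val_inj.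
Qed.

Lemma eps00 : eps R 0 0 = 0. Proof. by rewrite /eps/= subr0. Qed.
Lemma eps01 : eps R 0 1 = 1. Proof. by rewrite /eps/= subr0. Qed.
Lemma eps10 : eps R 1 0 = - 1. Proof. by rewrite /eps/= sub0r. Qed.
Lemma eps11 : eps R 1 1 = 0. Proof. by rewrite /eps/= subr0. Qed.

Definition J (v : R2) : R2 := \row_i (if i == 0 then - v 0 1 else v 0 0).

Lemma JE0 v : J v 0 0 = - v 0 1. Proof. by rewrite mxE. Qed.
Lemma JE1 v : J v 0 1 = v 0 0. Proof. by rewrite mxE. Qed.

Lemma JJ v : J (J v) = - v.
Proof. by apply: R2_ext; rewrite !mxE. Qed.

Lemma clinear_J : clinear J.
Proof.
have -> : J = fun v => (-1 *: (v 0 1 *: delta_mx 0 0)) + v 0 0 *: delta_mx 0 1.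
  apply/funext => v; apply: R2_ext.
    by rewrite !mxE/= mulr1 mulr0 addr0 mulN1r.
  by rewrite !mxE/= mulr1 !mulr0 add0r.
have h i j : clinear (fun v : R2 => v 0 i *: (delta_mx 0 j : R2)).
  exact: (clinear_comp (@clinear_coord R 1 i) (clinear_scalel (delta_mx 0 j : R2))).
by apply: clinear_add; [apply: clinear_scale|]; exact: h.
Qed.

Lemma J_linear a u v : J (a *: u + v) = a *: J u + J v.
Proof. exact: clinear_J.1. Qed.

Lemma JZ a u : J (a *: u) = a *: J u.
Proof. by apply: R2_ext; rewrite !mxE//= mulrN. Qed.

Lemma JD u v : J (u + v) = J u + J v.
Proof. by rewrite -[u]scale1r J_linear !scale1r. Qed.

Lemma J0 : J 0 = 0.
Proof. by apply: R2_ext; rewrite !mxE ?oppr0. Qed.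

Lemma partialE (f : R2 -> R) i x : differentiable f x ->
  partial i f x = 'd f x (delta_mx 0 i).
Proof. by move=> df; rewrite /partial deriveE. Qed.

(** For [f = phi] and v = E this is the integrand of the holonomy, in coordinate-free form. *)
Lemma diff_J (f : R2 -> R) x v : differentiable f x ->
  'd f x (J v) = v 0 0 * partial 1 f x - v 0 1 * partial 0 f x.
Proof.
move=> df; rewrite !partialE// [J v]R2_basis linearD !linearZ/= JE0 JE1.
by rewrite scaleNr addrC scalerN.
Qed.

Lemma near_eq_continuous_at (E F : normedModType R) (f g : E -> F) (x : E) :
  (\forall y \near x, f y = g y) -> {for x, continuous f} -> {for x, continuous g}.
Proof.
move=> fg cf; suff : g @ x --> g x by [].
by rewrite -(nbhs_singleton fg); apply: cvg_trans cf; exact: near_eq_cvg.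
Qed.

Lemma continuous_comb (E F : normedModType R) (k l : E -> R) (v w : F) (x : E) :
  {for x, continuous k} -> {for x, continuous l} ->
  {for x, continuous (fun y => k y *: v + l y *: w)}.
Proof. by move=> ck cl; apply: cvgD; apply: cvgZl. Qed.

Lemma cont01_comp_at (E F : normedModType R) (c : R -> E) (f : E -> F) :
  {within I01, continuous c} -> (forall t : R, I01 t -> {for c t, continuous f}) ->
  {within I01, continuous (f \o c)}.
Proof.
move=> /subspace_continuousP cc cf; apply/subspace_continuousP => t It.
exact: (cvg_comp _ _ (cc t It) (cf t It)).
Qed.

Lemma cont01_pair (E F : normedModType R) (c : R -> E) (d : R -> F) :
  {within I01, continuous c} -> {within I01, continuous d} ->
  {within I01, continuous (fun t => (c t, d t))}.
Proof. by move=> cc cd t; apply: cvg_pair; [exact: cc|exact: cd]. Qed.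

Lemma continuous_diff_app (E F : normedModType R) (A : set E) (f : E -> F) (v x : E) :
  smooth_on A f -> A x -> {for x, continuous (fun z => 'd f z v)}.
Proof.
move=> sf Ax; have cT := smooth_continuous (smooth_tangent sf) (conj Ax I : (A `*` setT) (x, v)).
apply: (@continuous_comp _ _ _ (fun z => (z, v)) (fun p : E * E => 'd f (p.1) p.2) x) => //.
by apply: cvg_pair; [exact: cvg_id|exact: cvg_cst].
Qed.

Section Leaves.
Variables (U : set R2) (phi : R2 -> R).
Hypotheses (openU : open U) (sphi : smooth_on U phi).

Definition ham_dir (f : R2 -> R) (z : R2) : R2 :=
  partial 1 f z *: delta_mx 0 0 + (- partial 0 f z) *: delta_mx 0 1.

Lemma ham_fieldE f z : ham_field phi f z = phi z *: ham_dir f z.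
Proof.
apply: R2_ext; rewrite !mxE sum_ord2 /bivector ?eps00 ?eps01 ?eps10 ?eps11/=.
  by rewrite !mul0r add0r !mulr1 mulr0 addr0 mul1r.
by rewrite !mul0r !addr0 mulr1 mulr0 add0r mulN1r mulNr mulrN.
Qed.

Lemma continuous_ham_dir f z : smooth_on U f -> U z -> {for z, continuous (ham_dir f)}.
Proof.
move=> sf Uz.
have cp i : {for z, continuous (partial i f)}.
  apply: (near_eq_continuous_at _ (continuous_diff_app (v := delta_mx 0 i) sf Uz)).
  near=> y; have Uy : U y by near: y; exact: open_nbhs_nbhs.
  by rewrite partialE//; exact: (smooth_differentiable sf).
by apply: continuous_comb; [exact: cp|apply: continuousN; exact: cp].
Unshelve. all: by end_near. Qed.

(** The Hamiltonian field carries the factor phi, so phi along a trajectory solves a linear equation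
    g' = a g and cannot reach 0. *)
Lemma ham_step_sign x y : ham_step U phi x y -> phi x != 0 ->
  U y /\ 0 < phi x * phi y.
Proof.
move=> [f [c [sf c0 c1 cP]]] phix.
pose g := phi \o c; pose a t := 'd phi (c t) (ham_dir f (c t)).
have dg (t : R) : I01 t -> is_derive t 1 g (a t * g t).
  move=> /cP[Uct dc]; have := is_derive_comp_diff dc (smooth_differentiable sphi Uct).
  by rewrite ham_fieldE linearZ/= mulrC.
have cc : {within I01, continuous c}.
  apply: derivable_within_continuous => t It; have [_ dc] := cP t It.
  by have [] := dc.
have ca : {within I01, continuous a}.
  have chd : {within I01, continuous (ham_dir f \o c)}.
    by apply: (cont01_comp_at cc) => t It; apply: continuous_ham_dir => //; have [] := cP t It.
  apply: (cont01_comp_at (f := fun p : R2 * R2 => 'd phi (p.1) p.2) (cont01_pair cc chd)).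
  move=> t It; apply: (smooth_continuous (smooth_tangent sphi)).
  by split=> //; have [] := cP t It.
have cg : {within I01, continuous g}.
  apply: derivable_within_continuous => t It.
  by have [] := dg t It.
have g0 : forall t : R, I01 t -> g t != 0.
  by apply: linear_ode_neq0 ca _ => //; rewrite /g /= c0.
have := cont01_sign cg g0 (I01_1 R).
rewrite /g/= c0 c1 => gpos; split=> //.
by rewrite -c1; have [] := cP 1 (I01_1 R).
Qed.

Lemma leaf_sign x y : U x -> phi x != 0 -> leaf U phi x y ->
  U y /\ 0 < phi x * phi y.
Proof.
move=> Ux phix xy; move: Ux phix; rewrite /leaf/= in xy.
elim: xy => {x y} [x y xy Ux|x Ux phix|x y z _ IHxy _ IHyz Ux phix].
- exact: ham_step_sign.
- by split=> //; rewrite -expr2 exprn_even_gt0.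
- have [Uy xy] := IHxy Ux phix.
  have phiy : phi y != 0 by apply: contraTneq xy => ->; rewrite mulr0 ltxx.
  have [Uz yz] := IHyz Uy phiy; split=> //.
  have y2 : 0 < phi y ^+ 2 by rewrite exprn_even_gt0.
  rewrite -(pmulr_rgt0 _ y2).
  have -> : phi y ^+ 2 * (phi x * phi z) = (phi x * phi y) * (phi y * phi z) by ring.
  exact: mulr_gt0.
Qed.

(* The Hamiltonian is linear, with flow lines along [w]; the speed [phi] along the segment is
   accounted for by [separable_ode]. *)
Lemma ham_step_segment x y :
  (forall s : R, I01 s -> U (x + s *: (y - x)) /\ phi (x + s *: (y - x)) != 0) ->
  ham_step U phi x y.
Proof.
move=> seg; set w := y - x in seg.
(* Affine from [1/3, 2/3] onto [0, 1] and clamped outside, so that the speed is defined and nonzero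
   on the whole interval required by [separable_ode]. *)
pose k (u : R) := Num.max 0 (Num.min (u * 3 - 1) 1).
have kI u : I01 (k u).
  by apply/I01P; rewrite /k le_max lexx/= ge_max ler01 ge_min lexx orbT.
have ck : continuous k.
  move=> u; apply: (@continuous_max _ _ (cst 0) (fun u : R => Num.min (u * 3 - 1) 1)).
    exact: cvg_cst.
  apply: (@continuous_min _ _ (fun u : R => u * 3 - 1) (cst 1)); last exact: cvg_cst.
  by apply: cvgB; [apply: cvgMl; exact: cvg_id|exact: cvg_cst].
pose psi := C0of (fun u : R => (phi (x + k u *: w))^-1).
have psiE (u : R) : I01 u -> psi u = (phi (x + k u *: w))^-1.
  move=> Iu; rewrite /psi C0ofE//; apply: continuous_subspaceT => v.
  have [Uv phiv] := seg _ (kI v).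
  apply: cvgV => //.
  apply: (@continuous_comp _ _ _ (fun v => x + k v *: w) phi).
    by apply: cvgD; [exact: cvg_cst|apply: cvgZl; exact: ck].
  exact: smooth_continuous sphi _ Uv.
have psi0 (u : R) : I01 u -> psi u != 0.
  by move=> Iu; rewrite psiE// invr_eq0; have [] := seg _ (kI u).
have [a [s [s0 s1 sP]]] := separable_ode psi0.
pose c t := x + (s t * 3 - 1) *: w.
(* The factor 3 comes from the rescaling s -> 3 s - 1 and [a] from the separable equation; the field
   of [f] is then 3 a phi w, the velocity of [c]. *)
pose f (z : R2) := (3 * a) * (w 0 0 * z 0 1 - w 0 1 * z 0 0).
have cf : clinear f.
  have -> : f = fun z => (3 * a) *: (w 0 0 *: z 0 1 + (- w 0 1) *: z 0 0).
    by apply/funext => z; rewrite /f /GRing.scale/= mulNr.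
  by apply/clinear_scale/clinear_add; apply/clinear_scale; exact: clinear_coord.
exists f, c; split.
- exact: smooth_lin.
- by rewrite /c s0 (_ : 1 / 3 * 3 - 1 = 0); [rewrite scale0r addr0|field].
- rewrite /c s1 (_ : 2 / 3 * 3 - 1 = 1); [by rewrite scale1r /w addrC subrK|by field].
move=> t It; have [/andP[st1 st2] dst] := sP t It.
have kst : k (s t) = s t * 3 - 1 by rewrite /k min_l ?max_r//; lra.
have Ist : I01 (s t) by apply/I01P; lra.
have [Uct _] := seg _ (kI (s t)); rewrite kst in Uct.
split; first exact: Uct.
have dk : is_derive t 1 (fun t => s t * 3 - 1) (3 * (a / psi (s t))).
  have := is_deriveB (is_deriveZ 3 dst) (is_derive_cst (1 : R) t 1).
  rewrite subr0; congr (is_derive _ _ _ _); apply/funext => v.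
  by transitivity (3 * s v - 1) => //; ring.
have := is_deriveD (is_derive_cst x t 1) (is_derive_clinear (clinear_scalel w) dk).
rewrite add0r (_ : _ + _ = c); last by apply/funext.
move/is_derive_eq; apply.
rewrite psiE// kst invrK ham_fieldE /ham_dir !partialE; [|exact: (clinear_diff _ cf).1..].
rewrite (clinear_diff _ cf).2 /f; apply: R2_ext; rewrite !mxE/=; ring.
Qed.

End Leaves.
End Plane.

(** * The set [h_pos] near zeros of phi *)

Section Groupoid.
Variable R : realType.
Local Notation R2 := 'rV[R]_2.

Lemma ball_segment (E : normedModType R) (z x y : E) (r s : R) :
  ball z r x -> ball z r y -> I01 s -> ball z r (x + s *: (y - x)).
Proof.
rewrite -!ball_normE/= => zx zy; rewrite in_itv/= => /andP[s0 s1].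
have -> : z - (x + s *: (y - x)) = (1 - s) *: (z - x) + s *: (z - y).
  rewrite !scalerBr !scalerBl !scale1r opprB.
  rewrite [RHS]addrA [X in _ = X - _]addrAC subrK.
  by rewrite opprD opprB [- x + _]addrA [- x + _]addrC addrA.
have s0' : 0 <= 1 - s by rewrite subr_ge0.
rewrite (le_lt_trans (ler_normD _ _))// !normrZ !ger0_norm//.
have -> : r = (1 - s) * r + s * r by ring.
have [->|sn0] := eqVneq s 0; first by rewrite subr0 !mul1r !mul0r !addr0.
by apply: ler_ltD; [rewrite ler_wpM2l// ltW|rewrite ltr_pM2l// lt_neqAle eq_sym sn0].
Qed.

Lemma add1_mul_gt0 (t b : R) : 0 <= t <= 1 -> -1 < b -> 0 < 1 + t * b.
Proof.
case/andP=> t0 t1 b1; have [->|tn0] := eqVneq t 0; first by rewrite mul0r addr0.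
have tb : 0 < t * (1 + b).
  by apply: mulr_gt0; [rewrite lt_neqAle eq_sym tn0|lra].
by move: tb; rewrite mulrDr mulr1 => tb; lra.
Qed.

Lemma path_component (T : topologicalType) (A : set T) (c : R -> T) :
  {within I01, continuous c} -> (forall t : R, I01 t -> A (c t)) ->
  forall t : R, I01 t -> connected_component A (c 0) (c t).
Proof.
move=> cc cA t It; exists (c @` I01); last by exists t.
split; first by exists 0 => //; exact: I01_0.
  by move=> _ [s Is <-]; exact: cA.
apply: connected_continuous_connected cc.
by apply/connected_intervalP; exact: interval_is_interval.
Qed.

Lemma open_component (E : normedModType R) (A : set E) (x : E) :
  open A -> open (connected_component A x).
Proof.
move=> oA; rewrite openE => y xy.
have Ay : A y := connected_component_sub xy.
have [r r0 rA] := (nbhs_ballP _ _).1 (open_nbhs_nbhs (conj oA Ay)).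
apply/nbhs_ballP; exists r => // z yz; apply: connected_component_trans xy _.
have -> : z = y + 1 *: (z - y) by rewrite scale1r addrC subrK.
rewrite -{1}[y]addr0 -(scale0r (z - y)).
apply: (path_component (c := fun t => y + t *: (z - y))); last exact: I01_1.
  by apply: continuous_subspaceT; exact: continuous_line.
by move=> t It; apply: rA; apply: ball_segment => //; exact: ballxx.
Qed.

Variables (U : set R2) (phi : R2 -> R).
Hypotheses (openU : open U) (sphi : smooth_on U phi).

Lemma open_phi_neq0 : open (U `&` [set x | phi x != 0]).
Proof.
rewrite (_ : [set x | _] = phi @^-1` [set r | r != 0])//.
by apply: open_smooth_preimage => //; exact: open_neq.
Qed.

Lemma ham_step_near x : U x -> phi x != 0 -> \forall y \near x & z \near x,
  ham_step U phi y z.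
Proof.
move=> Ux phix.
have [r r0 rA] := (nbhs_ballP _ _).1 (open_nbhs_nbhs (conj open_phi_neq0 (conj Ux phix))).
exists (ball x r, ball x r); first by split; exact: nbhsx_ballx.
move=> [y z] [/= xy xz]; apply: ham_step_segment => // s Is.
exact: (rA _ (ball_segment xy xz Is)).
Qed.

(** Off the zeros of phi, points of a small ball are joined by Hamiltonian segments, so membership
    in the leaf of [x] is locally constant. *)
Lemma leaf_connected (A : set R2) x : connected A -> A x ->
  (forall y, A y -> U y /\ phi y != 0) -> A `<=` leaf U phi x.
Proof.
move=> cA Ax AU; apply: (connected_locally_const cA Ax); first exact: rt_refl.
move=> y Ay; have [Uy phiy] := AU y Ay.
have [[N1 N2] /= [n1 n2] N12] := ham_step_near Uy phiy.
have N1y := nbhs_singleton n1; have N2y := nbhs_singleton n2.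
apply: filterS2 n1 n2 => z N1z N2z _; split=> xz.
  apply: rt_trans xz _; apply: rt_step; exact: (N12 (z, y)).
apply: rt_trans xz _; apply: rt_step; exact: (N12 (y, z)).
Qed.

Lemma x_fE p : x_f phi p = p.1 + phi p.1 *: J p.2.
Proof.
apply: R2_ext; rewrite !mxE sum_ord2 ?eps00 ?eps01 ?eps10 ?eps11/=.
  by rewrite mul0r add0r mul1r mulrN.
by rewrite mul0r addr0 mulN1r mulrN opprK.
Qed.

Lemma hE0 p : U p.1 -> phi p.1 = 0 -> h phi p = 1 + 'd phi (p.1) (J p.2).
Proof.
move=> Up p0; rewrite /h p0 eqxx (diff_J _ (smooth_differentiable sphi Up)) /comp1 /comp2.
by rewrite addrAC addrA.
Qed.

Lemma hE p : phi p.1 != 0 -> h phi p = phi (x_f phi p) / phi p.1.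
Proof. by move=> p0; rewrite /h (negbTE p0). Qed.

Lemma smooth_x_f : smooth_on (U `*` setT) (x_f phi).
Proof.
have oUT := openXT (F := R2) openU.
have -> : x_f phi = fun p => p.1 + phi p.1 *: J p.2 by apply/funext => p; rewrite x_fE.
move=> k; apply: Ck_add => //; first exact/Ck_lin/clinear_fst.
apply: Ck_scale => //; last first.
  by apply: Ck_lin; exact: (clinear_comp (clinear_snd R2 R2) (@clinear_J R)).
apply: (Ck_comp _ _ (Ck_lin _ _ (clinear_fst R2 R2)) (sphi k)) => //.
by move=> p [].
Qed.

(** Both the integrand of the holonomy and the linear part of [h] at a zero of phi. *)
Definition dphiJ (q : R2 * R2) : R := 'd phi (q.1) (J q.2).

Lemma smooth_dphiJ : smooth_on (U `*` setT) dphiJ.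
Proof.
apply: (smooth_comp (f := fun q : R2 * R2 => (q.1, J q.2)) _ _ _ (smooth_tangent sphi)).
- exact: openXT.
- by move=> q [].
- apply/smooth_lin/clinear_pair; first exact: clinear_fst.
  exact: (clinear_comp (clinear_snd R2 R2) (@clinear_J R)).
Qed.

Lemma dphiJ_scale x (a : R) w : dphiJ (x, a *: w) = a * dphiJ (x, w).
Proof. by rewrite /dphiJ/= JZ linearZ. Qed.

(* If [phi x = 0] there need be no trajectory from [x] to [x_f]; instead the segment
   [{x} `*` [0, 1] w] stays in [h_pos], also for nearby (x, w). *)
Lemma h_pos_segment0 (x0 pi0 : R2) : h_pos U phi (x0, pi0) -> phi x0 = 0 ->
  \forall p \near (x0, pi0), forall t : R, I01 t -> h_pos U phi (p.1, t *: p.2).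
Proof.
move=> [/= Ux0 _ hp] phi0; rewrite hE0//= in hp.
pose D := dphiJ; have sD : smooth_on (U `*` setT) D by exact: smooth_dphiJ.
(* At a zero, h > 0 means D > -1. A product of balls is needed, since D will be evaluated at
   intermediate points of the segment from x to x_f, with the same w. *)
have oP : open ((U `*` setT) `&` D @^-1` [set r | -1 < r]).
  by apply: open_smooth_preimage => //; exact: openXT.
have P0 : ((U `*` setT) `&` D @^-1` [set r | -1 < r]) (x0, pi0).
  by split=> //; rewrite /= /D /dphiJ/= -subr_gt0 opprK addrC.
have [d /= d0 dP] := (nbhs_ballP _ _).1 (open_nbhs_nbhs (conj oP P0)).
have {dP}dP z w : ball x0 d z -> ball pi0 d w -> U z /\ -1 < D (z, w).
  by move=> zd wd; have [[]] := dP (z, w) (conj zd wd).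
have oQ : open ((U `*` setT) `&` x_f phi @^-1` ball x0 d).
  by apply: open_smooth_preimage; [exact: openXT|exact: smooth_x_f|exact: ball_open].
have Q0 : ((U `*` setT) `&` x_f phi @^-1` ball x0 d) (x0, pi0).
  by split=> //=; rewrite x_fE/= phi0 scale0r addr0; exact: ballxx.
have N1 : \forall p \near (x0, pi0), ball (x0, pi0) d p by exact: nbhsx_ballx.
apply: filterS2 N1 (open_nbhs_nbhs (conj oQ Q0)) => -[x w] /= [/= xd wd] [_ xfd] t It.
have [Ux _] := dP _ _ xd wd.
have seg (s : R) : I01 s -> ball x0 d (x + s *: (phi x *: J w)).
  move=> Is; rewrite x_fE/= in xfd.
  by have := ball_segment xd xfd Is; rewrite [x + _ - x]addrC addKr.
have t01 : 0 <= t <= 1 by move: It; rewrite /= in_itv.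
have tpos (b : R) : -1 < b -> 0 < 1 + t * b by exact: add1_mul_gt0.
have xfE : x_f phi (x, t *: w) = x + t *: (phi x *: J w).
  by rewrite x_fE/= JZ !scalerA mulrC.
split=> //=; rewrite ?xfE; first by have [] := dP _ _ (seg t It) wd.
have [px|px] := eqVneq (phi x) 0.
  rewrite hE0//= JZ linearZ/=; apply: tpos.
  by have [_] := dP _ _ xd wd.
rewrite hE//= xfE.
(* The increment contains the factor phi(x), so h(x, t w) = 1 + t dphi_z(J w) with z on the segment:
   the quotient formula is tied to the one at zeros. *)
have [s s01 sE] : exists2 s : R, 0 <= s <= 1 & phi (x + t *: (phi x *: J w)) - phi x
    = 'd phi (x + s *: (t *: (phi x *: J w))) (t *: (phi x *: J w)).
  apply: mvt_line => s /andP[s0 s1]; apply: (smooth_differentiable sphi).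
  have -> : s *: (t *: (phi x *: J w)) = (s * t) *: (phi x *: J w) by rewrite scalerA.
  have Ist : I01 (s * t).
    by case/andP: t01 => t0 t1; apply/I01P; rewrite mulr_ge0//= mulr_ile1.
  by have [] := dP _ _ (seg _ Ist) wd.
rewrite -[phi (x + t *: _)](subrK (phi x)) sE mulrDl divff// addrC.
have -> : s *: (t *: (phi x *: J w)) = (s * t) *: (phi x *: J w) by rewrite scalerA.
have Ist : I01 (s * t).
  by case/andP: t01 => t0 t1; case/andP: s01 => s0 s1; apply/I01P; rewrite mulr_ge0//= mulr_ile1.
have [_ Db] := dP _ _ (seg _ Ist) wd.
move: Db; rewrite /D /dphiJ/=; set z := x + (s * t) *: _ => Db.
move: z Db {sE} => z Db; rewrite !linearZ/=.
have -> : t *: (phi x *: 'd phi z (J w)) / phi x = t * 'd phi z (J w).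
  by rewrite /GRing.scale/=; move: ('d phi z (J w)) => b; clear - px; field.
exact: tpos Db.
Qed.

End Groupoid.

Lemma continuous_clinear_addc (R : realType) (E F : normedModType R) (l : E -> F) (c : F) :
  clinear l -> continuous (fun x => l x + c).
Proof. by move=> [_ cl] x; apply: cvgD; [exact: cl|exact: cvg_cst]. Qed.

(** * Fibres of the groupoid and leaves *)

Section GroupoidFibres.
Variable R : realType.
Local Notation R2 := 'rV[R]_2.
Variables (U : set R2) (phi : R2 -> R).
Hypotheses (openU : open U) (sphi : smooth_on U phi).

(** Off the zeros of phi, h > 0 says that phi has the same sign at x and x_f; as a positive product
    this is visibly open. *)
Lemma open_xf_phi :
  open ((U `*` setT) `&` (x_f phi @^-1` U)
        `&` (fun p : R2 * R2 => phi (x_f phi p) * phi p.1) @^-1` [set r | 0 < r]).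
Proof.
have oUT := openXT (F := R2) openU.
have oV := open_smooth_preimage oUT (smooth_x_f openU sphi) openU.
apply: open_smooth_preimage => //.
have sx : smooth_on ((U `*` setT) `&` (x_f phi @^-1` U)) (fun p => phi (x_f phi p)).
  apply: (smooth_comp (f := x_f phi) oV _ _ sphi); first by move=> p [].
  by apply: smooth_sub (smooth_x_f openU sphi); exact: subIsetl.
have s1 : smooth_on ((U `*` setT) `&` (x_f phi @^-1` U)) (fun p : R2 * R2 => phi p.1).
  apply: (smooth_comp (f := fst) oV _ _ sphi); first by move=> p [[]].
  exact/smooth_lin/clinear_fst.
by move=> k; apply: (Ck_scale oV (sx k) (s1 k)).
Qed.

Lemma h_pos_neq0 p : phi p.1 != 0 ->
  h_pos U phi p <-> [/\ U p.1, U (x_f phi p) & 0 < phi (x_f phi p) * phi p.1].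
Proof.
move=> p0; have d0 : 0 < (phi p.1)^-1 ^+ 2 by rewrite exprn_even_gt0//= invr_eq0.
have e : h phi p = (phi p.1)^-1 ^+ 2 * (phi (x_f phi p) * phi p.1).
  by rewrite hE//; field.
by split=> -[Up Ux hp]; split=> //; move: hp; rewrite e (pmulr_rgt0 _ d0).
Qed.

(** [h] is defined by cases, so openness at a zero of phi is not continuity of one formula; it is
    the case t = 1 of [h_pos_segment0]. *)
Lemma open_h_pos : open (h_pos U phi).
Proof.
rewrite openE => -[x w] hp; have [/= Ux Uxf hp0] := hp; rewrite /interior.
have [px|px] := eqVneq (phi x) 0.
  have := h_pos_segment0 openU sphi hp px.
  apply: filterS => -[y v] /(_ 1 (I01_1 R))/=.
  by rewrite scale1r.
have Op := open_xf_phi.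
have hin : ((U `*` setT) `&` (x_f phi @^-1` U)
        `&` (fun p : R2 * R2 => phi (x_f phi p) * phi p.1) @^-1` [set r | 0 < r]) (x, w).
  by have [? ? ?] := (h_pos_neq0 (p := (x, w)) px).1 hp.
apply: filterS (open_nbhs_nbhs (conj Op hin)) => p [[[Up _] Uxp]] /= pos.
apply/h_pos_neq0; last by split.
by apply: contraTneq pos => ->; rewrite mulr0 ltxx.
Qed.

(* This property is open and closed in [h_pos]. *)
Definition same_leaf (p : R2 * R2) : Prop := phi p.1 = 0 \/ leaf U phi p.1 (x_f phi p).

Lemma h_pos0 x : U x -> h_pos U phi (x, 0).
Proof.
move=> Ux; have xf : x_f phi (x, 0) = x by rewrite x_fE/= J0 scaler0 addr0.
split=> //=; rewrite ?xf//.
have [px|px] := eqVneq (phi x) 0.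
  by rewrite (hE0 sphi (p := (x, 0)) Ux px)/= J0 linear0 addr0.
by rewrite hE//= xf divff.
Qed.

(** While t runs over [0, 1], x_f(x, t w) runs along the straight segment from x to x_f(x, w), which
    is a Hamiltonian arc if phi does not vanish on it. *)
Lemma h_pos_same_leaf (x w : R2) :
  (forall t : R, I01 t -> h_pos U phi (x, t *: w)) -> same_leaf (x, w).
Proof.
move=> H; have [px|px] := eqVneq (phi x) 0; [by left|right].
apply: rt_step; apply: ham_step_segment => // s Is.
have -> : x + s *: (x_f phi (x, w) - x) = x_f phi (x, s *: w).
  rewrite !x_fE/= JZ [x + _ - x]addrC addKr; congr (_ + _).
  by rewrite !scalerA mulrC.
have [_ Ux pos] := (h_pos_neq0 (p := (x, s *: w)) px).1 (H s Is).
by split=> //; apply: contraTneq pos => ->; rewrite mul0r ltxx.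
Qed.

Lemma groupoid_same_leaf p : groupoid U phi p -> h_pos U phi p /\ same_leaf p.
Proof.
move=> [z Uz zp]; split; first exact: connected_component_sub zp.
apply: (connected_locally_const (@component_connected _ (h_pos U phi) (z, 0)) _ _ _ zp).
- by apply: connected_component_refl; exact: h_pos0.
- by right; rewrite x_fE/= J0 scaler0 addr0; exact: rt_refl.
move=> [x w] /connected_component_sub hp.
(* Around a zero every nearby point has the property: either phi vanishes there too, or its whole
   segment of multiples t v lies in [h_pos]. Elsewhere both x and x_f move by small Hamiltonian
   arcs. *)
have [px|px] := eqVneq (phi x) 0.
  have := h_pos_segment0 openU sphi hp px; apply: filterS => -[y v] /= Hyv _.
  by split=> _; [left|exact: h_pos_same_leaf].
have [/= Ux Uxf pos] := (h_pos_neq0 (p := (x, w)) px).1 hp.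
have pxf : phi (x_f phi (x, w)) != 0 by apply: contraTneq pos => ->; rewrite mul0r ltxx.
have [[M1 M2] /= [m1 m2] M12] := ham_step_near openU sphi Ux px.
have [[N1 N2] /= [n1 n2] N12] := ham_step_near openU sphi Uxf pxf.
have cxf : {for (x, w), continuous (x_f phi)}.
  exact: (smooth_continuous (smooth_x_f openU sphi)).
have cfst : {for (x, w), continuous (@fst R2 R2)} by exact: cvg_fst.
have nn : \forall p \near (x, w), [/\ (M1 `&` M2) p.1, (N1 `&` N2) (x_f phi p) & phi p.1 != 0].
  have a1 : \forall p \near (x, w), (M1 `&` M2) p.1 by exact: cfst _ (filterI m1 m2).
  have a2 : \forall p \near (x, w), (N1 `&` N2) (x_f phi p) by exact: cxf _ (filterI n1 n2).
  have a3 : \forall p \near (x, w), (U `&` [set x | phi x != 0]) p.1.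
    exact: cfst _ (open_nbhs_nbhs (conj (open_phi_neq0 openU sphi) (conj Ux px))).
  by apply: filterS3 a1 a2 a3 => q ? ? [].
have [Mx Nx _] := nbhs_singleton nn.
apply: filterS nn => q [[M1p M2p] [N1p N2p] pp] _.
have e1 : ham_step U phi q.1 x by apply: (M12 (q.1, x)); split=> //; case: Mx.
have e2 : ham_step U phi x q.1 by apply: (M12 (x, q.1)); split=> //; case: Mx.
have e3 : ham_step U phi (x_f phi q) (x_f phi (x, w)).
  by apply: (N12 (x_f phi q, x_f phi (x, w))); split=> //; case: Nx.
have e4 : ham_step U phi (x_f phi (x, w)) (x_f phi q).
  by apply: (N12 (x_f phi (x, w), x_f phi q)); split=> //; case: Nx.
split=> -[p0|pl]; first by rewrite p0 eqxx in pp.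
- right; apply: rt_trans (rt_step _ _ _ _ e2) _; apply: rt_trans pl _; exact: rt_step.
- by move: px; rewrite /= in p0; rewrite p0 eqxx.
- right; apply: rt_trans (rt_step _ _ _ _ e1) _; apply: rt_trans pl _; exact: rt_step.
Qed.

Lemma open_groupoid : open (groupoid U phi).
Proof. by apply: bigcup_open => x _; apply: open_component; exact: open_h_pos. Qed.

Lemma curve_groupoid x (c : R -> R2) : U x -> {within I01, continuous c} -> c 0 = 0 ->
  (forall t : R, I01 t -> h_pos U phi (x, c t)) -> groupoid U phi (x, c 1).
Proof.
move=> Ux cc c0 cP; exists x => //.
have := @path_component R _ (h_pos U phi) (fun t => (x, c t)) _ cP 1 (I01_1 R).
rewrite c0; apply.
by apply: cont01_pair cc; move=> t; exact: cvg_cst.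
Qed.

Lemma curve_leaf x (c : R -> R2) : phi x != 0 -> {within I01, continuous c} -> c 0 = 0 ->
  (forall t : R, I01 t -> h_pos U phi (x, c t)) ->
  forall t : R, I01 t -> leaf U phi x (x_f phi (x, c t)).
Proof.
move=> px cc c0 cP t It.
have cx : {within I01, continuous (x_f phi \o (fun t => (x, c t)))}.
  apply: cont01_comp_at; first by apply: cont01_pair cc; move=> s; exact: cvg_cst.
  by move=> s Is; apply: (smooth_continuous (smooth_x_f openU sphi)); have [] := cP s Is.
have xc0 : x_f phi (x, c 0) = x by rewrite c0 x_fE/= J0 scaler0 addr0.
have cA : connected ((x_f phi \o (fun t => (x, c t))) @` I01).
  apply: connected_continuous_connected cx.
  by apply/connected_intervalP; exact: interval_is_interval.
apply: (leaf_connected openU sphi cA); last by exists t.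
  by exists 0 => //; exact: I01_0.
move=> _ [s Is <-] /=.
have [_ Uxf pos] := (h_pos_neq0 (p := (x, c s)) px).1 (cP s Is).
by split=> //; apply: contraTneq pos => ->; rewrite mul0r ltxx.
Qed.

(** The inverse of w -> x_f(x, w) for phi(x) <> 0, as J^-1 = - J. *)
Definition unx (x y : R2) : R2 := (- (phi x)^-1) *: J (y - x).

Lemma x_f_unx x y : phi x != 0 -> x_f phi (x, unx x y) = y.
Proof.
move=> px; rewrite x_fE/= /unx JZ JJ scalerA mulrN divff// scaleN1r opprK.
by rewrite addrC subrK.
Qed.

Lemma unx_x_f x w : phi x != 0 -> unx x (x_f phi (x, w)) = w.
Proof.
move=> px; rewrite x_fE/= /unx [x + _ - x]addrC addKr JZ JJ scalerA mulNr mulVf//.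
by rewrite scaleN1r opprK.
Qed.

Lemma unx_h_pos x y : U x -> phi x != 0 -> leaf U phi x y -> h_pos U phi (x, unx x y).
Proof.
move=> Ux px xy; have [Uy pos] := leaf_sign openU sphi Ux px xy.
by apply/h_pos_neq0 => //; rewrite x_f_unx//; split=> //; rewrite mulrC.
Qed.

Lemma continuous_unx x : continuous (unx x).
Proof.
have -> : unx x = fun y => (- (phi x)^-1) *: J y + (- (phi x)^-1) *: J (- x).
  by apply/funext => y; rewrite /unx JD scalerDr.
exact/continuous_clinear_addc/clinear_scale/clinear_J.
Qed.

(* At a zero of [phi] the fibre of [h_pos] is a half plane. *)
Lemma h_pos_convex0 x v w (t : R) : phi x = 0 -> h_pos U phi (x, v) -> h_pos U phi (x, w) ->
  I01 t -> h_pos U phi (x, v + t *: (w - v)).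
Proof.
move=> px [/= Ux _ hv] [_ _ hw]; rewrite /= in_itv/= => /andP[t0 t1].
have xf u : x_f phi (x, u) = x by rewrite x_fE/= px scale0r addr0.
split; rewrite ?xf//=.
move: hv hw; rewrite !(hE0 sphi (p := (x, _)) Ux px)/= JD JZ JD -[- v]scaleN1r JZ.
rewrite linearD linearZ/= linearD linearZ/=.
move: ('d phi x (J v)) ('d phi x (J w)) => a b.
rewrite /GRing.scale/= => h1 h2; clear - t0 t1 h1 h2.
have [->|tn0] := eqVneq t 0; first by rewrite mul0r addr0.
have h3 : 0 < t * (1 + b) by apply: mulr_gt0 => //; rewrite lt_neqAle eq_sym tn0.
have h4 : 0 <= (1 - t) * (1 + a) by apply: mulr_ge0; lra.
have -> : 1 + (a + t * (b + -1 * a)) = (1 - t) * (1 + a) + t * (1 + b) by ring.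
lra.
Qed.

End GroupoidFibres.

(** * Chains of segments between homotopic curves *)

Section Density.
Variable R : realType.
Local Notation R2 := 'rV[R]_2.

(** The bound d < 1 lets a window of length d slide inside [0, 1]. *)
Lemma C0_uniform (V : normedModType R) (f : C0 V) (e : R) : 0 < e ->
  exists2 d : R, 0 < d < 1 & forall u v : R, I01 u -> I01 v -> `|u - v| <= d -> `|f u - f v| <= e.
Proof.
move=> e0.
pose P n (u : R) := I01 u -> forall v : R, I01 v -> `|u - v| < n.+1%:R^-1 -> `|f u - f v| <= e.
have [||n nP] := @near_I01 R P.
- move=> n m u nm Pn Iu v Iv uv; apply: Pn => //; apply: lt_le_trans uv _.
  by rewrite lef_pV2 ?posrE// ler_nat ltnS.
- move=> u Iu; have e2 : 0 < e / 2 by rewrite divr_gt0.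
  have [n nP] := ball_natP ((cont01P f).1 (@C0_continuous _ _ f) u Iu _ e2).
  exists (n.+1 + n.+1)%N; pose d : R := (n.+1 + n.+1).+1%:R^-1.
  have d0 : 0 < d by rewrite invr_gt0.
  have d2 : d + d <= n.+1%:R^-1 by exact: invn_double.
  apply: filterS (near_dist u d0) => v uv Iv w Iw vw.
  rewrite [e]splitr (le_trans (ler_distD (f u) _ _))// lerD//.
    rewrite distrC; apply: nP => //; rewrite -ball_normE/= (lt_le_trans uv)//.
    by rewrite (le_trans _ d2)// lerDl ltW.
  apply: nP => //; rewrite -ball_normE/= (le_lt_trans (ler_distD v _ _))//.
  by rewrite (lt_le_trans _ d2)// ltrD.
- exists n.+2%:R^-1.
    by rewrite invr_gt0 ltr0n/= invf_lt1 ?ltr0n// ltr1n.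
  move=> u v Iu Iv uv; apply: nP => //; apply: le_lt_trans uv _.
  by rewrite ltf_pV2 ?posrE// ltr_nat.
Qed.

(* Steklov averages [u |-> (1/d) int_{(1-d)u}^{(1-d)u+d} f] are C^1 and close to [f]. *)
Lemma C1_dense_scalar (f : C0 R) (e : R) : 0 < e ->
  exists Q : C1 R, [/\ Q 0 = f 0, Q 1 = f 1 & forall u : R, I01 u -> `|Q u - f u| <= e].
Proof.
move=> e0; have e2 : 0 < e / 2 by rewrite divr_gt0.
have [d /andP[d0 d1] dP] := C0_uniform f e2.
pose F := prim f.
have dF (u : R) : `]0, 1[%classic u -> is_derive u 1 (F : R -> R) (f u).
  by move=> u01; have := C1_is_derive F u01; rewrite prim_deriv.
have cF : {within I01, continuous F} by exact: (@C1_continuous _ _ F).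
(* The window [a(u), b(u)] has length d, stays in [0, 1] and contains u, so [f] need not be
   continued beyond the end points. *)
pose a (u : R) := 0 + u * (1 - d). pose b (u : R) := d + u * (1 - d).
have aI (u : R) : I01 u -> I01 (a u).
  by rewrite /= !in_itv/= /a => /andP[u0 u1]; rewrite add0r; apply/andP; split; nra.
have bI (u : R) : I01 u -> I01 (b u).
  by rewrite /= !in_itv/= /b => /andP[u0 u1]; apply/andP; split; nra.
have ca (x : R) : continuous (fun u : R => x + u * (1 - d)) by exact: (@continuous_line R R x (1 - d)).
pose g (u : R) := d^-1 *: (F (b u) - F (a u)).
have cg : {within I01, continuous g}.
  move=> u; apply: cvgZr; apply: cvgB; apply: (cont01_comp cF) => //; exact: ca.
pose g' := C0of (fun u : R => (d^-1 * (1 - d)) *: (f (b u) - f (a u))).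
have g'E (u : R) : I01 u -> g' u = (d^-1 * (1 - d)) *: (f (b u) - f (a u)).
  move=> Iu; rewrite /g' C0ofE//.
  move=> v; apply: cvgZr; apply: cvgB; apply: (cont01_comp (@C0_continuous _ _ f)) => //; exact: ca.
have dg (u : R) : `]0, 1[%classic u -> is_derive u 1 g (g' u).
  move=> u01; have Iu := I01_oo u01; rewrite g'E//.
  have ao : `]0, 1[%classic (a u).
    move: u01; rewrite /= !in_itv/= /a add0r => /andP[u0 u1].
    by apply/andP; split; nra.
  have bo : `]0, 1[%classic (b u).
    move: u01; rewrite /= !in_itv/= /b => /andP[u0 u1].
    by apply/andP; split; nra.
  have dd (x : R) : `]0, 1[%classic (x + u * (1 - d)) ->
      is_derive u 1 (F \o (fun u => x + u * (1 - d))) ((1 - d) * f (x + u * (1 - d))).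
    move=> xo; have h1 := is_derive_affine x (1 - d) u.
    have [dFx dFE] := dF _ xo.
    have h2 := is_derive_comp_diff h1 ((derivable1_diffP _ _).1 dFx).
    move: h2; rewrite diff_real; last exact/derivable1_diffP.
    by rewrite dFE.
  have := is_deriveZ d^-1 (is_deriveB (dd d bo) (dd 0 ao)).
  by move/is_derive_eq; apply; rewrite /GRing.scale/= /a /b; ring.
have gf (u : R) : I01 u -> `|g u - f u| <= e / 2.
  move=> Iu.
  have ab : a u < b u by rewrite /a /b ltrD2r.
  have /andP[a0 a1] := (I01P _).1 (aI u Iu); have /andP[b0 b1] := (I01P _).1 (bI u Iu).
  have H1 (w : R) : w \in `]a u, b u[%R -> is_derive w 1 (F : R -> R) (f w).
    rewrite in_itv/= => /andP[uw wv]; apply: dF.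
    by rewrite /= in_itv/= (le_lt_trans a0)//= (lt_le_trans wv).
  have H2 : {within `[a u, b u], continuous (F : R -> R)}.
    apply: continuous_subspaceW cF => w /=; rewrite !in_itv/= => /andP[uw wv].
    by rewrite (le_trans a0)//= (le_trans wv).
  have [w wab wE] := MVT ab H1 H2.
  rewrite /g wE (_ : b u - a u = d); last by rewrite /a /b; ring.
  have -> : d^-1 *: (f w * d) = f w by rewrite /GRing.scale/=; field; rewrite gt_eqF.
  move: wab; rewrite in_itv/= => /andP[aw wb].
  apply: dP => //; first by apply/I01P; rewrite (le_trans a0 (ltW aw))/= (le_trans (ltW wb)).
  have /andP[u0 u1] := (I01P _).1 Iu.
  rewrite ler_distl; move: aw wb; rewrite /a /b => aw wb.
  by apply/andP; split; nra.
(* An affine correction restores the end values; |A| and |B| are at most e/2, the other half of the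
   allowed error. *)
pose A := f 0 - g 0; pose B := f 1 - g 1.
pose Q (u : R) := g u + (A + u * (B - A)).
pose Q' := C0of (fun u : R => g' u + (B - A)).
have Q'E (u : R) : I01 u -> Q' u = g' u + (B - A).
  move=> Iu; rewrite /Q' C0ofE// => v; apply: cvgD; last exact: cvg_cst.
  exact: (@C0_continuous _ _ g').
have cQ : {within I01, continuous Q}.
  have cl : {within I01, continuous (fun u : R => A + u * (B - A))}.
    by apply: continuous_subspaceT; exact: (@continuous_line R R A (B - A)).
  by move=> u; apply: cvgD; [exact: cg|exact: cl].
have dQ (u : R) : `]0, 1[%classic u -> is_derive u 1 Q (Q' u).
  move=> u01; rewrite Q'E; last exact: I01_oo.
  exact: is_deriveD (dg u u01) (is_derive_affine A (B - A) u).
have QE (u : R) : I01 u -> C1of Q Q' u = Q u by exact: C1ofE cQ dQ.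
exists (C1of Q Q'); split.
- by rewrite (QE _ (I01_0 R)) /Q mul0r addr0 /A addrC subrK.
- by rewrite (QE _ (I01_1 R)) /Q mul1r [A + _]addrC subrK /B addrC subrK.
- move=> u Iu; rewrite QE// /Q addrAC [e]splitr (le_trans (ler_normD _ _))// lerD ?gf//.
  have h0 := gf 0 (I01_0 R); have h1 := gf 1 (I01_1 R).
  have /andP[u0 u1] := (I01P _).1 Iu.
  rewrite -/A in h0; have {h0}hA : `|A| <= e / 2 by rewrite distrC.
  have {h1}hB : `|B| <= e / 2 by rewrite distrC.
  have -> : A + u * (B - A) = (1 - u) * A + u * B by ring.
  have u1' : 0 <= 1 - u by rewrite subr_ge0.
  rewrite (le_trans (ler_normD _ _))// !normrM (ger0_norm u0) (ger0_norm u1').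
  have -> : e / 2 = (1 - u) * (e / 2) + u * (e / 2) by ring.
  by rewrite lerD// ler_wpM2l.
Qed.

Lemma C1_dense (f : C0 R2) (r : R) : 0 < r ->
  exists Q : C1 R2, [/\ Q 0 = f 0, Q 1 = f 1 & `|C1val Q - f| < r].
Proof.
move=> r0.
pose del (i : 'I_2) : R2 := delta_mx 0 i.
pose m := `|del 0| + `|del 1| + 1.
have m0 : 0 < m by rewrite ltr_wpDl// addr_ge0.
have e0 : 0 < r / 2 / m by rewrite !divr_gt0.
have cc i : clinear (fun v : R2 => v 0 i) by exact: clinear_coord.
have cd i : clinear (fun c : R => c *: del i) by exact: clinear_scalel.
have [Q0 [Q00 Q01 Q0P]] := C1_dense_scalar (C0map (fun v : R2 => v 0 0) f) e0.
have [Q1 [Q10 Q11 Q1P]] := C1_dense_scalar (C0map (fun v : R2 => v 0 1) f) e0.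
pose Q := C1map (fun c : R => c *: del 0) Q0 + C1map (fun c : R => c *: del 1) Q1.
have QE (u : R) : I01 u -> Q u = Q0 u *: del 0 + Q1 u *: del 1.
  by move=> Iu; rewrite C1D !C1mapE.
have I0 := I01_0 R; have I1 := I01_1 R.
exists Q; split.
- by rewrite QE// Q00 Q10 !C0map_clinE// -R2_basis.
- by rewrite QE// Q01 Q11 !C0map_clinE// -R2_basis.
apply: (@le_lt_trans _ _ (r / 2)); last by rewrite ltr_pdivrMr// ltr_pMr// ltr1n.
rewrite C0_normE; apply: C0_norm_le => u Iu; rewrite C0B C1valE QE//.
rewrite [f u]R2_basis opprD addrACA -!scalerBl.
rewrite (le_trans (ler_normD _ _))// !normrZ.
have h0 := Q0P u Iu; have h1 := Q1P u Iu; rewrite !C0map_clinE// in h0 h1.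
apply: (@le_trans _ _ (r / 2 / m * (`|del 0| + `|del 1|))).
  by rewrite mulrDr lerD// ler_wpM2r.
rewrite -mulrA; apply: ler_piMr; first by rewrite divr_ge0 ?ltW.
by rewrite mulrC ltW// ltr_pdivrMr// mul1r ltrDl.
Qed.

End Density.

(** * From homotopies to chains of segments *)

Section Homotopy.
Variable R : realType.
Local Notation R2 := 'rV[R]_2.

(** One link of a chain. It will yield an explicit path of symmetries, since Q - P vanishes at 0 and
    1. *)
Definition straight (W : set R2) (P Q : C1 R2) : Prop :=
  [/\ P 0 = 0, Q 0 = 0, P 1 = Q 1
    & forall t u : R, I01 t -> I01 u -> W (P u + t *: (Q u - P u))].

Lemma cvg_within_slice (F : R * R -> R2) (t u : R) :
  {within I01 `*` I01, continuous F} -> I01 t -> I01 u ->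
  forall e : R, 0 < e -> \forall t' \near t & u' \near u,
    I01 t' -> I01 u' -> `|F (t, u) - F (t', u')| <= e.
Proof.
move=> /subspace_continuousP cF It Iu e e0.
have /cvgrPdist_le/(_ e e0) := cF (t, u) (conj It Iu).
move=> [[M N] /= [m n] MN]; exists (M, N) => // -[t' u'] [/= Mt Nu] It' Iu'.
exact: (MN (t', u')).
Qed.

Lemma slice_continuous (F : R * R -> R2) (t : R) :
  {within I01 `*` I01, continuous F} -> I01 t -> {within I01, continuous (fun u => F (t, u))}.
Proof.
move=> cF It; apply/cont01P => u Iu e e0.
have [[M N] /= [m n] MN] := cvg_within_slice cF It Iu e0.
apply: filterS n => v Nv Iv; apply: (MN (t, v)) => //; split=> //=.
exact: nbhs_singleton m.
Qed.

(** The tube lemma: compactness in [u] makes continuity in t uniform. *)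
Lemma slice_near (F : R * R -> R2) (t e : R) :
  {within I01 `*` I01, continuous F} -> I01 t -> 0 < e ->
  \forall t' \near t, forall u : R, I01 u -> I01 t' -> `|F (t, u) - F (t', u)| <= e.
Proof.
move=> cF It e0; have /compact_near_coveringP cI := @segment_compact R 0 1.
have e2 : 0 < e / 2 by rewrite divr_gt0.
pose P (t' u : R) := I01 u -> I01 t' -> `|F (t, u) - F (t', u)| <= e.
have H (u : R) : I01 u -> \forall u' \near u & t' \near nbhs t, P t' u'.
  move=> Iu; have [[M N] /= [m n] MN] := cvg_within_slice cF It Iu e2.
  exists (N, M) => //= -[u' t'] [/= Nu' Mt'] Iu' It'.
  rewrite [e]splitr (le_trans (ler_distD (F (t, u)) _ _))// lerD//.
    rewrite distrC; apply: (MN (t, u')) => //; split=> //=; exact: nbhs_singleton m.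
  exact: (MN (t', u')).
have NP : \forall t' \near t, I01 `<=` P t' by exact: (cI R (nbhs t) P _ H).
by apply: filterS NP => t' NP u Iu; exact: (NP u Iu).
Qed.

(** The exponential law: a homotopy is a continuous path in the space of curves. *)
Lemma homotopy_C0_continuous (F : R * R -> R2) :
  {within I01 `*` I01, continuous F} ->
  {within I01, continuous (fun t : R => C0of (fun u => F (t, u)) : C0 R2)}.
Proof.
move=> cF; apply/cont01P => t It e e0.
apply: filterS (slice_near cF It e0) => t' NP It'.
rewrite C0_normE; apply: C0_norm_le => u Iu; rewrite C0B.
rewrite !C0ofE//; try exact: (slice_continuous cF).
exact: NP.
Qed.

Lemma ball_straight (W : set R2) (X : C0 R2) (r : R) (P Q : C1 R2) :
  (forall Y, ball X r Y -> forall u : R, I01 u -> W (Y u)) ->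
  ball X r (C1val P) -> ball X r (C1val Q) -> P 0 = 0 -> Q 0 = 0 -> P 1 = Q 1 ->
  straight W P Q.
Proof.
move=> XW bP bQ P0 Q0 PQ1; split=> // t u It Iu.
exact: (XW _ (ball_segment bP bQ It) u Iu).
Qed.

(* C^1 curves that are uniformly close to the same [G t] are joined by a segment; the set of [t]
   reached from [P0] by a chain is open and closed in [0, 1]. *)
Lemma chain_of_C0_path (W : set R2) (G : R -> C0 R2) (P0 P1 : C1 R2) : open W ->
  {within I01, continuous G} ->
  (forall t u : R, I01 t -> I01 u -> W (G t u)) ->
  (forall t : R, I01 t -> G t 0 = 0 /\ G t 1 = P1 1) ->
  G 0 = C1val P0 -> G 1 = C1val P1 ->
  clos_refl_trans _ (straight W) P0 P1.
Proof.
move=> oW cG GW Gends G0 G1.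
pose O := [set X : C0 R2 | forall u : R, I01 u -> W (X u)].
have oO : open O by exact: open_C0.
pose good (X : C0 R2) (r : R) (Q : C1 R2) := [/\ ball X r (C1val Q), Q 0 = 0 & Q 1 = P1 1].
(* All C^1 curves of a ball with the right ends, so that the choice of an approximation of [G t]
   does not matter. *)
pose Pr (t : R) := exists2 r : R, 0 < r &
  forall Q, good (G t) r Q -> clos_refl_trans _ (straight W) P0 Q.
have rad t : I01 t -> exists2 r : R, 0 < r & ball (G t) r `<=` O.
  move=> It; have Ot : O (G t) by move=> u; exact: GW.
  by have [r r0 rO] := (nbhs_ballP _ _).1 (open_nbhs_nbhs (conj oO Ot)); exists r.
have ex t (r : R) : I01 t -> 0 < r -> exists Q, good (G t) r Q.
  move=> It r0; have [Q [Q0 Q1 Qr]] := C1_dense (G t) r0; have [g0 g1] := Gends t It.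
  by exists Q; split; rewrite ?Q0 ?Q1// -ball_normE/= distrC.
have str X (r : R) Q Q' : ball X r `<=` O -> good X r Q -> good X r Q' -> straight W Q Q'.
  move=> rO [bQ Q0 Q1] [bQ' Q0' Q1']; apply: (@ball_straight W X r) => //.
  by rewrite Q1 Q1'.
have shrink X (r r' : R) Q : r <= r' -> good X r Q -> good X r' Q.
  by move=> rr [bQ ? ?]; split=> //; exact: le_ball bQ.
have : (I01 : set R) `<=` Pr.
  apply: (@connected_locally_const R I01 Pr 0).
  - by apply/connected_intervalP; exact: interval_is_interval.
  - exact: I01_0.
  - have [r r0 rO] := rad 0 (I01_0 R); exists r => // Q Qr.
    apply: rt_step; apply: (str (G 0) r) => //.
    have [g0 g1] := Gends 0 (I01_0 R).
    split; first by rewrite -G0; exact: ballxx.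
      by rewrite -C1valE -G0.
    by rewrite -C1valE -G0.
  move=> t It; have [r r0 rO] := rad t It.
  have r2 : 0 < r / 2 by rewrite divr_gt0.
  have r4 : 0 < r / 4 by rewrite divr_gt0.
  have := (cont01P G).1 cG t It _ r4; apply: filterS => t' Gt It'; have {}Gt := Gt It'.
  have near_good (r' : R) Q : r' <= r / 2 -> good (G t') r' Q -> good (G t) r Q.
    move=> rr [bQ Q0 Q1]; split=> //; move: bQ; rewrite -!ball_normE/= => bQ.
    rewrite (le_lt_trans (ler_distD (G t') _ _))//.
    have -> : r = r / 4 + (r / 2 + r / 4) by lra.
    rewrite ler_ltD// (lt_le_trans bQ)// (le_trans rr)// lerDl ltW//.
  (* In both directions a C^1 curve near the centre where the property is known is reached first. It
     lies within r of [G t], and so does the target, hence one more segment suffices; r/4 + r/2 < r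
     leaves room. *)
  split=> -[s s0 sP].
    have [Q1 gQ1] := ex t' (Num.min s (r / 2)) It' ltac:(by rewrite lt_min s0).
    exists r => // Q gQ; apply: rt_trans (sP Q1 _) _.
      by apply: shrink gQ1; rewrite ge_min lexx.
    apply: rt_step; apply: (str (G t) r) => //; apply: near_good gQ1.
    by rewrite ge_min lexx orbT.
  have [Q1 gQ1] := ex t (Num.min s r) It ltac:(by rewrite lt_min s0).
  exists (r / 2) => // Q gQ; apply: rt_trans (sP Q1 _) _.
    by apply: shrink gQ1; rewrite ge_min lexx.
  apply: rt_step; apply: (str (G t) r) => //.
    by apply: shrink gQ1; rewrite ge_min lexx orbT.
  exact: near_good gQ.
move=> /(_ 1 (I01_1 R))[r r0]; apply; have [g0 g1] := Gends 1 (I01_1 R).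
by split; [rewrite G1; exact: ballxx|rewrite -C1valE -G1|].
Qed.

End Homotopy.

(** * Homotopy of two arcs from the contraction of a loop *)

Section FibreChains.
Variable R : realType.
Local Notation R2 := 'rV[R]_2.

Definition edge1 (t : R) : R := Num.min 1 (Num.min (0 + t * 3) (3 + t * (-3))).
Definition edge2 (t : R) : R := Num.max 0 (Num.min 1 (-1 + t * 3)).

Lemma continuous_affine (a b : R) : continuous (fun t : R => a + t * b).
Proof. exact: (@continuous_line R R a b). Qed.

Lemma continuous_minc (g : R -> R) (a : R) : continuous g -> continuous (fun t => Num.min a (g t)).
Proof. by move=> cg t; apply: (@continuous_min _ _ (cst a) g); [exact: cvg_cst|exact: cg]. Qed.

Lemma continuous_edge1 : continuous edge1.
Proof.
apply: continuous_minc => t.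
by apply: (@continuous_min _ _ (fun t : R => 0 + t * 3) (fun t => 3 + t * (-3)));
  exact: continuous_affine.
Qed.

Lemma continuous_edge2 : continuous edge2.
Proof.
move=> t; apply: (@continuous_max _ _ (cst 0) (fun t : R => Num.min 1 (-1 + t * 3))).
  exact: cvg_cst.
by apply: continuous_minc; exact: continuous_affine.
Qed.

Lemma edge_I (t : R) : I01 t -> I01 (edge1 t) /\ I01 (edge2 t).
Proof.
rewrite /= in_itv/= => /andP[t0 t1]; split; apply/I01P.
  by rewrite /edge1 !le_min ge_min ler01 lexx/= andbT; apply/andP; split; lra.
by rewrite /edge2 le_max lexx/= ge_max ler01 ge_min lexx.
Qed.

(* [edge] runs along three sides of the unit square, from (0,0) to (0,1). *)
Lemma edgeP (t : R) : I01 t -> [\/ edge2 t = 0, edge1 t = 1 | edge2 t = 1].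
Proof.
rewrite /= in_itv/= => /andP[t0 t1].
have [h|h] := leP (t * 3) 1.
  by apply: Or31; rewrite /edge2 max_l// ge_min; apply/orP; right; lra.
have [h2|h2] := leP 2 (t * 3).
  by apply: Or33; rewrite /edge2 min_l ?max_r//; lra.
by apply: Or32; rewrite /edge1 min_l// le_min; apply/andP; split; lra.
Qed.

(** The contraction of the loop [y0] followed by [y1] backwards is a map on the square, equal to the
    loop on the side {0} x [0, 1] and constant on the three others. The square is swept by the
    segments from a point of these three sides to the midpoint (0, 1/2), which is mapped to [y0 1].
    The first and last segments are the two halves of the fourth side and give [y0] and [y1]. *)
Lemma loop_homotopy (A : set R2) (y0 y1 : R -> R2) :
  simply_connected A -> {within I01, continuous y0} -> {within I01, continuous y1} ->
  (forall t : R, I01 t -> A (y0 t) /\ A (y1 t)) -> y0 0 = y1 0 -> y0 1 = y1 1 ->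
  exists F : R * R -> R2, [/\ {within I01 `*` I01, continuous F},
    forall t u : R, I01 t -> I01 u -> A (F (t, u)),
    forall u : R, I01 u -> F (0, u) = y0 u /\ F (1, u) = y1 u
    & forall t : R, I01 t -> F (t, 0) = y0 0 /\ F (t, 1) = y0 1].
Proof.
move=> [_ sc] c0 c1 yA y00 y11.
pose k0 (t : R) := Num.min 1 (0 + t * 2); pose k1 (t : R) := Num.min 1 (2 + t * (-2)).
have ck0 : continuous k0.
  by apply: continuous_minc; exact: continuous_affine.
have ck1 : continuous k1.
  by apply: continuous_minc; exact: continuous_affine.
have kI (t : R) : I01 t -> I01 (k0 t) /\ I01 (k1 t).
  rewrite /= in_itv/= => /andP[t0 t1]; split; apply/I01P.
    by rewrite /k0 le_min ge_min ler01 lexx/= andbT; lra.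
  by rewrite /k1 le_min ge_min ler01 lexx/= andbT; lra.
(* On each half of [0, 1] one of the two arcs rests at the common end point, so the loop is a sum of
   continuous functions. *)
pose c (t : R) := y0 (k0 t) + (y1 (k1 t) - y0 1).
have cc : {within I01, continuous c}.
  have cy0 := cont01_comp c0 ck0 (fun t It => (kI t It).1).
  have cy1 := cont01_comp c1 ck1 (fun t It => (kI t It).2).
  move=> t; apply: cvgD; first exact: cy0.
  by apply: cvgB; [exact: cy1|exact: cvg_cst].
have cl (t : R) : 0 <= t -> t <= 2^-1 -> c t = y0 (t * 2).
  move=> t0 t2; rewrite /c /k0 /k1 add0r min_r; last lra.
  by rewrite min_l ?y11 ?subrr ?addr0//; lra.
have cr (t : R) : 2^-1 <= t -> t <= 1 -> c t = y1 (2 + t * (-2)).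
  move=> t0 t2; rewrite /c /k0 /k1 min_l; last lra.
  by rewrite min_r; [rewrite addrC subrK|lra].
have cA (t : R) : I01 t -> A (c t).
  rewrite /= in_itv/= => /andP[t0 t1]; have [h|h] := leP t 2^-1.
    by rewrite (cl t t0 h); apply: (yA _ _).1; apply/I01P; lra.
  by rewrite (cr t (ltW h) t1); apply: (yA _ _).2; apply/I01P; lra.
have e0 : c 0 = y0 0 by rewrite cl ?mul0r//; lra.
have e1 : c 1 = y0 0.
  by rewrite (cr 1 ltac:(lra) (lexx 1)) y00; congr y1; lra.
have [H [cH HA H0 H1]] := sc c cc cA ltac:(by rewrite e0 e1).
pose q (p : R * R) : R * R := ((1 - p.2) * edge1 p.1, (1 - p.2) * edge2 p.1 + p.2 * 2^-1).
have cq : continuous q.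
  move=> p; have cf : {for p, continuous (@fst R R)} by exact: cvg_fst.
  have cs : {for p, continuous (@snd R R)} by exact: cvg_snd.
  have c1s : {for p, continuous (fun p : R * R => 1 - p.2)}.
    by apply: cvgB; [exact: cvg_cst|exact: cs].
  have ce1 : {for p, continuous (fun p : R * R => edge1 p.1)}.
    by apply: (continuous_comp cf); exact: continuous_edge1.
  have ce2 : {for p, continuous (fun p : R * R => edge2 p.1)}.
    by apply: (continuous_comp cf); exact: continuous_edge2.
  have cm1 : {for p, continuous (fun p : R * R => (1 - p.2) * edge1 p.1)} by apply: cvgM.
  have cm2 : {for p, continuous (fun p : R * R => (1 - p.2) * edge2 p.1 + p.2 * 2^-1)}.
    by apply: cvgD; apply: cvgM => //; exact: cvg_cst.
  exact: (cvg_pair cm1 cm2).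
have qI (p : R * R) : (I01 `*` I01) p -> (I01 `*` I01) (q p).
  move=> [I1 I2]; have [E1 E2] := edge_I I1.
  move: I2 E1 E2; rewrite /= !in_itv/=.
  move: p.2 (edge1 p.1) (edge2 p.1) => u a b /andP[u0 u1] /andP[a0 a1] /andP[b0 b1].
  by split; apply/andP; split; nra.
exists (H \o q); split.
- apply/subspace_continuousP => p Ip.
  have HP := (subspace_continuousP _ _).1 cH _ (qI p Ip).
  apply: (@cvg_comp _ _ _ q H _ (within (I01 `*` I01) (nbhs (q p)))); last exact: HP.
  move=> B nB.
  have nq : \forall z \near p, (I01 `*` I01) (q z) -> B (q z) by exact: (cq p _ nB).
  rewrite /fmap/= /within/=.
  by apply: filterS nq => z zB Iz; apply: zB; exact: qI.
- by move=> t u It Iu; apply: HA; have [] := qI (t, u) (conj It Iu).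
- move=> u; rewrite /= in_itv/= => /andP[u0 u1]; rewrite /q /=.
  have [-> ->] : edge1 0 = 0 /\ edge1 1 = 0.
    by rewrite /edge1; split; [rewrite (@min_l _ _ (0 + 0 * 3)); [rewrite min_r|]|rewrite (@min_r _ _ (0 + 1 * 3)); [rewrite min_r|]]; lra.
  have [-> ->] : edge2 0 = 0 /\ edge2 1 = 1.
    by rewrite /edge2; split; [rewrite max_l// ge_min; apply/orP; right|rewrite min_l ?max_r]; lra.
  rewrite !mulr0 mulr1 add0r; split.
    rewrite (H0 _ _).1; last by apply/I01P; lra.
    by rewrite cl; [congr y0; lra|lra..].
  rewrite (H0 _ _).1; last by apply/I01P; lra.
  by rewrite cr; [congr y1; lra|lra..].
- move=> t It; have [E1 E2] := edge_I It; rewrite /q /= subr0 !mul1r mul0r addr0 subrr !mul0r add0r ?mul1r.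
  split; last first.
    rewrite (H0 _ _).1; last by apply/I01P; lra.
    by rewrite cl; [congr y0; lra|lra..].
  rewrite -e0; have [->|->|->] := edgeP It.
  + by have [] := H1 _ E1.
  + by have [] := H0 _ E2.
  + by have [] := H1 _ E1.
Qed.

End FibreChains.

(** * Curves in a fibre of the groupoid *)

Section Fibres.
Variable R : realType.
Local Notation R2 := 'rV[R]_2.
Variables (U : set R2) (phi : R2 -> R).
Hypotheses (openU : open U) (sphi : smooth_on U phi).
Hypothesis leafsc : forall x, U x -> simply_connected (leaf U phi x).

Definition fibre (x : R2) : set R2 := [set w | h_pos U phi (x, w)].

Lemma open_fibre x : open (fibre x).
Proof.
apply: open_comp (open_h_pos openU sphi) => w _; exact: continuous_pairl.
Qed.

Lemma fibre_chain x (P Q : C1 R2) : U x -> P 0 = 0 -> Q 0 = 0 -> P 1 = Q 1 ->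
  (forall u : R, I01 u -> fibre x (P u)) -> (forall u : R, I01 u -> fibre x (Q u)) ->
  clos_refl_trans _ (straight (fibre x)) P Q.
Proof.
move=> Ux P0 Q0 PQ1 WP WQ; have [px|px] := eqVneq (phi x) 0.
  apply: rt_step; split=> // t u It Iu.
  by apply: h_pos_convex0 => //; [exact: WP|exact: WQ].
have cP : {within I01, continuous P} by exact: (@C1_continuous _ _ P).
have cQ : {within I01, continuous Q} by exact: (@C1_continuous _ _ Q).
pose xf (P : C1 R2) (u : R) := x + phi x *: J (P u).
have xfE (P' : C1 R2) (u : R) : xf P' u = x_f phi (x, P' u) by rewrite x_fE.
have cxf (P' : C1 R2) : {within I01, continuous (xf P')}.
  have cP' : {within I01, continuous P'} by exact: (@C1_continuous _ _ P').
  apply: (@cont01_comp_at _ _ _ P' (fun v => x + phi x *: J v) cP') => t _.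
  suff -> : (fun v => x + phi x *: J v) = (fun v => phi x *: J v + x).
    have H := continuous_clinear_addc (c := x) (clinear_scale (phi x) (@clinear_J R)).
    exact: (H (P' t)).
  by apply/funext => v; rewrite addrC.
have [|||F [cF FA F01 Fends]] := @loop_homotopy _ (leaf U phi x) (xf P) (xf Q)
    (leafsc Ux) (cxf P) (cxf Q).
- by move=> t It; rewrite !xfE; split; apply: (curve_leaf openU sphi).
- by rewrite /xf P0 Q0.
- by rewrite /xf PQ1.
have un (P' : C1 R2) u : unx phi x (xf P' u) = P' u by rewrite xfE unx_x_f.
pose H (p : R * R) := unx phi x (F p).
have cH : {within I01 `*` I01, continuous H}.
  move=> p; apply: (continuous_comp (cF p)); exact: continuous_unx.
have Hs (t : R) : I01 t -> {within I01, continuous (fun u => H (t, u))}.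
  by move=> It; exact: slice_continuous cH It.
have I0 := I01_0 R; have I1 := I01_1 R.
apply: (@chain_of_C0_path _ _ (fun t => C0of (fun u => H (t, u)))).
- exact: open_fibre.
- exact: homotopy_C0_continuous.
- move=> t u It Iu; rewrite C0ofE//; last exact: Hs.
  by apply: unx_h_pos => //; exact: FA.
- move=> t It; rewrite !C0ofE//; try exact: Hs.
  by have [f0 f1] := Fends t It; rewrite /H f0 f1 !un P0 PQ1.
- apply: C0_ext => u Iu; rewrite C0ofE//; last exact: Hs.
  by rewrite /H (F01 u Iu).1 un.
- apply: C0_ext => u Iu; rewrite C0ofE//; last exact: Hs.
  by rewrite /H (F01 u Iu).2 un.
Qed.

Lemma C1_curve (W : set R2) (c : R -> R2) : open W -> {within I01, continuous c} ->
  (forall u : R, I01 u -> W (c u)) ->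
  exists P : C1 R2, [/\ P 0 = c 0, P 1 = c 1 & forall u : R, I01 u -> W (P u)].
Proof.
move=> oW cc cW.
have CW : forall u : R, I01 u -> W (C0of c u) by move=> u Iu; rewrite C0ofE//; exact: cW.
have [r r0 rW] := (nbhs_ballP _ _).1 (open_nbhs_nbhs (conj (open_C0 (E := R2) oW) CW)).
have [P [P0 P1 Pr]] := C1_dense (C0of c) r0.
exists P; split.
- by rewrite P0 C0ofE//; exact: I01_0.
- by rewrite P1 C0ofE//; exact: I01_1.
by apply: (rW (C1val P)); rewrite -ball_normE/= distrC.
Qed.

(** Membership in the component connects (x, w) to the units only through other fibres. A path
    inside the leaf from x to x_f, pulled back by [unx], is a curve in the fibre over x; at a zero
    of phi the half plane gives a segment. *)
Lemma groupoid_C1_curve x w : groupoid U phi (x, w) -> U x /\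
  exists P : C1 R2, [/\ P 0 = 0, P 1 = w & forall u : R, I01 u -> fibre x (P u)].
Proof.
move=> /(groupoid_same_leaf openU sphi)[hp sl]; have [/= Ux _ _] := hp.
split=> //.
suff [c [cc c0 c1 cW]] : exists c : R -> R2, [/\ {within I01, continuous c}, c 0 = 0, c 1 = w
    & forall u : R, I01 u -> fibre x (c u)].
  have [P [P0 P1 PW]] := C1_curve (open_fibre (x := x)) cc cW.
  by exists P; rewrite P0 P1.
have [px|px] := eqVneq (phi x) 0.
  exists (fun t => 0 + t *: w); split.
  - by apply: continuous_subspaceT; exact: continuous_line.
  - by rewrite scale0r addr0.
  - by rewrite scale1r add0r.
  - move=> u Iu; have := h_pos_convex0 sphi px (h_pos0 sphi Ux) hp Iu.
    by rewrite subr0.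
have {sl}sl : leaf U phi x (x_f phi (x, w)) by case: sl => //= p0; rewrite p0 eqxx in px.
have [pc _] := leafsc Ux.
have [c [cc cA c0 c1]] := pc x (x_f phi (x, w)) (@rt_refl _ _ x) sl.
exists (unx phi x \o c); split.
- by move=> u; apply: (continuous_comp (cc u)); exact: continuous_unx.
- by rewrite /= c0 /unx subrr J0 scaler0.
- by rewrite /= c1 unx_x_f.
- by move=> u Iu; apply: unx_h_pos => //; exact: cA.
Qed.

End Fibres.

(** * The linearized problem *)

Section Solutions.
Variable R : realType.
Local Notation R2 := 'rV[R]_2.

Lemma clinear0 (E F : normedModType R) (l : E -> F) : clinear l -> l 0 = 0.
Proof.
by move=> [ll _]; have := ll (-1) 0 0; rewrite scaler0 addr0 scaleN1r addNr.
Qed.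

Lemma clinearZ (E F : normedModType R) (l : E -> F) a x : clinear l -> l (a *: x) = a *: l x.
Proof. by move=> cl; rewrite -[a *: x]addr0 cl.1 clinear0// addr0. Qed.

Lemma clinearB (E F : normedModType R) (l : E -> F) x y : clinear l -> l (x - y) = l x - l y.
Proof. by move=> cl; rewrite addrC -[- y]scaleN1r cl.1 scaleN1r addrC. Qed.

Lemma R2_inj_coord (v w : R2) : (forall i, v 0 i = w 0 i) -> v = w.
Proof. by move=> H; apply/rowP. Qed.

Lemma C1_inj0_R2 (X Y : C1 R2) : C1_deriv X = C1_deriv Y -> X 0 = Y 0 -> X = Y.
Proof.
move=> dXY XY0; apply: C1_ext => // u Iu; apply: R2_inj_coord => i.
have cl := @clinear_coord R 1 i.
rewrite -!(C1mapE _ cl Iu); congr (C1_fun _ u); apply: C1_inj0.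
  by rewrite !C1map_deriv// dXY.
by rewrite !C1mapE ?XY0//; exact: I01_0.
Qed.

Let del (i : 'I_2) (c : R) : R2 := c *: delta_mx 0 i.
Let cdel i : clinear (del i). Proof. exact: clinear_scalel. Qed.
Let coo (i : 'I_2) (v : R2) : R := v 0 i.
Let ccoo i : clinear (coo i). Proof. exact: clinear_coord. Qed.

Definition prim2 (f : C0 R2) : C1 R2 :=
  C1map (del 0) (prim (C0map (coo 0) f)) + C1map (del 1) (prim (C0map (coo 1) f)).

Lemma clinear_prim2 : clinear prim2.
Proof.
apply: clinear_add.
  exact: (clinear_comp (clinear_comp (clinear_C0map (ccoo 0)) (clinear_prim R))
    (clinear_C1map (cdel 0))).
exact: (clinear_comp (clinear_comp (clinear_C0map (ccoo 1)) (clinear_prim R))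
    (clinear_C1map (cdel 1))).
Qed.

Lemma prim2_deriv f : C1_deriv (prim2 f) = f.
Proof.
apply: C0_ext => u Iu.
rewrite /prim2 (_ : C1_deriv (_ + _) = C1_deriv (C1map (del 0) (prim (C0map (coo 0) f)))
  + C1_deriv (C1map (del 1) (prim (C0map (coo 1) f))))//.
rewrite C0D !C1map_deriv// !C0map_clinE// !prim_deriv !C0map_clinE//.
by rewrite -R2_basis.
Qed.

Lemma prim2_0 f : prim2 f 0 = 0.
Proof.
have I0 := I01_0 R.
by rewrite /prim2 C1D !C1mapE// !prim0 /del !scale0r addr0.
Qed.

Lemma prim2K (P : C1 R2) : P 0 = 0 -> prim2 (C1_deriv P) = P.
Proof. by move=> P0; apply: C1_inj0_R2; rewrite ?prim2_deriv ?prim2_0. Qed.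

Definition C1cst (x : R2) : C1 R2 := C1of (fun=> x) 0.

Lemma C1cst_subproof (x : R2) : {within I01, continuous (fun _ : R => x)} /\
  (forall u : R, `]0, 1[%classic u -> is_derive u 1 (fun _ : R => x) ((0 : C0 R2) u)).
Proof.
split; first by move=> t; exact: cvg_cst.
by move=> u _; exact: is_derive_cst.
Qed.

Lemma C1cstE x (u : R) : I01 u -> C1cst x u = x.
Proof. by have [cx dx] := C1cst_subproof x; move=> Iu; rewrite /C1cst (C1ofE cx dx). Qed.

Lemma C1cst_deriv x : C1_deriv (C1cst x) = 0.
Proof. by have [cx dx] := C1cst_subproof x; exact: C1of_deriv cx dx. Qed.

Lemma clinear_C1cst : clinear C1cst.
Proof.
have I0 := I01_0 R.
apply: (@clinear_bound _ _ _ _ 1).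
  move=> a x y; apply: C1_inj0_R2; last by rewrite C1D C1Z !C1cstE.
  rewrite (_ : C1_deriv (a *: C1cst x + C1cst y) = a *: C1_deriv (C1cst x) + C1_deriv (C1cst y))//.
  by rewrite !C1cst_deriv scaler0 addr0.
move=> x; rewrite mul1r C1_normE C1cst_deriv normr0 ge_max normr_ge0 andbT C0_normE.
by apply: C0_norm_le => u Iu; rewrite C1valE C1cstE.
Qed.

Variables (U : set R2) (phi : R2 -> R).
Hypotheses (openU : open U) (sphi : smooth_on U phi).
Local Notation J := (@J R).
Local Notation B := (C1 R2 * C0 R2)%type.

Definition inU : set B := [set b : B | forall u : R, I01 u -> U (b.1 u)].

Lemma open_inU : open inU.
Proof.
have cl := clinear_comp (clinear_fst (C1 R2) (C0 R2)) (@clinear_C1val R R2).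
rewrite (_ : inU = (@C1val R R2 \o fst) @^-1` [set X : C0 R2 | forall u : R, I01 u -> U (X u)])//.
by apply: open_comp; [move=> b _; exact: cl.2|exact: open_C0].
Qed.

(* The logarithmic derivative of [phi] along a solution, equal to [H'] for the linearized one. *)
Definition logd (b : B) : C0 R := C0map (dphiJ phi) (C0pair (C1val b.1, b.2)).

Lemma logdE b (u : R) : inU b -> I01 u -> logd b u = dphiJ phi (b.1 u, b.2 u).
Proof.
move=> bU Iu; rewrite /logd (@C0mapE _ _ _ (U `*` setT))//; first by rewrite C0pairE.
  exact: smooth_continuous (smooth_dphiJ openU sphi).
by move=> v Iv; rewrite C0pairE//; split=> //=; exact: bU.
Qed.

Lemma smooth_logd : smooth_on inU logd.
Proof.
have oUT := openXT (F := R2) openU.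
have cl : clinear (fun b : B => C0pair (C1val b.1, b.2)).
  apply: (clinear_comp (l := fun b : B => (C1val b.1, b.2)) _ (clinear_C0pair R2 R2)).
  apply: clinear_pair; last exact: clinear_snd.
  exact: (clinear_comp (clinear_fst (C1 R2) (C0 R2)) (@clinear_C1val R R2)).
apply: (smooth_comp open_inU _ (smooth_lin _ cl) (smooth_C0map oUT (smooth_dphiJ openU sphi))).
by move=> b bU u Iu; rewrite C0pairE//; split=> //=; exact: bU.
Qed.

Definition C0one : C0 R := C0of (fun=> 1 : R).

Lemma C0oneE (u : R) : I01 u -> C0one u = 1.
Proof. by move=> Iu; rewrite /C0one C0ofE// => t; exact: cvg_cst. Qed.

(** [hol] as an element of C^0, built from [logd] and the linear map [prim] so that smoothness in
    [b] follows by composition. *)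
Definition holC (b : B) : C0 R := C0one + C1val (prim (logd b)).

Lemma holCE b (u : R) : I01 u -> holC b u = 1 + prim (logd b) u.
Proof. by move=> Iu; rewrite /holC C0D C0oneE. Qed.

Lemma smooth_holC : smooth_on inU holC.
Proof.
move=> k; apply: Ck_add; first exact: open_inU.
  exact: Ck_cst.
have cl := clinear_comp (clinear_prim R) (@clinear_C1val R R).
apply: (Ck_comp (f := logd) open_inU _ (smooth_logd k) (Ck_lin k setT cl)).
by [].
Qed.

Lemma holE (X : C1 R2) (E : C0 R2) (u : R) : inU (X, E) -> I01 u ->
  hol phi X E u = holC (X, E) u.
Proof.
move=> bU Iu; rewrite holCE// primE// /hol; congr (1 + _).
apply: eq_Rintegral => v; rewrite inE/= in_itv/= => /andP[v0 vu].
have Iv : I01 v.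
  by apply/I01P; rewrite v0 (le_trans vu)//; case/andP: ((I01P u).1 Iu).
rewrite logdE//= /dphiJ/= diff_J ?/comp1 ?/comp2; last exact/(smooth_differentiable sphi)/bU.
by rewrite mulrC [X in _ - X]mulrC.
Qed.

Definition hol_pos : set B := inU `&` [set b : B | forall u : R, I01 u -> 0 < holC b u].

Lemma open_hol_pos : open hol_pos.
Proof.
rewrite /hol_pos (_ : [set b | _] = holC @^-1` [set f : C0 R | forall u : R, I01 u -> 0 < f u])//.
apply: open_smooth_preimage; [exact: open_inU|exact: smooth_holC|].
by apply: (@open_C0 R R [set r | 0 < r]); exact: open_gt.
Qed.

(** The left side of X' - phi(X(0)) J E = 0. Positivity of the holonomy is an open condition, so
    this is the only equation cutting out the solutions. *)
Definition defect (b : B) : C0 R2 := C1_deriv b.1 - phi (b.1 0) *: C0map J b.2.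

Lemma lin_solutionsP b : lin_solutions U phi b <-> hol_pos b /\ defect b = 0.
Proof.
case: b => X E; split.
  move=> H; have bU : inU (X, E) by move=> u Iu; have [] := H u Iu.
  split; first by split=> // u Iu; rewrite -holE//; have [] := H u Iu.
  apply: C0_ext => u Iu; have [_ e1 e2 _] := H u Iu.
  rewrite /defect C0B C0Z C0map_clinE//=; last exact: clinear_J.
  apply: R2_ext; rewrite !mxE/=.
    by rewrite mulrN opprK.
  exact: e2.
move=> [[bU hp] d0] u Iu; split; first exact: bU.
- have := congr1 (fun f : C0 R2 => f u 0 0) d0; rewrite /defect C0B C0Z C0map_clinE//=; last exact: clinear_J.
  by rewrite !mxE/= mulrN opprK.
- have := congr1 (fun f : C0 R2 => f u 0 1) d0; rewrite /defect C0B C0Z C0map_clinE//=; last exact: clinear_J.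
  by rewrite !mxE/=.
- by rewrite holE//; exact: hp.
Qed.

(* Every solution of the linearized equation has this form, with [P 0 = 0]. *)
Definition sol (x : R2) (P : C1 R2) : B := (C1cst x + phi x *: C1map J P, C1_deriv P).

Lemma solE x (P : C1 R2) (u : R) : I01 u -> (sol x P).1 u = x_f phi (x, P u).
Proof.
move=> Iu; rewrite x_fE/= C1D C1Z C1cstE// C1mapE//; exact: clinear_J.
Qed.

Lemma sol_at0 x (P : C1 R2) : P 0 = 0 -> (sol x P).1 0 = x.
Proof. by move=> P0; rewrite solE ?P0 ?x_fE/= ?J0 ?scaler0 ?addr0//; exact: I01_0. Qed.

Lemma sol_defect x (P : C1 R2) : P 0 = 0 -> defect (sol x P) = 0.
Proof.
move=> P0; rewrite /defect sol_at0//.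
rewrite (_ : C1_deriv (sol x P).1 = C1_deriv (C1cst x) + phi x *: C1_deriv (C1map J P))//.
by rewrite C1cst_deriv add0r C1map_deriv ?subrr//; exact: clinear_J.
Qed.

Lemma defect0_sol b : defect b = 0 -> b = sol (b.1 0) (prim2 b.2).
Proof.
case: b => X E /= /subr0_eq dX; congr pair; last by rewrite prim2_deriv.
apply: C1_inj0_R2.
  rewrite (_ : C1_deriv (_ + _) = C1_deriv (C1cst (X 0)) + phi (X 0) *: C1_deriv (C1map J (prim2 E)))//.
  by rewrite C1cst_deriv add0r C1map_deriv ?prim2_deriv//; exact: clinear_J.
by rewrite -/(sol _ _).1 sol_at0// prim2_0.
Qed.

Lemma prim_logd_diff (b : B) (w : C0 R2) : inU b -> C1_deriv b.1 = w ->
  forall u : R, I01 u -> phi (b.1 u) = phi (b.1 0)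
    + prim (C0map (fun q : R2 * R2 => 'd phi (q.1) q.2) (C0pair (C1val b.1, w))) u.
Proof.
move=> bU dw u Iu.
set T := C0map _ _.
have TE (v : R) : I01 v -> T v = 'd phi (b.1 v) (w v).
  move=> Iv; rewrite /T (@C0mapE _ _ _ (U `*` setT))//; first by rewrite C0pairE.
    exact: smooth_continuous (smooth_tangent sphi).
  by move=> s Is; rewrite C0pairE//; split=> //=; exact: bU.
pose g (v : R) := phi (b.1 v) - prim T v.
have cg : {within I01, continuous g}.
  have c1 : {within I01, continuous (phi \o b.1)}.
    apply: (cont01_comp_at (@C1_continuous _ _ b.1)) => t It.
    exact/(smooth_continuous sphi)/bU.
  by move=> t; apply: cvgB; [exact: c1|exact: (@C1_continuous _ _ (prim T))].
have dg (v : R) : `]0, 1[%classic v -> is_derive v 1 g 0.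
  move=> v01; have Iv := I01_oo v01.
  have h1 := is_derive_comp_diff (C1_is_derive b.1 v01) (smooth_differentiable sphi (bU v Iv)).
  have := is_deriveB h1 (C1_is_derive (prim T) v01).
  by rewrite prim_deriv TE// dw subrr.
have := cst01 cg dg Iu; rewrite /g prim0 subr0 => <-.
by rewrite subrK.
Qed.

Lemma clinear_diffJ x : U x -> clinear (fun v : R2 => 'd phi x (J v) : R).
Proof.
move=> Ux; apply: (clinear_comp (@clinear_J R)).
by split; [exact: linearP|exact: (diff_continuous (smooth_differentiable sphi Ux))].
Qed.

Lemma prim_C0map (l : R2 -> R) (P : C1 R2) : clinear l -> P 0 = 0 ->
  prim (C0map l (C1_deriv P)) = C1map l P.
Proof.
move=> cl P0; set f := C0map l (C1_deriv P); apply: C1_inj0.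
  exact: (etrans (prim_deriv f) (esym (C1map_deriv P cl))).
have e : C1map l P 0 = 0 by rewrite (C1mapE P cl (I01_0 R)) P0 clinear0.
exact: (etrans (prim0 f) (esym e)).
Qed.

(** Along a solution (phi(X))' = phi(x) dphi(J P') = phi(x) H', hence phi(X) = phi(x) H, and one
    divides by phi(x). At a zero of phi, X stays at x and H' is a fixed linear form of P'. *)
Lemma holC_h x (P : C1 R2) (u : R) : inU (sol x P) -> P 0 = 0 -> I01 u ->
  holC (sol x P) u = h phi (x, P u).
Proof.
move=> bU P0 Iu; have x0 := sol_at0 x P0.
have Ux : U x by rewrite -x0; apply: bU; exact: I01_0.
rewrite holCE//; have [px|px] := eqVneq (phi x) 0.
  rewrite (hE0 sphi (p := (x, _)) Ux px)/=; congr (1 + _).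
  have cl := clinear_diffJ Ux.
  rewrite -[RHS](C1mapE P cl Iu) -(prim_C0map cl P0); congr (C1_fun (prim _) u).
  apply: C0_ext => v Iv; rewrite (logdE bU Iv) (C0map_clinE _ cl Iv) /dphiJ.
  by rewrite (solE x P Iv) x_fE/= px scale0r addr0.
rewrite hE//= -(solE x P Iu).
have dw : C1_deriv (sol x P).1 = phi x *: C0map J (C1_deriv P).
  by have /subr0_eq := sol_defect x P0; rewrite x0.
rewrite (prim_logd_diff bU dw Iu) x0.
set T := C0map _ _.
suff -> : T = phi x *: logd (sol x P).
  rewrite (clinearZ _ _ (clinear_prim R)) C1Z mulrDl divff//.
  by rewrite /GRing.scale/= mulrAC divff// mul1r.
apply: C0_ext => v Iv; rewrite C0Z (logdE bU Iv).
have Tin (s : R) : I01 s -> (U `*` setT) (C0pair (C1val (sol x P).1, phi x *: C0map J (C1_deriv P)) s).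
  by move=> Is; rewrite (C0pairE _ Is); split=> //=; exact: bU.
rewrite /T (C0mapE (smooth_continuous (smooth_tangent sphi)) Tin Iv).
have e : (phi x *: C0map J (C1_deriv P)) v = phi x *: J (C1_deriv P v).
  by rewrite C0Z (C0map_clinE _ (@clinear_J R) Iv).
rewrite (C0pairE _ Iv); transitivity ('d phi ((sol x P).1 v) (phi x *: J (C1_deriv P v))).
  by rewrite -e.
by rewrite linearZ.
Qed.

End Solutions.

(** * The manifold of linearized solutions *)

Section LinSlice.
Variable R : realType.
Local Notation R2 := 'rV[R]_2.
Local Notation J := (@J R).
Local Notation B := (C1 R2 * C0 R2)%type.

(** Preimages of the four basis vectors define a continuous right inverse r, and 1 - r l projects
    onto the kernel. *)
Lemma R2R2_split (K : normedModType R) (l : {linear K -> (R2 * R2)%type}) :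
  continuous l -> (forall y, exists x, l x = y) -> split_surjection l.
Proof.
move=> cl sl; split=> //.
pose pre y := xget 0 [set x | l x = y].
have preP y : l (pre y) = y.
  by have [x xy] := sl y; exact: (xgetPex 0 (ex_intro (fun x => l x = y) x xy)).
pose d (i : 'I_2) : R2 := delta_mx 0 i.
pose r (y : R2 * R2) : K := y.1 0 0 *: pre (d 0, 0) + y.1 0 1 *: pre (d 1, 0)
  + (y.2 0 0 *: pre (0, d 0) + y.2 0 1 *: pre (0, d 1)).
have cr : clinear r.
  have h i (v : K) : clinear (fun y : R2 => y 0 i *: v).
    exact: (clinear_comp (@clinear_coord R 1 i) (clinear_scalel v)).
  have h1 i (v : K) : clinear (fun y : R2 * R2 => y.1 0 i *: v).
    exact: (clinear_comp (clinear_fst R2 R2) (h i v)).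
  have h2 i (v : K) : clinear (fun y : R2 * R2 => y.2 0 i *: v).
    exact: (clinear_comp (clinear_snd R2 R2) (h i v)).
  by apply: clinear_add; apply: clinear_add.
have lr y : l (r y) = y.
  rewrite /r !linearD !linearZ/= !preP; case: y => y z.
  congr pair; rewrite /= ?scaler0 ?addr0 ?add0r; exact/esym/R2_basis.
have cl' : clinear l by split; [exact: linearP|].
have cp : clinear (fun x => x - r (l x)).
  rewrite (_ : (fun x => _) = fun x => x + -1 *: r (l x)).
    by apply: clinear_add; [exact: clinear_id|exact/clinear_scale/(clinear_comp cl' cr)].
  by apply/funext => x; rewrite scaleN1r.
pose p : {linear K -> K} := HB.pack (fun x => x - r (l x)) (GRing.isLinear.Build _ _ _ _ _ cp.1).
exists p; split; first exact: cp.2.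
  by move=> x; rewrite /p/= linearB/= lr subrr.
by move=> x lx; rewrite /p/= lx (clinear0 cr) subr0.
Qed.

Variables (U : set R2) (phi : R2 -> R).
Hypotheses (openU : open U) (sphi : smooth_on U phi).

(** Initial value, E and defect F are independent coordinates: X is recovered by integrating X' = F
    + phi(x) J E. The solutions are F = 0 in an open set, so one chart straightens all of them. *)
Definition slice (b : B) : (R2 * C0 R2) * C0 R2 := ((b.1 0, b.2), defect phi b).

Definition unslice (k : (R2 * C0 R2) * C0 R2) : B :=
  (C1cst k.1.1 + prim2 (k.2 + phi k.1.1 *: C0map J k.1.2), k.1.2).

Lemma unslice_at0 k : (unslice k).1 0 = k.1.1.
Proof. by rewrite /= C1D (C1cstE _ (I01_0 R)) prim2_0 addr0. Qed.

Lemma unsliceK k : slice (unslice k) = k.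
Proof.
rewrite /slice /defect unslice_at0; case: k => -[x E] F; congr (_, _).
rewrite (_ : C1_deriv (unslice _).1 = C1_deriv (C1cst x) + C1_deriv (prim2 (F + phi x *: C0map J E)))//.
by rewrite C1cst_deriv add0r prim2_deriv /= addrK.
Qed.

Lemma sliceK b : unslice (slice b) = b.
Proof.
case: b => X E; congr pair; rewrite /slice /defect/= subrK.
apply: C1_inj0_R2; last by rewrite C1D (C1cstE _ (I01_0 R)) prim2_0 addr0.
rewrite (_ : C1_deriv (_ + _) = C1_deriv (C1cst (X 0)) + C1_deriv (prim2 (C1_deriv X)))//.
by rewrite C1cst_deriv add0r prim2_deriv.
Qed.

Lemma clinear_at0 : clinear (fun b : B => b.1 0).
Proof. exact: (clinear_comp (clinear_fst (C1 R2) (C0 R2)) (clinear_C1_eval R2 0)). Qed.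

Lemma clinear_C0mapJ : clinear (C0map J).
Proof. exact: clinear_C0map (@clinear_J R). Qed.

Lemma smooth_slice : smooth_on (inU U) slice.
Proof.
have oU := open_inU openU.
apply: smooth_pair => //.
  apply: smooth_lin; apply: clinear_pair; first exact: clinear_at0.
  exact: clinear_snd.
have s1 : smooth_on (inU U) (fun b : B => phi (b.1 0)).
  apply: (smooth_comp oU _ (smooth_lin _ clinear_at0) sphi).
  by move=> b; apply; exact: I01_0.
have l1 : clinear (fun b : B => C1_deriv b.1).
  exact: (clinear_comp (clinear_fst (C1 R2) (C0 R2)) (clinear_C1_deriv R2)).
have l2 : clinear (fun b : B => -1 *: C0map J b.2).
  apply: clinear_scale; exact: (clinear_comp (clinear_snd (C1 R2) (C0 R2)) clinear_C0mapJ).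
move=> k; apply: (@Ck_congr _ _ _ _ _ (fun b : B => C1_deriv b.1 + phi (b.1 0) *: (-1 *: C0map J b.2))) => //.
  by move=> b _; rewrite /defect scaleN1r scalerN.
by apply: Ck_add => //; [exact: Ck_lin|apply: Ck_scale => //; exact: Ck_lin].
Qed.

Let D : set ((R2 * C0 R2) * C0 R2) := [set k | U k.1.1].

Let clin11 : clinear (fun k : (R2 * C0 R2) * C0 R2 => k.1.1).
Proof. exact: (clinear_comp (clinear_fst (R2 * C0 R2)%type (C0 R2)) (clinear_fst R2 (C0 R2))). Qed.

Let clin12 : clinear (fun k : (R2 * C0 R2) * C0 R2 => k.1.2).
Proof. exact: (clinear_comp (clinear_fst (R2 * C0 R2)%type (C0 R2)) (clinear_snd R2 (C0 R2))). Qed.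

Let openD : open D.
Proof.
rewrite (_ : D = (fun k : (R2 * C0 R2) * C0 R2 => k.1.1) @^-1` U)//.
by apply: open_comp => // k _; exact: clin11.2.
Qed.

Lemma smooth_unslice : smooth_on D unslice.
Proof.
apply: smooth_pair => //; last exact: smooth_lin.
have s1 : smooth_on D (fun k => phi k.1.1).
  by apply: (smooth_comp openD _ (smooth_lin _ clin11) sphi).
move=> k; apply: Ck_add => //.
  exact: Ck_lin (clinear_comp clin11 (clinear_C1cst R)).
apply: (Ck_comp (f := fun k : (R2 * C0 R2) * C0 R2 => k.2 + phi k.1.1 *: C0map J k.1.2)
  (B := setT) openD) => //; last exact: Ck_lin (clinear_prim2 R).
apply: Ck_add => //; first exact: Ck_lin (clinear_snd _ _).
apply: Ck_scale => //; exact: Ck_lin (clinear_comp clin12 clinear_C0mapJ).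
Qed.

Lemma slice_image (O : set B) : O `<=` inU U ->
  slice @` O = D `&` unslice @^-1` O.
Proof.
move=> OU; apply/seteqP; split=> [_ [b Ob <-]|k [Dk Ok]].
  by split; [apply: (OU b Ob); exact: I01_0|rewrite /= sliceK].
by exists (unslice k) => //; rewrite unsliceK.
Qed.

Lemma lin_slice_chart :
  slice_chart (lin_solutions U phi) (hol_pos U phi) slice.
Proof.
have hU : hol_pos U phi `<=` inU U by move=> b [].
have oO := open_hol_pos openU sphi.
have im := slice_image hU.
split=> //.
- rewrite im; apply: open_smooth_preimage => //; exact: smooth_unslice.
- exact: smooth_sub hU smooth_slice.
- exists unslice; last by move=> b _; exact: sliceK.
  by rewrite im; apply: smooth_sub smooth_unslice; exact: subIsetl.
move=> b Ob; split; first by move=> /(lin_solutionsP openU sphi)[].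
by move=> d0; apply/(lin_solutionsP openU sphi).
Qed.

End LinSlice.

(** * Classes of linearized solutions *)

Section LinTheorem.
Variable R : realType.
Local Notation R2 := 'rV[R]_2.
Local Notation J := (@J R).
Local Notation B := (C1 R2 * C0 R2)%type.
Variables (U : set R2) (phi : R2 -> R).
Hypotheses (openU : open U) (sphi : smooth_on U phi).

Definition ends (b : B) : R2 * R2 := (b.1 0, prim2 b.2 1).

Lemma clinear_ends : clinear ends.
Proof.
apply: clinear_pair; first exact: clinear_at0.
exact: (clinear_comp (clinear_snd (C1 R2) (C0 R2))
  (clinear_comp (clinear_prim2 R) (clinear_C1_eval R2 1))).
Qed.

Lemma ends_sol x (P : C1 R2) : P 0 = 0 -> ends (sol phi x P) = (x, P 1).
Proof. by move=> P0; rewrite /ends sol_at0// prim2K. Qed.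

Lemma sol_lin_solution x (P : C1 R2) : P 0 = 0 ->
  (forall u : R, I01 u -> fibre U phi x (P u)) -> lin_solutions U phi (sol phi x P).
Proof.
move=> P0 PW; have bU : inU U (sol phi x P).
  by move=> u Iu; rewrite solE//; have [] := PW u Iu.
apply/(lin_solutionsP openU sphi); split; last exact: sol_defect.
split=> // u Iu; rewrite (holC_h openU sphi bU P0 Iu).
by have [] := PW u Iu.
Qed.

Lemma lin_solution_sol b : lin_solutions U phi b ->
  exists x (P : C1 R2), [/\ P 0 = 0, forall u : R, I01 u -> fibre U phi x (P u) & b = sol phi x P].
Proof.
move=> /(lin_solutionsP openU sphi)[[bU hp] d0].
have bE := defect0_sol d0; exists (b.1 0), (prim2 b.2).
have P0 := prim2_0 b.2; split=> // u Iu.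
rewrite bE in bU hp; have x0 := @sol_at0 R phi (b.1 0) _ P0.
split => /=.
- by have := bU 0 (I01_0 R); rewrite x0.
- by have := bU u Iu; rewrite solE.
- by have := hp u Iu; rewrite (holC_h openU sphi bU P0 Iu).
Qed.

Lemma derive0_cst01 (E : normedModType R) (f : R -> E) (l : E -> R) : clinear l ->
  {within I01, continuous f} ->
  (forall t : R, `]0, 1[%classic t -> is_derive t 1 f 0) -> l (f 1) = l (f 0).
Proof.
move=> cl cf df; apply: (@cst01 _ (l \o f)); last exact: I01_1.
  by apply: (cont01_comp_at cf) => t _; exact: cl.2.
move=> t t01; have := is_derive_clinear cl (df t t01).
by rewrite clinear0.
Qed.

Lemma derive0_R2R2 (f : R -> R2 * R2) : {within I01, continuous f} ->
  (forall t : R, `]0, 1[%classic t -> is_derive t 1 f 0) -> f 1 = f 0.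
Proof.
move=> cf df.
have h1 i : clinear (fun y : R2 * R2 => y.1 0 i).
  exact: (clinear_comp (clinear_fst R2 R2) (@clinear_coord R 1 i)).
have h2 i : clinear (fun y : R2 * R2 => y.2 0 i).
  exact: (clinear_comp (clinear_snd R2 R2) (@clinear_coord R 1 i)).
rewrite [LHS]surjective_pairing [RHS]surjective_pairing; congr pair; apply: R2_inj_coord => i.
  exact: (derive0_cst01 (h1 i) cf df).
exact: (derive0_cst01 (h2 i) cf df).
Qed.

Lemma path_continuous (E : normedModType R) (c : R -> E) :
  (forall t : R, I01 t -> derivable c t 1) -> {within I01, continuous c}.
Proof. by move=> dc; apply: derivable_within_continuous => t It; exact: dc. Qed.

(** A symmetry moves X(0) by a multiple of J e(0) = 0 and int E by e(1) - e(0) = 0. *)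
Lemma lin_joined_ends s s' : joined (lin_solutions U phi) (lin_symmetry phi) s s' ->
  ends s = ends s'.
Proof.
move=> [c [<- <- cP _]]; apply/esym.
apply: (@derive0_R2R2 (ends \o c)).
  apply: (cont01_comp_at (path_continuous _)) => t It; first by have [] := cP t It.
  exact: clinear_ends.2.
move=> t /I01_oo It; have [St dc symt] := cP t It.
have := is_derive_clinear clinear_ends (derivableP dc).
suff -> : ends ('D_1 c t) = 0 by [].
move: symt; case: (c t) => X E; case: ('D_1 c t) => dX dE [e [e0 e1] eP].
congr pair => /=.
  have [d1 d2 _] := eP 0 (I01_0 R).
  apply: R2_ext; rewrite mxE -/(comp1 (dX 0)) -/(comp2 (dX 0)) ?d1 ?d2 e0 /comp1 /comp2 mxE mulr0 ?oppr0//.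
have -> : dE = C1_deriv e by apply: C0_ext => u Iu; have [] := eP u Iu.
by rewrite prim2K.
Qed.

(** For fixed x, [sol] is affine in P, so a segment of curves is an affine path of solutions with
    constant velocity, the symmetry of Q - P. *)
Definition lin_segment (x : R2) (P Q : C1 R2) (t : R) : B :=
  sol phi x P + t *: (phi x *: C1map J (Q - P), C1_deriv (Q - P)).

Lemma lin_segmentE x (P Q : C1 R2) (t : R) :
  lin_segment x P Q t = sol phi x (P + t *: (Q - P)).
Proof.
have cJ := clinear_C1map (@clinear_J R).
have e1 : C1cst x + phi x *: C1map J P + t *: (phi x *: C1map J (Q - P))
    = C1cst x + phi x *: C1map J (P + t *: (Q - P)).
  rewrite -[in RHS](addrC (t *: (Q - P))) cJ.1 [in RHS]scalerDr [in RHS](addrC (phi x *: (t *: _))).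
  by rewrite addrA !scalerA mulrC.
have e2 : C1_deriv P + t *: C1_deriv (Q - P) = C1_deriv (P + t *: (Q - P)) by [].
by rewrite /lin_segment /sol -e1 -e2.
Qed.

Lemma lin_segment_solution x (P Q : C1 R2) (t : R) : straight (fibre U phi x) P Q ->
  I01 t -> lin_solutions U phi (lin_segment x P Q t).
Proof.
move=> [P0 Q0 PQ1 W] It; rewrite lin_segmentE; apply: sol_lin_solution.
  by rewrite C1D C1Z C1B P0 Q0 subrr scaler0 addr0.
by move=> u Iu; rewrite C1D C1Z C1B; exact: W.
Qed.

Lemma lin_symmetryZ s v a : lin_symmetry phi s v -> lin_symmetry phi s (a *: v).
Proof.
case: s => X E; case: v => dX dE [e [e0 e1] eP]; exists (a *: e).
  by split; rewrite C1Z ?e0 ?e1 scaler0.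
move=> u Iu; have [d1 d2 d3] := eP u Iu.
have z (v : R2) i : (a *: v) 0 i = a * v 0 i by rewrite mxE.
rewrite /comp1 /comp2 in d1 d2 *; split.
- by rewrite (C1Z a dX u) (C1Z a e u) !z d1 mulrN mulrCA.
- by rewrite (C1Z a dX u) (C1Z a e u) !z d2 mulrCA.
- by rewrite (C0Z a dE u) d3.
Qed.

Lemma lin_symmetry_J b (e : C1 R2) : C10 e ->
  lin_symmetry phi b (phi (b.1 0) *: C1map J e, C1_deriv e).
Proof.
case: b => X E e0; exists e => // u Iu.
have dX : (phi (X 0) *: C1map J e) u = phi (X 0) *: J (e u).
  by rewrite C1Z (C1mapE e (@clinear_J R) Iu).
have z (a : R) (v : R2) i : (a *: v) 0 i = a * v 0 i by rewrite mxE.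
have j0 : comp1 (phi (X 0) *: J (e u)) = - (phi (X 0) * comp2 (e u)).
  by rewrite /comp1 z JE0 mulrN.
have j1 : comp2 (phi (X 0) *: J (e u)) = phi (X 0) * comp1 (e u).
  by rewrite /comp2 z JE1.
split=> //; first by rewrite -j0 -dX.
by rewrite -j1 -dX.
Qed.

Lemma straight_lin_joined x (P Q : C1 R2) : straight (fibre U phi x) P Q ->
  joined (lin_solutions U phi) (lin_symmetry phi) (sol phi x P) (sol phi x Q).
Proof.
move=> PQ; have [P0 Q0 PQ1 _] := PQ.
pose v : B := (phi x *: C1map J (Q - P), C1_deriv (Q - P)).
have dc (t : R) : is_derive t 1 (lin_segment x P Q) v by exact: is_derive_affine.
have Dc (t : R) : 'D_1 (lin_segment x P Q) t = v by exact: (@derive_val _ _ _ _ _ _ _ (dc t)).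
have e0 : C10 (Q - P) by split; rewrite C1B ?P0 ?Q0 ?PQ1 subrr.
have x0 (t : R) : (lin_segment x P Q t).1 0 = x.
  by rewrite lin_segmentE; apply: sol_at0; rewrite C1D C1Z C1B P0 Q0 subrr scaler0 addr0.
exists (lin_segment x P Q); split.
- by rewrite lin_segmentE scale0r addr0.
- by rewrite lin_segmentE scale1r addrC subrK.
- move=> t It; split; first exact: lin_segment_solution.
    by have [] := dc t.
  by rewrite Dc; have := lin_symmetry_J (lin_segment x P Q t) e0; rewrite x0.
have -> : (fun t : R => 'D_1 (lin_segment x P Q) t) = cst v by exact/funext.
by move=> t; exact: cvg_cst.
Qed.

Lemma lin_section_path x (v1 : R2) (P L : C1 R2) : U x ->
  derivable (fun t : R => sol phi (x + t *: v1) (P + t *: L)) 0 1.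
Proof.
move=> Ux.
have dx := is_derive_affine x v1 (0 : R).
have dP := is_derive_affine P L (0 : R).
have dp : differentiable phi (x + (0 : R) *: v1).
  by rewrite scale0r addr0; exact: (smooth_differentiable sphi Ux).
have dphi := is_derive_comp_diff dx dp.
have dJ := is_derive_clinear (clinear_C1map (@clinear_J R)) dP.
have dC := is_derive_clinear (clinear_C1cst R) dx.
have dX := is_deriveD dC (is_derive_scale dphi dJ).
have dE := is_derive_clinear (clinear_C1_deriv R2) dP.
by have [] := is_derive_pair dX dE.
Qed.

(** Base point and curve move affinely, P by multiples of a C^1 curve from 0 to [v.2]. The form
    [sol] keeps the equation exact, and positivity of the holonomy persists for small t. *)
Lemma lin_section (s : B) (v : R2 * R2) : lin_solutions U phi s ->
  exists g : R -> B, [/\ g 0 = s, derivable g 0 1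
    & \forall t \near (0 : R), lin_solutions U phi (g t) /\ ends (g t) = ends s + t *: v].
Proof.
move=> /[dup] Ss /lin_solution_sol[x [P [P0 PW sE]]].
have Ux : U x by have [] := PW 0 (I01_0 R).
have [L [L0 L1 _]] : exists L : C1 R2, [/\ L 0 = 0, L 1 = v.2 & forall u : R, I01 u -> setT (L u)].
  have cf : {within I01, continuous (fun u : R => 0 + u *: v.2)}.
    by apply: continuous_subspaceT; exact: continuous_line.
  have [//|L [L0 L1 _]] := C1_curve openT cf.
  by exists L; rewrite L0 L1 scale0r addr0 scale1r add0r.
pose g (t : R) : B := sol phi (x + t *: v.1) (P + t *: L).
have g0 : g 0 = s by rewrite sE /g !scale0r !addr0.
have dg : derivable g 0 1 by exact: lin_section_path.
have PL0 (t : R) : (P + t *: L) 0 = 0 by rewrite C1D C1Z P0 L0 scaler0 addr0.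
exists g; split=> //.
have hpg : \forall t \near (0 : R), hol_pos U phi (g t).
  have := differentiable_continuous ((derivable1_diffP _ _).1 dg).
  apply; apply: open_nbhs_nbhs; split; first exact: open_hol_pos.
  by rewrite g0; have [] := (lin_solutionsP openU sphi s).1 Ss.
move: hpg; apply: filterS => t hpt; split.
  by apply/(lin_solutionsP openU sphi); split=> //; exact: sol_defect.
rewrite /g ends_sol// sE ends_sol// C1D C1Z L1.
by case: v {L L0 L1 g g0 dg PL0 hpt}.
Qed.

Hypothesis leafsc : forall x, U x -> simply_connected (leaf U phi x).

Lemma clos_joined (S : set B) (sym : B -> B -> Prop) (r : C1 R2 -> C1 R2 -> Prop)
    (f : C1 R2 -> B) (P Q : C1 R2) :
  (forall s v a, S s -> sym s v -> sym s (a *: v)) -> (forall s, S s -> exists v, sym s v) ->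
  (forall P Q, r P Q -> joined S sym (f P) (f Q)) ->
  S (f P) -> clos_refl_trans _ r P Q -> joined S sym (f P) (f Q).
Proof.
move=> symZ sym_ex rJ SP PQ.
(* Reflexive steps of the closure come without membership in [S], so equality is carried along and
   [joined_refl] is called only at [f P]. *)
have [<-|//] : f P = f Q \/ joined S sym (f P) (f Q).
  elim: PQ {SP} => [P1 P2 /rJ|P1|P1 P2 P3 _ [->//|J12] _ [<-|J23]]; [by right|by left|by right|].
  by right; exact: joined_trans J12 J23.
have [v fv] := sym_ex _ SP.
by apply: joined_refl => //; rewrite -(scale0r v); exact: symZ.
Qed.

Lemma lin_symmetry0 s : lin_symmetry phi s 0.
Proof.
have e0 : C10 (0 : C1 R2) by [].
by have := lin_symmetryZ 0 (lin_symmetry_J s e0); rewrite scale0r.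
Qed.

Lemma lin_joinedP s s' : lin_solutions U phi s -> lin_solutions U phi s' ->
  joined (lin_solutions U phi) (lin_symmetry phi) s s' <-> ends s = ends s'.
Proof.
move=> Ss Ss'; split; first exact: lin_joined_ends.
have [x [P [P0 PW sE]]] := lin_solution_sol Ss.
have [y [Q [Q0 QW s'E]]] := lin_solution_sol Ss'.
rewrite sE s'E !ends_sol// => -[xy PQ]; subst y.
have Ux : U x by have [] := PW 0 (I01_0 R).
have Sx : lin_solutions U phi (sol phi x P) by rewrite -sE.
have := fibre_chain openU sphi leafsc Ux P0 Q0 PQ PW QW.
apply: clos_joined => //.
- by move=> b v a _; exact: lin_symmetryZ.
- by move=> b _; exists 0; exact: lin_symmetry0.
- by move=> P1 P2; exact: straight_lin_joined.
Qed.

Lemma lin_ends_groupoid s : lin_solutions U phi s -> groupoid U phi (ends s).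
Proof.
move=> /lin_solution_sol[x [P [P0 PW ->]]]; rewrite ends_sol//.
have Ux : U x by have [] := PW 0 (I01_0 R).
have cP : {within I01, continuous P} by exact: (@C1_continuous _ _ P).
exact: (curve_groupoid Ux cP P0 PW).
Qed.

Lemma groupoid_lin_ends y : groupoid U phi y ->
  exists2 s, lin_solutions U phi s & ends s = y.
Proof.
case: y => x w gw; have [Ux [P [P0 P1 PW]]] := groupoid_C1_curve openU sphi leafsc gw.
exists (sol phi x P); first exact: sol_lin_solution.
by rewrite ends_sol// P1.
Qed.

Lemma lin_quotient :
  quotient_diffeomorphic_to (lin_solutions U phi) (lin_symmetry phi) (groupoid U phi).
Proof.
apply: (@quotient_diffeomorphic _ _ _ _ _ _ ends _ _ _ _ _ (R2 * C0 R2)%type (C0 R2) setT).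
- exact: R2R2_split.
- exact: open_groupoid.
- exact: lin_ends_groupoid.
- exact: groupoid_lin_ends.
- exact: lin_joinedP.
- move=> s /(lin_solutionsP openU sphi)[hs _]; exists (hol_pos U phi), (slice phi).
  by split=> //; exact: lin_slice_chart.
- by [].
- exact: smooth_lin clinear_ends.
- exact: lin_section.
Qed.

End LinTheorem.

(** * The original problem *)

Section TildeMap.
Variable R : realType.
Local Notation R2 := 'rV[R]_2.
Local Notation J := (@J R).
Local Notation B := (C1 R2 * C0 R2)%type.

Lemma cont01_expR (c : R -> R) : {within I01, continuous c} ->
  {within I01, continuous (fun s => expR (c s))}.
Proof. by move=> cc; apply: (cont01_comp_at cc) => t _; exact: continuous_expR. Qed.

Let del (i : 'I_2) (c : R) : R2 := c *: delta_mx 0 i.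
Let cdel i : clinear (del i). Proof. exact: clinear_scalel. Qed.
Let m (i : 'I_2) (q : R * R2) : R := q.1 *: (q.2 0 i : R^o).
Let sm i : smooth_on setT (m i).
Proof.
move=> k; apply: Ck_scale; first exact: openT.
  exact: Ck_lin (clinear_fst R R2).
exact: Ck_lin (clinear_comp (clinear_snd R R2) (@clinear_coord R 1 i)).
Qed.

(** Pointwise product, assembled from coordinates because [smooth_C0map] is about scalar
    functions. *)
Definition C0mul (p : C0 R * C0 R2) : C0 R2 :=
  C0map (del 0) (C0map (m 0) (C0pair p)) + C0map (del 1) (C0map (m 1) (C0pair p)).

Lemma C0mulE p (u : R) : I01 u -> C0mul p u = p.1 u *: p.2 u.
Proof.
move=> Iu; have mE i : C0map (m i) (C0pair p) u = p.1 u * p.2 u 0 i.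
  rewrite (C0mapE (smooth_continuous (@sm i)) _ Iu)//.
  by rewrite C0pairE.
rewrite /C0mul C0D (C0map_clinE _ (cdel 0) Iu) (C0map_clinE _ (cdel 1) Iu) !mE.
by rewrite [in RHS](R2_basis (p.2 u)) scalerDr !scalerA.
Qed.

Lemma smooth_C0mul : smooth_on setT C0mul.
Proof.
have s i : smooth_on setT (fun p : C0 R * C0 R2 => C0map (del i) (C0map (m i) (C0pair p))).
  apply: (smooth_comp (f := fun p : C0 R * C0 R2 => C0map (m i) (C0pair p)) (B := setT) openT) => //;
    last exact: smooth_lin (clinear_C0map (@cdel i)).
  apply: (smooth_comp openT _ (smooth_lin _ (clinear_C0pair R R2)) (smooth_C0map openT (@sm i))).
  by [].
by move=> k; apply: Ck_add; [exact: openT|exact: s|exact: s].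
Qed.

Variables (U : set R2) (phi : R2 -> R).
Hypotheses (openU : open U) (sphi : smooth_on U phi).

Lemma smooth_lift (k : B -> C0 R) (A : set B) : open A -> smooth_on A k ->
  smooth_on A (fun b : B => (b.1, C0mul (k b, b.2))).
Proof.
move=> oA sk; apply: smooth_pair => //; first exact: smooth_lin (clinear_fst _ _).
apply: (smooth_comp (f := fun b : B => (k b, b.2)) (B := setT) oA) => //; last exact: smooth_C0mul.
by apply: smooth_pair => //; exact: smooth_lin (clinear_snd _ _).
Qed.

Definition expC (b : B) : C0 R := C0map expR (C1val (prim (logd phi b))).

Lemma expCE b (u : R) : I01 u -> expC b u = expR (prim (logd phi b) u).
Proof. by move=> Iu; rewrite /expC (@C0mapE _ _ _ setT)// => x _; exact: continuous_expR. Qed.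

(* The change of variables E = K eta with K = exp(int dphi(J eta)); its inverse is
   eta = E / H since [H = K]. *)
Definition to_lin (b : B) : B := (b.1, C0mul (expC b, b.2)).

Definition of_lin (b : B) : B := (b.1, C0mul (C0map (fun r : R => r^-1) (holC phi b), b.2)).

Lemma smooth_to_lin : smooth_on (inU U) to_lin.
Proof.
have oU := open_inU openU; apply: smooth_lift => //.
have cl := clinear_comp (clinear_prim R) (@clinear_C1val R R).
have s1 : smooth_on (inU U) (fun b : B => C1val (prim (logd phi b))).
  exact: (smooth_comp (B := setT) oU (fun _ _ => I) (smooth_logd openU sphi) (smooth_lin _ cl)).
have s2 : smooth_on setT (@expR R) by move=> k; exact: Ck_expR.
by apply: (smooth_comp (B := [set X : C0 R | forall u : R, I01 u -> setT (X u)]) oU _ s1 (smooth_C0map openT s2)).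
Qed.

Lemma smooth_of_lin : smooth_on (hol_pos U phi) of_lin.
Proof.
have oH := open_hol_pos openU sphi; apply: smooth_lift => //.
have sH : smooth_on (hol_pos U phi) (holC phi).
  by apply: smooth_sub (smooth_holC openU sphi) => b [].
have s2 : smooth_on [set r : R | 0 < r] (fun r : R => r^-1).
  by move=> k; apply: Ck_inv; [exact: open_gt|move=> x /lt0r_neq0].
apply: (smooth_comp oH _ sH (smooth_C0map (@open_gt R 0) s2)).
by move=> b [].
Qed.

Lemma logd_mul (X : C1 R2) (k : C0 R) (E : C0 R2) (u : R) : inU U (X, E) -> I01 u ->
  logd phi (X, C0mul (k, E)) u = k u * logd phi (X, E) u.
Proof.
move=> bU Iu; rewrite (logdE openU sphi (b := (X, C0mul (k, E))) bU Iu).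
rewrite (logdE openU sphi bU Iu) -dphiJ_scale.
by rewrite -(C0mulE (k, E) Iu).
Qed.

(** With E = K eta, H' = dphi(J E) = K dphi(J eta) = K', and both are 1 at 0. In particular
    positivity is automatic on the image. *)
Lemma holC_to_lin b : inU U b -> holC phi (to_lin b) = expC b.
Proof.
move=> bU; apply: C0_ext => u Iu; rewrite (holCE _ _ Iu) (expCE _ Iu).
pose g (v : R) := 1 + prim (logd phi (to_lin b)) v - expR (prim (logd phi b) v).
have cg : {within I01, continuous g}.
  move=> v; apply: cvgB; last exact: (cont01_expR (@C1_continuous _ _ _)).
  by apply: cvgD; [exact: cvg_cst|exact: (@C1_continuous _ _ (prim _))].
have dg (v : R) : `]0, 1[%classic v -> is_derive v 1 g 0.
  move=> v01; have Iv := I01_oo v01.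
  have h1 := C1_is_derive (prim (logd phi (to_lin b))) v01.
  have h2 := is_derive_expR_comp (C1_is_derive (prim (logd phi b)) v01).
  have h3 := is_deriveB (is_deriveD (is_derive_cst (1 : R) v 1) h1) h2.
  apply: (is_derive_eq h3); rewrite !prim_deriv add0r.
  have e : logd phi (to_lin b) v = expC b v * logd phi b v.
    by case: b bU {g cg h1 h2 h3} => X E bU; exact: logd_mul.
  by rewrite e (expCE _ Iv) subrr.
have := cst01 cg dg Iu; rewrite /g !prim0 expR0 addr0 subrr => /subr0_eq; exact.
Qed.

Lemma to_lin_hol_pos b : inU U b -> hol_pos U phi (to_lin b).
Proof.
move=> bU; split=> // u Iu.
by rewrite (holC_to_lin bU) (expCE _ Iu) expR_gt0.
Qed.

Lemma invCE b (u : R) : hol_pos U phi b -> I01 u ->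
  C0map (fun r : R => r^-1) (holC phi b) u = (holC phi b u)^-1.
Proof.
move=> [bU hp] Iu; apply: (@C0mapE _ _ _ [set r : R | 0 < r]) => // x /lt0r_neq0 x0.
exact: inv_continuous.
Qed.

Lemma of_linE b (u : R) : hol_pos U phi b -> I01 u ->
  (of_lin b).2 u = (holC phi b u)^-1 *: b.2 u.
Proof. move=> hb Iu; rewrite -(invCE hb Iu).
exact: (C0mulE (C0map (fun r : R => r^-1) (holC phi b), b.2) Iu). Qed.

Lemma to_linE b (u : R) : I01 u ->
  (to_lin b).2 u = expR (prim (logd phi b) u) *: b.2 u.
Proof. by move=> Iu; rewrite -(expCE _ Iu); exact: (C0mulE (expC b, b.2) Iu). Qed.

Lemma to_linK b : inU U b -> of_lin (to_lin b) = b.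
Proof.
move=> bU; have hb := to_lin_hol_pos bU.
rewrite [RHS]surjective_pairing [LHS]surjective_pairing; congr pair.
apply: C0_ext => u Iu; rewrite (of_linE hb Iu) (holC_to_lin bU) (to_linE _ Iu) (expCE _ Iu).
by rewrite scalerA mulVf ?scale1r// gt_eqF// expR_gt0.
Qed.

(** With eta = E / H, dphi(J eta) = H' / H is the logarithmic derivative of H; instead of a
    logarithm, H exp(- int dphi(J eta)) is shown to be constant. *)
Lemma expC_of_lin b (u : R) : hol_pos U phi b -> I01 u ->
  expR (prim (logd phi (of_lin b)) u) = holC phi b u.
Proof.
move=> hb Iu; have [bU hp] := hb.
pose g (v : R) := (1 + prim (logd phi b) v) * expR (0 - prim (logd phi (of_lin b)) v).
have cg : {within I01, continuous g}.
  have ce : {within I01, continuous (fun v : R => expR (0 - prim (logd phi (of_lin b)) v))}.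
    by apply: cont01_expR => v; apply: cvgB; [exact: cvg_cst|exact: (@C1_continuous _ _ (prim _))].
  move=> v; apply: cvgM; last exact: ce.
  by apply: cvgD; [exact: cvg_cst|exact: (@C1_continuous _ _ (prim _))].
have dg (v : R) : `]0, 1[%classic v -> is_derive v 1 g 0.
  move=> v01; have Iv := I01_oo v01.
  have h1 : is_derive v 1 (fun s : R => 1 + prim (logd phi b) s) (logd phi b v).
    apply: (is_derive_eq (is_deriveD (is_derive_cst (1 : R) v 1) (C1_is_derive (prim (logd phi b)) v01))).
    by rewrite add0r (prim_deriv (logd phi b)).
  have h2 : is_derive v 1 (fun s : R => 0 - prim (logd phi (of_lin b)) s) (- logd phi (of_lin b) v).
    apply: (is_derive_eq (is_deriveB (is_derive_cst (0 : R) v 1) (C1_is_derive (prim (logd phi (of_lin b))) v01))).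
    by rewrite sub0r (prim_deriv (logd phi (of_lin b))).
  have h3 := is_derive_scale h1 (is_derive_expR_comp h2).
  apply: (is_derive_eq h3).
  have e : logd phi (of_lin b) v = (holC phi b v)^-1 * logd phi b v.
    by rewrite -(invCE hb Iv); case: b bU {g cg h1 h2 h3 hb hp} => X E bU; exact: logd_mul.
  have n0 : holC phi b v != 0 by rewrite gt_eqF// hp.
  rewrite -(holCE _ _ Iv) /GRing.scale/= e mulrN mulrN mulrCA (mulrA (holC phi b v)) divff// mul1r.
  by rewrite mulrC subrr.
have := cst01 cg dg Iu; rewrite /g !prim0 subrr expR0 addr0 mulr1 sub0r expRN -(holCE _ _ Iu).
by move=> /divr1_eq ->.
Qed.

Lemma of_linK b : hol_pos U phi b -> to_lin (of_lin b) = b.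
Proof.
move=> hb; rewrite [RHS]surjective_pairing [LHS]surjective_pairing; congr pair.
apply: C0_ext => u Iu; rewrite (to_linE _ Iu) (expC_of_lin hb Iu) (of_linE hb Iu).
by rewrite scalerA divff ?scale1r// gt_eqF//; exact: hb.2.
Qed.

End TildeMap.

(** * Correspondence of the two sets of solutions *)

Section TildeSolutions.
Variable R : realType.
Local Notation R2 := 'rV[R]_2.
Local Notation J := (@J R).
Local Notation B := (C1 R2 * C0 R2)%type.
Variables (U : set R2) (phi : R2 -> R).
Hypotheses (openU : open U) (sphi : smooth_on U phi).

Lemma solutionsE b : solutions U phi b <->
  inU U b /\ forall u : R, I01 u -> C1_deriv b.1 u = phi (b.1 u) *: J (b.2 u).
Proof.
have z (a : R) (v : R2) i : (a *: v) 0 i = a * v 0 i by rewrite mxE.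
case: b => X E; split.
  move=> H; split=> [u Iu|u Iu]; have [Uu e1 e2] := H u Iu; first exact: Uu.
  apply: R2_ext; rewrite z ?JE0 ?JE1 /=.
    by rewrite mulrN; apply/eqP; rewrite -addr_eq0; apply/eqP.
  exact: subr0_eq.
move=> [bU dX] u Iu; have := dX u Iu; rewrite /= => dXu; split; first exact: bU.
- by rewrite dXu /comp1 /comp2 z JE0 mulrN addNr.
- by rewrite dXu /comp1 /comp2 z JE1 subrr.
Qed.

Lemma phi_continuous (b : B) : inU U b -> {within I01, continuous (fun v : R => phi (b.1 v))}.
Proof.
move=> bU; apply: (cont01_comp_at (@C1_continuous _ _ b.1)) => t It.
exact/(smooth_continuous sphi)/bU.
Qed.

Lemma phi_is_derive (b : B) (v : R) : inU U b -> `]0, 1[%classic v ->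
  is_derive v 1 (fun v : R => phi (b.1 v)) ('d phi (b.1 v) (C1_deriv b.1 v)).
Proof.
move=> bU v01; exact: (is_derive_comp_diff (C1_is_derive b.1 v01) (smooth_differentiable sphi (bU v (I01_oo v01)))).
Qed.

(** X' carries the factor phi(X), so f = phi(X) solves f' = dphi(J eta) f. Hence X' = phi(X(0)) J (K
    eta), the linearized equation. *)
Lemma phi_solution b (u : R) : solutions U phi b -> I01 u ->
  phi (b.1 u) = phi (b.1 0) * expR (prim (logd phi b) u).
Proof.
move=> /solutionsE[bU dX] Iu.
pose g (v : R) := phi (b.1 v) * expR (0 - prim (logd phi b) v).
have ce : {within I01, continuous (fun v : R => expR (0 - prim (logd phi b) v))}.
  by apply: cont01_expR => v; apply: cvgB; [exact: cvg_cst|exact: (@C1_continuous _ _ (prim _))].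
have cg : {within I01, continuous g}.
  by move=> v; apply: cvgM; [exact: phi_continuous|exact: ce].
have dg (v : R) : `]0, 1[%classic v -> is_derive v 1 g 0.
  move=> v01; have Iv := I01_oo v01.
  have h2 : is_derive v 1 (fun s : R => 0 - prim (logd phi b) s) (- logd phi b v).
    apply: (is_derive_eq (is_deriveB (is_derive_cst (0 : R) v 1) (C1_is_derive (prim (logd phi b)) v01))).
    by rewrite sub0r (prim_deriv (logd phi b)).
  apply: (is_derive_eq (is_derive_scale (phi_is_derive bU v01) (is_derive_expR_comp h2))).
  rewrite (dX v Iv) linearZ (logdE openU sphi bU Iv) /dphiJ /GRing.scale/=.
  by rewrite !mulrN [X in _ - X]mulrCA mulrC subrr.
have := cst01 cg dg Iu; rewrite /g prim0 subrr expR0 mulr1 sub0r expRN => <-.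
by rewrite mulrVK// unitfE gt_eqF// expR_gt0.
Qed.

(** The same identity from the other side, where only X' = phi(X(0)) K J eta is known: then phi(X)
    and phi(X(0)) K have equal derivatives. *)
Lemma phi_lin_solution b (u : R) : inU U b -> defect phi (to_lin phi b) = 0 -> I01 u ->
  phi (b.1 u) = phi (b.1 0) * expR (prim (logd phi b) u).
Proof.
move=> bU /subr0_eq d0 Iu; apply/subr0_eq.
have dX (v : R) : I01 v -> C1_deriv b.1 v = (phi (b.1 0) * expR (prim (logd phi b) v)) *: J (b.2 v).
  move=> Iv; rewrite [C1_deriv b.1]d0 C0Z (C0map_clinE _ (@clinear_J R) Iv).
  by rewrite (to_linE _ _ Iv) JZ scalerA.
pose g (v : R) := phi (b.1 v) - phi (b.1 0) * expR (prim (logd phi b) v).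
have cg : {within I01, continuous g}.
  move=> v; apply: cvgB; first exact: phi_continuous.
  by apply: cvgM; [exact: cvg_cst|exact: (cont01_expR (@C1_continuous _ _ _))].
have dg (v : R) : `]0, 1[%classic v -> is_derive v 1 g 0.
  move=> v01; have Iv := I01_oo v01.
  have h2 := is_derive_expR_comp (C1_is_derive (prim (logd phi b)) v01).
  have h3 := is_derive_scale (is_derive_cst (phi (b.1 0)) v 1) h2.
  apply: (is_derive_eq (is_deriveB (phi_is_derive bU v01) h3)).
  rewrite (dX v Iv) linearZ (prim_deriv (logd phi b)) (logdE openU sphi bU Iv) /dphiJ /GRing.scale/=.
  by rewrite mul0r add0r mulrA subrr.
by have := cst01 cg dg Iu; rewrite /g prim0 expR0 mulr1 subrr.
Qed.

Lemma solutionsP b : solutions U phi b <-> inU U b /\ defect phi (to_lin phi b) = 0.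
Proof.
have key (u : R) : I01 u -> (phi (b.1 0) *: C0map J (to_lin phi b).2) u
    = (phi (b.1 0) * expR (prim (logd phi b) u)) *: J (b.2 u).
  move=> Iu; rewrite C0Z (C0map_clinE _ (@clinear_J R) Iu).
  by rewrite (to_linE _ _ Iu) JZ scalerA.
split.
  move=> Sb; have [bU dX] := (solutionsE b).1 Sb; split=> //.
  apply/eqP; rewrite subr_eq0; apply/eqP; apply: C0_ext => u Iu.
  by rewrite [RHS]key// -(phi_solution Sb Iu) -dX.
move=> [bU d0]; apply/solutionsE; split=> // u Iu.
rewrite (phi_lin_solution bU d0 Iu) -key//.
by have /subr0_eq := d0; move=> /(congr1 (fun f : C0 R2 => f u)).
Qed.

Lemma solutions_lin b : solutions U phi b <-> inU U b /\ lin_solutions U phi (to_lin phi b).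
Proof.
split=> [/solutionsP[bU d0]|[bU /(lin_solutionsP openU sphi)[_ d0]]].
  by split=> //; apply/(lin_solutionsP openU sphi); split=> //; exact: to_lin_hol_pos.
by apply/solutionsP.
Qed.

Lemma of_lin_solution b : lin_solutions U phi b -> solutions U phi (of_lin phi b).
Proof.
move=> Sb; have [hb _] := (lin_solutionsP openU sphi b).1 Sb.
by apply/solutions_lin; rewrite (of_linK openU sphi hb); split=> //; have [] := hb.
Qed.

Lemma to_lin_image : to_lin phi @` inU U = hol_pos U phi.
Proof.
apply/seteqP; split=> [_ [b bU <-]|b hb]; first exact: to_lin_hol_pos.
by exists (of_lin phi b); [have [] := hb|exact: (of_linK openU sphi hb)].
Qed.

Lemma slice_chart_to_lin :
  slice_chart (solutions U phi) (inU U) (slice phi \o to_lin phi).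
Proof.
have [oH oim ss [psi' spsi' psiK] SP] := lin_slice_chart openU sphi.
have oU := open_inU openU.
have tH b : inU U b -> hol_pos U phi (to_lin phi b) by exact: to_lin_hol_pos.
have imE : (slice phi \o to_lin phi) @` inU U = slice phi @` hol_pos U phi.
  by rewrite -image_comp to_lin_image.
split=> //.
- by rewrite imE.
- exact: (smooth_comp oU tH (smooth_to_lin openU sphi) ss).
- exists (of_lin phi \o psi').
    rewrite imE; apply: (smooth_comp oim _ spsi' (smooth_of_lin openU sphi)).
    by move=> _ [b hb <-]; rewrite psiK.
  by move=> b bU /=; rewrite psiK ?(to_linK openU sphi bU)//; exact: tH.
move=> b bU; split=> [/solutionsP[]//|d0].
by apply/solutionsP.
Qed.

Lemma smooth_ends_to_lin : smooth_on (inU U) (@ends R \o to_lin phi).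
Proof.
exact: (smooth_comp (B := setT) (open_inU openU) (fun _ _ => I) (smooth_to_lin openU sphi)
  (smooth_lin _ (clinear_ends R))).
Qed.

Lemma tilde_section (s : B) (v : R2 * R2) : solutions U phi s ->
  exists g : R -> B, [/\ g 0 = s, derivable g 0 1
    & \forall t \near (0 : R), solutions U phi (g t) /\
        (@ends R \o to_lin phi) (g t) = (@ends R \o to_lin phi) s + t *: v].
Proof.
move=> /solutions_lin[sU Ss]; have [g [g0 dg gP]] := lin_section openU sphi v Ss.
exists (of_lin phi \o g); split.
- by rewrite /= g0 (to_linK openU sphi sU).
- have dO : differentiable (of_lin phi) (g 0).
    apply: (smooth_differentiable (smooth_of_lin openU sphi)); rewrite g0.
    exact: to_lin_hol_pos.
  by have [] := is_derive_comp_diff (derivableP dg) dO.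
apply: filterS gP => t [St gE]; split; first exact: of_lin_solution.
have [hg _] := (lin_solutionsP openU sphi (g t)).1 St.
by rewrite /= (of_linK openU sphi hg).
Qed.

End TildeSolutions.

(** * Invariance of the coordinate along paths of symmetries *)

Section TildeJoined.
Variable R : realType.
Local Notation R2 := 'rV[R]_2.
Local Notation J := (@J R).
Local Notation B := (C1 R2 * C0 R2)%type.
Variables (U : set R2) (phi : R2 -> R).
Hypotheses (openU : open U) (sphi : smooth_on U phi).

Let z (a : R) (v : R2) i : (a *: v) 0 i = a * v 0 i. Proof. by rewrite mxE. Qed.

(** The planar identity dphi(J v) w - dphi(J w) v = (v1 w2 - v2 w1) grad phi, which removes partial
    derivatives from the symmetries. *)
Lemma dphiJ_cross x (v w : R2) i : U x ->
  (dphiJ phi (x, v) *: w) 0 i = (dphiJ phi (x, w) *: v) 0 i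
    + partial i phi x * (comp1 v * comp2 w - comp2 v * comp1 w).
Proof.
move=> Ux; rewrite !z /dphiJ/= !(diff_J _ (smooth_differentiable sphi Ux)) /comp1 /comp2.
by case: (ord2P i) => ->; move: (partial 0 phi x) (partial 1 phi x) => a b;
  clear; ring.
Qed.

Lemma symmetryP b v : inU U b -> symmetry phi b v <->
  exists2 e : C1 R2, C10 e & forall u : R, I01 u ->
    v.1 u = phi (b.1 u) *: J (e u) /\
    v.2 u = C1_deriv e u + (dphiJ phi (b.1 u, b.2 u) *: e u - dphiJ phi (b.1 u, e u) *: b.2 u).
Proof.
case: b => X E; case: v => dX dE /= bU.
have vE (v w : R2) u i : I01 u ->
    (dphiJ phi (X u, v) *: w - dphiJ phi (X u, w) *: v) 0 i
    = partial i phi (X u) * (comp1 v * comp2 w - comp2 v * comp1 w).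
  move=> Iu; rewrite mxE [X in _ + X]mxE (dphiJ_cross v w i (bU u Iu)).
  by rewrite addrAC subrr add0r.
split=> -[e e0 eP]; exists e => // u Iu.
  have [d1 d2 d3] := eP u Iu; split.
    apply: R2_ext; rewrite z ?JE0 ?JE1; last exact: d2.
    by rewrite mulrN; exact: d1.
  by apply: R2_inj_coord => i; rewrite d3 mxE vE.
have [d1 d2] := eP u Iu; split.
- by rewrite d1 /comp1 z JE0 mulrN.
- by rewrite d1 /comp2 z JE1.
- by move=> i; rewrite d2 mxE vE.
Qed.

Lemma derive0_R2 (f : R -> R2) : {within I01, continuous f} ->
  (forall t : R, `]0, 1[%classic t -> is_derive t 1 f 0) ->
  forall t : R, I01 t -> f t = f 0.
Proof.
move=> cf df t It; apply: R2_inj_coord => i; have cl := @clinear_coord R 1 i.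
apply: (@cst01 _ (fun t => f t 0 i) _ _ t It).
  by apply: (cont01_comp_at (f := fun v : R2 => v 0 i) cf) => s _; exact: cl.2.
move=> s s01; apply: (is_derive_eq (is_derive_clinear cl (df s s01))); exact: clinear0 cl.
Qed.

Lemma solution_phi0 b : solutions U phi b -> phi (b.1 0) = 0 -> b.1 = C1cst (b.1 0).
Proof.
move=> Sb p0; have [bU dX] := (solutionsE U phi b).1 Sb.
apply: C1_inj0_R2; last by rewrite (C1cstE _ (I01_0 R)).
rewrite C1cst_deriv; apply: C0_ext => u Iu.
by rewrite (dX u Iu) (phi_solution openU sphi Sb Iu) p0 mul0r scale0r.
Qed.

Lemma ends_phi_neq0 b : solutions U phi b -> phi (b.1 0) != 0 ->
  ends (to_lin phi b) = (b.1 0, unx phi (b.1 0) (b.1 1)).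
Proof.
move=> /(solutionsP openU sphi)[bU d0] px; have bE := defect0_sol d0.
congr pair; set P := prim2 (to_lin phi b).2.
have -> : b.1 1 = x_f phi (b.1 0, P 1).
  rewrite -(solE phi _ P (I01_1 R)); exact: (congr1 (fun c : B => c.1 1) bE).
by rewrite unx_x_f.
Qed.

Variables (c : R -> B).
Hypothesis cP : forall t : R, I01 t ->
  [/\ solutions U phi (c t), derivable c t 1 & symmetry phi (c t) ('D_1 c t)].

Let cU t : I01 t -> inU U (c t).
Proof. by move=> It; have [/(solutionsE U phi)[]] := cP It. Qed.

Let cc : {within I01, continuous c}.
Proof. by apply: path_continuous => t It; have [] := cP It. Qed.

(** X(u) moves by phi(X(u)) J beta(u), and beta vanishes at both ends. *)
Lemma path_end_cst (u t : R) : u = 0 \/ u = 1 -> I01 t -> (c t).1 u = (c 0).1 u.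
Proof.
move=> u01; have cl := clinear_comp (clinear_fst (C1 R2) (C0 R2)) (clinear_C1_eval R2 u).
have Iu : I01 u by case: u01 => ->; [exact: I01_0|exact: I01_1].
apply: (@derive0_R2 (fun t => (c t).1 u)).
  by apply: (cont01_comp_at (f := fun b : B => b.1 u) cc) => s _; exact: cl.2.
move=> s /I01_oo Is; have [_ dc /(symmetryP _ (cU Is))[e [e0 e1] eP]] := cP Is.
apply: (is_derive_eq (is_derive_clinear cl (derivableP dc))).
apply: etrans (eP u Iu).1 _; have -> : e u = 0 by case: u01 => ->.
by rewrite J0 scaler0.
Qed.

Hypothesis phi0 : phi ((c 0).1 0) = 0.
Let x := (c 0).1 0.
Let l (v : R2) : R := 'd phi x (J v).

Let Ux : U x. Proof. exact: (cU (I01_0 R) (I01_0 R)). Qed.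
Let cl : clinear l. Proof. exact: clinear_diffJ. Qed.

Let c1E t : I01 t -> (c t).1 = C1cst x.
Proof.
move=> It; have [St _ _] := cP It; have c0 := path_end_cst (or_introl erefl) It.
by rewrite (solution_phi0 St) c0.
Qed.

Let logd_cE t : I01 t -> logd phi (c t) = C0map l (c t).2.
Proof.
move=> It; apply: C0_ext => u Iu.
by rewrite (logdE openU sphi (cU It) Iu) (c1E It) (C1cstE _ Iu) (C0map_clinE _ cl Iu).
Qed.

(* At a zero of [phi], [X] is constant and an infinitesimal symmetry [beta] changes [E] by the
   derivative of [K beta], whose integral over [0, 1] vanishes. *)
Lemma path_ends_phi0 : {within I01, continuous (@ends R \o to_lin phi \o c)} /\
  forall t : R, `]0, 1[%classic t -> is_derive t 1 (@ends R \o to_lin phi \o c) 0.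
Proof.
have sT := smooth_to_lin openU sphi.
split.
  apply: (cont01_comp_at cc) => t It.
  exact: (smooth_continuous (smooth_ends_to_lin openU sphi) (cU It)).
move=> t t01; have It := I01_oo t01.
have [St dc /(symmetryP _ (cU It))[e [e0 e1] eP]] := cP It.
have DT := is_derive_comp_diff (derivableP dc) (smooth_differentiable sT (cU It)).
set D := 'd _ _ _ in DT; set w := 'D_1 c t in D DT eP.
have := is_derive_clinear (clinear_ends R) DT.
suff -> : ends D = 0 by [].
have D1 : D.1 0 = 0.
  have h1 := is_derive_clinear (clinear_at0 R) DT.
  have h2 := is_derive_clinear (clinear_at0 R) (derivableP dc).
  have [_ e2] := h1; have [_ e3] := h2.
  transitivity (w.1 0); first by rewrite -e2 -e3.
  by apply: etrans (eP 0 (I01_0 R)).1 _; rewrite e0 J0 scaler0.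
pose f := prim (C0map l (c t).2).
(* The velocity of eta is e' + l(eta) e - l(e) eta; under l the last two terms cancel, leaving
   l(e'). *)
have lw : prim (C0map l w.2) = C1map l e.
  rewrite -(prim_C0map cl e0); congr prim; apply: C0_ext => u Iu.
  rewrite !(C0map_clinE _ cl Iu) (eP u Iu).2 (c1E It) (C1cstE _ Iu).
  have lD (a b : R2) : l (a + b) = l a + l b by rewrite /l JD linearD.
  rewrite lD (clinearB _ _ cl) !(clinearZ _ _ cl).
  have -> : dphiJ phi (x, e u) *: l ((c t).2 u) = dphiJ phi (x, (c t).2 u) *: l (e u).
    by rewrite /GRing.scale/= mulrC.
  by rewrite subrr addr0.
(* The differential of the substitution is identified only at each u, as the derivative of one
   function of s computed in two ways. *)
have D2 u : I01 u -> D.2 u = expR (f u) *: (l ((c t).2 u) *: e u + C1_deriv e u).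
  move=> Iu.
  have cs := clinear_snd (C1 R2) (C0 R2).
  have h1 : is_derive t 1 (fun s : R => (to_lin phi (c s)).2 u) (D.2 u).
    exact: (is_derive_clinear (clinear_comp cs (clinear_C0_eval R2 u)) DT).
  have k1 : is_derive t 1 (fun s : R => (c s).2 u) (w.2 u).
    exact: (is_derive_clinear (clinear_comp cs (clinear_C0_eval R2 u)) (derivableP dc)).
  have k2 : is_derive t 1 (fun s : R => prim (C0map l (c s).2) u) (C1map l e u).
    rewrite -lw; exact: (is_derive_clinear (clinear_comp (clinear_comp cs (clinear_C0map cl))
      (clinear_comp (clinear_prim R) (clinear_C1_eval R u))) (derivableP dc)).
  have h2 := is_derive_scale (is_derive_expR_comp k2) k1.
  have h3 : is_derive t 1 (fun s : R => (to_lin phi (c s)).2 u)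
      ((expR (f u) * C1map l e u) *: (c t).2 u + expR (f u) *: w.2 u).
    apply: (near_eq_is_derive _ h2).
    have := near_oo t01; apply: filterS => s /I01_oo Is.
    by rewrite (to_linE _ _ Iu) -(logd_cE Is).
  have -> : D.2 u = (expR (f u) * C1map l e u) *: (c t).2 u + expR (f u) *: w.2 u.
    have [_ <-] := h1; have [_ <-] := h3; reflexivity.
  have -> : w.2 u = C1_deriv e u + (l ((c t).2 u) *: e u - l (e u) *: (c t).2 u).
    by rewrite (eP u Iu).2 (c1E It) (C1cstE _ Iu).
  rewrite (C1mapE e cl Iu : C1map l e u = l (e u)) -scalerA -scalerDr; congr (_ *: _).
  by rewrite addrC -addrA subrK addrC.
have cf : {within I01, continuous (fun u : R => expR (f u) *: e u)}.
  move=> u; apply: cvgZ; first exact: (cont01_expR (@C1_continuous _ _ _)).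
  exact: (@C1_continuous _ _ e).
have df (u : R) : `]0, 1[%classic u -> is_derive u 1 (fun u : R => expR (f u) *: e u) (D.2 u).
  move=> u01; have Iu := I01_oo u01; rewrite (D2 u Iu).
  apply: (is_derive_eq (is_derive_scale (is_derive_expR_comp (C1_is_derive f u01)) (C1_is_derive e u01))).
  rewrite /f (prim_deriv (C0map l (c t).2)) (C0map_clinE _ cl Iu).
  by rewrite -scalerA -scalerDr.
pose W := C1of (fun u : R => expR (f u) *: e u) D.2.
have W0 : W 0 = 0 by rewrite /W (C1ofE cf df (I01_0 R)) e0 scaler0.
have W1 : W 1 = 0 by rewrite /W (C1ofE cf df (I01_1 R)) e1 scaler0.
rewrite /ends D1 -(C1of_deriv cf df); congr pair.
by rewrite -/W (prim2K W0).
Qed.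

End TildeJoined.

(** * Classes of solutions of the original problem *)

Section TildeTheorem.
Variable R : realType.
Local Notation R2 := 'rV[R]_2.
Local Notation J := (@J R).
Local Notation B := (C1 R2 * C0 R2)%type.
Variables (U : set R2) (phi : R2 -> R).
Hypotheses (openU : open U) (sphi : smooth_on U phi).

(** Off the zeros of phi the preserved points X(0) and X(1) determine [ends]. At a zero they
    coincide and carry no information on eta, hence the separate derivative computation. *)
Lemma tilde_joined_ends s s' : joined (solutions U phi) (symmetry phi) s s' ->
  ends (to_lin phi s) = ends (to_lin phi s').
Proof.
move=> [c [<- <- cP _]].
have S0 : solutions U phi (c 0) by have [] := cP 0 (I01_0 R).
have S1 : solutions U phi (c 1) by have [] := cP 1 (I01_1 R).
have [p0|p0] := eqVneq (phi ((c 0).1 0)) 0.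
  have [cf df] := path_ends_phi0 openU sphi cP p0.
  exact/esym/(derive0_R2R2 cf df).
have c0 := path_end_cst sphi cP (or_introl erefl) (I01_1 R).
have c1 := path_end_cst sphi cP (or_intror erefl) (I01_1 R).
rewrite (ends_phi_neq0 openU sphi S0 p0) (ends_phi_neq0 openU sphi S1); last by rewrite c0.
by rewrite c0 c1.
Qed.

Lemma symmetryZ s v a : solutions U phi s -> symmetry phi s v -> symmetry phi s (a *: v).
Proof.
move=> /(solutionsE U phi)[sU _] /(symmetryP sphi _ sU)[e [e0 e1] eP].
apply/(symmetryP sphi _ sU); exists (a *: e).
  by split; rewrite C1Z ?e0 ?e1 scaler0.
move=> u Iu; have [d1 d2] := eP u Iu; split.
  transitivity (a *: v.1 u) => //; rewrite d1 C1Z JZ !scalerA.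
  by rewrite mulrC.
transitivity (a *: v.2 u) => //; rewrite d2 C1Z.
transitivity (a *: C1_deriv e u + (dphiJ phi (s.1 u, s.2 u) *: (a *: e u)
  - dphiJ phi (s.1 u, a *: e u) *: s.2 u)) => //.
by rewrite dphiJ_scale !scalerDr scalerN !scalerA [dphiJ _ _ * a]mulrC.
Qed.

Lemma symmetry0 s : solutions U phi s -> exists v, symmetry phi s v.
Proof.
move=> /(solutionsE U phi)[sU _]; exists 0.
apply/(symmetryP sphi _ sU); exists 0; first by [].
move=> u Iu; split; first by rewrite [RHS](_ : _ = phi (s.1 u) *: J 0)// J0 scaler0.
transitivity (0 + (dphiJ phi (s.1 u, s.2 u) *: (0 : R2) - dphiJ phi (s.1 u, 0 *: 0) *: s.2 u)); last by rewrite scale0r.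
by rewrite dphiJ_scale mul0r scale0r scaler0 subrr addr0.
Qed.

Lemma invr_scale_derive (V : lmodType R) (h l : R) (f g : V) :
  (- h ^- 2 *: (l : R^o)) *: f + h^-1 *: g = h^-1 *: g - (h^-1 * h^-1 * l) *: f.
Proof.
rewrite addrC; congr (_ + _); rewrite -scaleNr; congr (_ *: _).
by rewrite scaleNr expr2 invfM.
Qed.

(** With k = 1/H, a = dphi(J E) and b = dphi(J e), the left side is the velocity of E/H and the
    right side the symmetry generated by e/H. *)
Lemma symmetry_algebra (V : lmodType R) (k a b : R) (e' e E : V) :
  k *: e' - (k * k * b) *: E
  = k *: e' - (k * k * a) *: e + ((k * a) *: (k *: e) - (k * b) *: (k *: E)).
Proof.
rewrite -addrA; congr (_ + _); rewrite !scalerA addrA.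
by rewrite ![k * _ * k]mulrAC addNr add0r.
Qed.

Section Straight.
Variables (x : R2) (P Q : C1 R2).
Hypothesis PQ : straight (fibre U phi x) P Q.
Let e : C1 R2 := Q - P.
Let seg := lin_segment phi x P Q.
Let v : B := (phi x *: C1map J e, C1_deriv e).

Let P0 : P 0 = 0. Proof. by have [] := PQ. Qed.
Let Q0 : Q 0 = 0. Proof. by have [] := PQ. Qed.

Let Pt0 (t : R) : (P + t *: e) 0 = 0.
Proof. by rewrite C1D C1Z C1B P0 Q0 subrr scaler0 addr0. Qed.

Let segE (t : R) : seg t = sol phi x (P + t *: e).
Proof. exact: lin_segmentE. Qed.

Let dseg (t : R) : is_derive t 1 seg v.
Proof. exact: is_derive_affine. Qed.

Let Sseg (t : R) : I01 t -> lin_solutions U phi (seg t).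
Proof. exact: lin_segment_solution. Qed.

Let hseg (t : R) : I01 t -> hol_pos U phi (seg t).
Proof. by move=> /Sseg /(lin_solutionsP openU sphi)[]. Qed.

Let Ux : U x.
Proof. by have [_ _ _ W] := PQ; have [] := W 0 0 (I01_0 R) (I01_0 R). Qed.

Let seg1 (t u : R) : I01 u -> (seg t).1 u = x + phi x *: J ((P + t *: e) u).
Proof. by move=> Iu; rewrite segE (solE _ _ _ Iu) x_fE. Qed.

Let holC_seg (t u : R) : I01 u -> hol_pos U phi (seg t) ->
  holC phi (seg t) u = h phi (x, (P + t *: e) u).
Proof. by move=> Iu [sU _]; move: sU; rewrite segE => sU; exact: (holC_h openU sphi sU (Pt0 t) Iu). Qed.

Let near_seg (t : R) : I01 t -> \forall s \near t, hol_pos U phi (seg s).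
Proof.
move=> It; have [dt _] := dseg t.
have := differentiable_continuous ((derivable1_diffP _ _).1 dt).
by apply; apply: open_nbhs_nbhs; split; [exact: open_hol_pos|exact: hseg].
Qed.

(** Off the zeros, H = phi(X)/phi(x) and X has velocity phi(x) J e; at a zero, H is affine in P.
    Both give dphi(J e). *)
Lemma holC_seg_derive (t u : R) : I01 t -> I01 u ->
  is_derive t 1 (fun s : R => holC phi (seg s) u) (dphiJ phi ((seg t).1 u, e u)).
Proof.
move=> It Iu.
have dP : is_derive t 1 (fun s : R => (P + s *: e) u) (e u).
  exact: (is_derive_clinear (clinear_C1_eval R2 u) (is_derive_affine P e t)).
have nH := near_seg It.
have [px|px] := eqVneq (phi x) 0.
  have hE (s : R) : h phi (x, (P + s *: e) u) = 1 + 'd phi x (J ((P + s *: e) u)).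
    by rewrite (hE0 sphi (p := (x, _)) Ux px).
  have xt : (seg t).1 u = x by rewrite (seg1 t Iu) px scale0r addr0.
  have h1 := is_derive_clinear (clinear_diffJ sphi Ux) dP.
  have h2 : is_derive t 1 (fun s : R => 1 + 'd phi x (J ((P + s *: e) u)) : R) (dphiJ phi ((seg t).1 u, e u)).
    by apply: (is_derive_eq (is_deriveD (is_derive_cst (1 : R) t 1) h1)); rewrite add0r xt.
  apply: (near_eq_is_derive _ h2); apply: filterS nH => s hs.
  by rewrite (holC_seg Iu hs) hE.
have d1 : is_derive t 1 (fun s : R => (seg s).1 u) (phi x *: J (e u)).
  have := is_derive_clinear (clinear_comp (clinear_fst (C1 R2) (C0 R2)) (clinear_C1_eval R2 u)) (dseg t).
  by move/is_derive_eq; apply; rewrite /= C1Z (C1mapE e (@clinear_J R) Iu).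
have dp := smooth_differentiable sphi ((hseg It).1 u Iu).
have h1 := is_derive_clinear (clinear_scale (phi x)^-1 (clinear_id R)) (is_derive_comp_diff d1 dp).
have h2 : is_derive t 1 (fun s : R => (phi x)^-1 *: phi ((seg s).1 u)) (dphiJ phi ((seg t).1 u, e u)).
  apply: (is_derive_eq h1); rewrite linearZ /GRing.scale/= mulrA mulVf// mul1r.
  by [].
apply: (near_eq_is_derive _ h2); apply: filterS nH => s hs.
by rewrite (holC_seg Iu hs) (hE px) segE (solE _ _ _ Iu) /GRing.scale/= mulrC.
Qed.

(* The symmetry is [beta = e / H]. *)
Lemma of_lin_seg_symmetry (t : R) : I01 t ->
  symmetry phi (of_lin phi (seg t)) ('d (of_lin phi) (seg t) v).
Proof.
move=> It; have hb := hseg It; have [sU hp] := hb.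
pose H := holC phi (seg t); pose iH : C0 R := C0map (fun r : R => r^-1) H.
have Hn0 u : I01 u -> H u != 0 by move=> Iu; rewrite gt_eqF// hp.
have iHE u : I01 u -> iH u = (H u)^-1 by move=> Iu; apply: invCE hb Iu.
have dO := is_derive_comp_diff (dseg t) (smooth_differentiable (smooth_of_lin openU sphi) hb).
set D := 'd _ _ _ in dO *.
pose L := logd phi (seg t).
(* The derivative e'/H - (H'/H^2) e of beta, with H' = L. *)
pose bD : C0 R2 := C0mul (iH, C1_deriv e) - C0mul (iH, C0mul (iH, C0mul (L, C1val e))).
have bDE u : I01 u -> bD u = (H u)^-1 *: C1_deriv e u
    - ((H u)^-1 * (H u)^-1 * L u) *: e u.
  move=> Iu; have m (k : C0 R) (f : C0 R2) : C0mul (k, f) u = k u *: f u by exact: C0mulE.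
  by rewrite /bD C0B !m (iHE u Iu) !scalerA.
have dH (u : R) : `]0, 1[%classic u -> is_derive u 1 H (L u).
  move=> u01; have h1 : is_derive u 1 (fun s : R => 1 + prim L s) (L u).
    apply: (is_derive_eq (is_deriveD (is_derive_cst (1 : R) u 1) (C1_is_derive (prim L) u01))).
    by rewrite add0r (prim_deriv L).
  apply: (near_eq_is_derive _ h1); have := near_oo u01; apply: filterS => s /I01_oo Is.
  by rewrite /H (holCE _ _ Is).
have cb : {within I01, continuous (fun s : R => (H s)^-1 *: e s)}.
  apply: (@cont01_eq _ _ (C0mul (iH, C1val e))); last exact: C0_continuous.
  by move=> s Is; rewrite -(iHE s Is); exact: (C0mulE (iH, C1val e) Is).
have db (u : R) : `]0, 1[%classic u -> is_derive u 1 (fun s : R => (H s)^-1 *: e s) (bD u).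
  move=> u01; have Iu := I01_oo u01.
  apply: (is_derive_eq (is_derive_scale (is_deriveV (Hn0 u Iu) (dH u u01)) (C1_is_derive e u01))).
  by rewrite (bDE u Iu); exact: invr_scale_derive.
have bE u : I01 u -> C1of (fun s : R => (H s)^-1 *: e s) bD u = (H u)^-1 *: e u.
  by move=> Iu; rewrite (C1ofE cb db Iu).
apply/(symmetryP sphi (b := of_lin phi (seg t)) D sU).
exists (C1of (fun s : R => (H s)^-1 *: e s) bD).
  have e0 : e 0 = 0 by rewrite C1B P0 Q0 subrr.
  have e1 : e 1 = 0 by have [_ _ PQ1 _] := PQ; rewrite C1B PQ1 subrr.
  by split; rewrite bE ?e0 ?e1 ?scaler0//; [exact: I01_0|exact: I01_1].
move=> u Iu; rewrite (C1of_deriv cb db) (bE u Iu) (bDE u Iu); split.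
  (* The component X: as phi(X) = phi(x) H, phi(X) J (e/H) is the velocity phi(x) J e of the
     segment. *)
  have h1 : is_derive t 1 (fun s : R => (seg s).1) D.1.
    exact: (is_derive_clinear (clinear_fst (C1 R2) (C0 R2)) dO).
  have h2 : is_derive t 1 (fun s : R => (seg s).1) v.1.
    exact: (is_derive_clinear (clinear_fst (C1 R2) (C0 R2)) (dseg t)).
  have -> : D.1 = v.1 by have [_ <-] := h1; have [_ <-] := h2.
  have So := of_lin_solution openU sphi (Sseg It).
  rewrite (phi_solution openU sphi So Iu) (expC_of_lin openU sphi hb Iu).
  have -> : (of_lin phi (seg t)).1 0 = x.
    by rewrite /= (seg1 t (I01_0 R)) Pt0 J0 scaler0 addr0.
  rewrite C1Z (C1mapE e (@clinear_J R) Iu) JZ scalerA mulfK//.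
  exact: Hn0.
have cu := clinear_comp (clinear_snd (C1 R2) (C0 R2)) (clinear_C0_eval R2 u).
have h1 : is_derive t 1 (fun s : R => (of_lin phi (seg s)).2 u) (D.2 u).
  exact: (is_derive_clinear cu dO).
have h2 : is_derive t 1 (fun s : R => (seg s).2 u) (C1_deriv e u).
  exact: (is_derive_clinear cu (dseg t)).
have h3 := is_derive_scale (@is_deriveV R (fun s : R => holC phi (seg s) u) t _ 1 (Hn0 u Iu) (holC_seg_derive It Iu)) h2.
have DE : D.2 u = (H u)^-1 *: C1_deriv e u
    - ((H u)^-1 * (H u)^-1 * dphiJ phi ((seg t).1 u, e u)) *: (seg t).2 u.
  have h4 : is_derive t 1 (fun s : R => (of_lin phi (seg s)).2 u) ((H u)^-1 *: C1_deriv e u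
      - ((H u)^-1 * (H u)^-1 * dphiJ phi ((seg t).1 u, e u)) *: (seg t).2 u).
    apply: (near_eq_is_derive _ (is_derive_eq h3 (invr_scale_derive _ _ _ _))).
    by have := near_seg It; apply: filterS => s hs; rewrite (of_linE hs Iu).
  by have [_ <-] := h1; have [_ <-] := h4.
have LE : L u = dphiJ phi ((seg t).1 u, (seg t).2 u) by exact: (logdE openU sphi sU Iu).
rewrite DE (of_linE hb Iu) !dphiJ_scale -/H LE.
exact: symmetry_algebra.
Qed.

Lemma straight_joined : joined (solutions U phi) (symmetry phi)
  (of_lin phi (sol phi x P)) (of_lin phi (sol phi x Q)).
Proof.
have sO := smooth_of_lin openU sphi.
have dc (t : R) : I01 t -> is_derive t 1 (of_lin phi \o seg) ('d (of_lin phi) (seg t) v).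
  by move=> It; exact: (is_derive_comp_diff (dseg t) (smooth_differentiable sO (hseg It))).
exists (of_lin phi \o seg); split.
- by rewrite /= segE scale0r addr0.
- by rewrite /= segE scale1r addrC subrK.
- move=> t It; split; [exact/(of_lin_solution openU sphi)/Sseg|by have [] := dc t It|].
  rewrite (@derive_val _ _ _ _ _ _ _ (dc t It)); exact: of_lin_seg_symmetry.
apply: (@cont01_eq R B (fun t : R => 'd (of_lin phi) (seg t) v)).
  by move=> t It; rewrite (@derive_val _ _ _ _ _ _ _ (dc t It)).
have cs : {within I01, continuous (fun t : R => (seg t, v))}.
  apply: path_continuous => t _.
  by have [] := is_derive_pair (dseg t) (is_derive_cst v t 1).
apply: (cont01_comp_at (f := fun p : B * B => 'd (of_lin phi) (p.1) p.2) cs) => t It.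
by apply: (smooth_continuous (smooth_tangent sO)); split=> //; exact: hseg.
Qed.

End Straight.
Hypothesis leafsc : forall x, U x -> simply_connected (leaf U phi x).

Lemma joinedP s s' : solutions U phi s -> solutions U phi s' ->
  joined (solutions U phi) (symmetry phi) s s' <->
  (@ends R \o to_lin phi) s = (@ends R \o to_lin phi) s'.
Proof.
move=> Ss Ss'; split; first exact: tilde_joined_ends.
have [sU Ls] := (solutions_lin openU sphi s).1 Ss.
have [sU' Ls'] := (solutions_lin openU sphi s').1 Ss'.
have [x [P [P0 PW sE]]] := lin_solution_sol openU sphi Ls.
have [y [Q [Q0 QW s'E]]] := lin_solution_sol openU sphi Ls'.
rewrite /= sE s'E !ends_sol// => -[xy PQ]; subst y.
have Ux : U x by have [] := PW 0 (I01_0 R).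
rewrite -(to_linK openU sphi sU) -(to_linK openU sphi sU') sE s'E.
have SP : solutions U phi (of_lin phi (sol phi x P)).
  by rewrite -sE (to_linK openU sphi sU).
have := fibre_chain openU sphi leafsc Ux P0 Q0 PQ PW QW.
apply: (@clos_joined R _ _ _ (fun P => of_lin phi (sol phi x P))) => //.
- exact: symmetryZ.
- exact: symmetry0.
- by move=> P1 P2; exact: straight_joined.
Qed.

Lemma solutions_quotient :
  quotient_diffeomorphic_to (solutions U phi) (symmetry phi) (groupoid U phi).
Proof.
apply: (@quotient_diffeomorphic _ _ _ _ _ _ (@ends R \o to_lin phi) _ _ _ _ _
  (R2 * C0 R2)%type (C0 R2) (inU U)).
- exact: R2R2_split.
- exact: open_groupoid.
- by move=> s /(solutions_lin openU sphi)[_]; exact: lin_ends_groupoid.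
- move=> y /(groupoid_lin_ends openU sphi leafsc)[s Ss <-].
  exists (of_lin phi s); first exact: of_lin_solution.
  have [hs _] := (lin_solutionsP openU sphi s).1 Ss.
  by rewrite /= (of_linK openU sphi hs).
- exact: joinedP.
- move=> s /(solutions_lin openU sphi)[sU _]; exists (inU U), (slice phi \o to_lin phi).
  by split=> //; exact: slice_chart_to_lin.
- by move=> s /(solutions_lin openU sphi)[].
- exact: smooth_ends_to_lin.
- exact: tilde_section.
Qed.

End TildeTheorem.

Theorem theorem7p7 (R : realType) (U : set 'rV[R]_2) (phi : 'rV[R]_2 -> R)
  (U_open : open U) (U_connected : connected U) (U_nonempty : U !=set0)
  (phi_smooth : smooth_on U phi)
  (leaves_simply_connected :
     forall x, U x -> simply_connected (leaf U phi x)) :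
  quotient_diffeomorphic_to (solutions U phi) (symmetry phi) (groupoid U phi) /\
  quotient_diffeomorphic_to (lin_solutions U phi) (lin_symmetry phi)
    (groupoid U phi).
Proof. by split; [exact: solutions_quotient|exact: lin_quotient]. Qed.
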